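(* (Ihara–Sunada formula.) Let $X$ be a connected weighted graph of bounded valency, possibly infinite, of finite total weight, and let $Z(u)$ be its Ihara zeta function. The entire function $Z(u)^{-1}$ can be written as $$Z(u)^{-1}=\det\left(1-u\tau(1+uJ)^{-1}\sigma\right)\,\prod_{e\in EX}\left(1-u^2W(e)\right)$$ (an identity of formal power series in $u$), where the product over all edges $e$ converges to an entire function with zeros at $\pm1/\sqrt{W(e)}$, $e$ running through the set of edges $EX$.
   Context: Graph: $X$ is a connected (simple, undirected) graph with vertex set $VX$ and edge set $EX$ consisting of two-element subsets of $VX$; $X$ may be infinite, but has bounded valency (there is $M>0$ such that every vertex has at most $M$ neighbours). $\mathrm{OE}$ is the set of oriented edges (each edge gives two); for $e\in \mathrm{OE}$, $o(e)$ is the starting vertex, $\tau(e)$ the terminal vertex, $e^{-1}$ the reverse of $e$. Weight: $w:\mathrm{OE}\to(0,\infty)$ with finite total weight $\sum_{e\in \mathrm{OE}}w(e)<\infty$. For adjacent $x,x'$, $w(x,x')$ is the weight of the oriented edge from $x$ to $x'$. For $e\in EX$ with orientations $e_1,e_2$ put $W(e)=w(e_1)w(e_2)$. A path is a sequence $p=(x_0,\dots,x_n)$ of vertices with consecutive vertices adjacent; its length is $l(p)=n$ and its weight is $w(p)=w(x_0,x_1)\cdots w(x_{n-1},x_n)$. Cycles: a path of length $n\ge1$ is closed if $x_n=x_0$. It is reduced if $x_{j-1}\ne x_{j+1}$ for all $1\le j\le n-1$. A closed path has a tail if $x_1=x_{n-1}$. A cycle is an equivalence class of closed paths under the equivalence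 relation generated by $(x_0,x_1,\dots,x_n)\sim(x_1,x_2,\dots,x_n,x_1)$. A regular cycle is a cycle all of whose members are reduced and without tail. A cycle is prime if it is not a power of a shorter one. Zeta function: $Z(u)=\prod_p(1-w(p)u^{l(p)})^{-1}$ over all regular prime cycles $p$; the product converges for small $|u|$, and $Z(u)^{-1}$ denotes also its extension to an entire function. Operators: $C_0=\ell^2(VX)$ and $C_1=\ell^2(\mathrm{OE})$ are the Hilbert spaces with orthonormal bases the vertices, respectively the oriented edges. $\sigma:C_0\to C_1$, $\sigma(x)=\sum_{e:\,o(e)=x}w(e)e$; $\tau:C_1\to C_0$ is the linear extension of $e\mapsto\tau(e)$; $J:C_1\to C_1$, $J(e)=w(e^{-1})e^{-1}$. Thus $1-u\tau(1+uJ)^{-1}\sigma=1+\sum_{n\ge1}(-u)^n\tau J^{n-1}\sigma$. Determinant: for a formal power series $1+T(u)=1+T_1u+T_2u^2+\cdots$ with trace class coefficients $T_j$, the Fredholm determinant is the formal power series $\det(1+T(u))=\sum_{k\ge0}\operatorname{tr}\bigwedge^kT(u)$. *)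

(* Defs.v *)
From HB Require Import structures.
From Stdlib Require Import Relation_Operators.
From mathcomp Require Import all_boot all_order all_algebra finmap generic_quotient.
From mathcomp Require Import all_classical all_reals all_analysis.
From mathcomp Require Import summability complex ring lra.

Set Implicit Arguments.
Unset Strict Implicit.
Unset Printing Implicit Defensive.

Import Order.TTheory GRing.Theory Num.Theory.
Import numFieldNormedType.Exports.

Local Open Scope classical_set_scope.
Local Open Scope complex_scope.
Local Open Scope ring_scope.
Local Open Scope quotient_scope.

Notation normc := ComplexField.Normc.normc.

(* [R[i]^o] is [R[i]] seen as a normed space over itself, so derivability in
   the direction 1 is complex differentiability. *)
Definition entire (R : realType) (f : R[i]^o -> R[i]^o) : Prop :=
  forall z, derivable f z 1.

Definition taylor (R : realType) (f : R[i]^o -> R[i]^o) (n : nat) : R[i] :=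
  derive1n n f 0 / n`!%:R.

Definition fps_mul (R : realType) (a b : nat -> R[i]) (n : nat) : R[i] :=
  \sum_(k < n.+1) a k * b (n - k)%N.

(* [f] vanishes at [z] to order exactly [m] ([m = 0]: it does not vanish). *)
Definition zero_of_order (R : realType) (f : R[i]^o -> R[i]^o) (z : R[i])
    (m : nat) : Prop :=
  exists g : R[i]^o -> R[i]^o,
    [/\ entire g, g z != 0 & forall u, f u = (u - z) ^+ m * g u].

Definition partial_prod (R : realType) (I : choiceType) (f : I -> R[i])
    (A : {fset I}) : R[i]^o :=
  \prod_(i <- A) f i.

(* Unconditional: [totally] is the filter of finite subsets ordered by
   inclusion. *)
Definition iprod (R : realType) (I : choiceType) (f : I -> R[i]) : R[i]^o :=
  lim (partial_prod f @ totally).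

Definition isum (R : realType) (I : choiceType) (f : I -> R[i]) : R[i]^o :=
  summability.sum (f : I -> R[i]^o).

Definition sqnorm (R : realType) (I : choiceType) (f : I -> R[i]) : \bar R :=
  \esum_(i in [set: I]) (normc (f i) ^+ 2)%:E.

Definition l2_pred (R : realType) (I : choiceType) : {pred I -> R[i]} :=
  fun f => `[< (sqnorm f < +oo)%E >].

Section L2.
Variables (R : realType) (I : choiceType).
Implicit Types f g : I -> R[i].

Lemma l2P f : reflect (sqnorm f < +oo)%E (f \in @l2_pred R I).
Proof. exact: asboolP. Qed.

Lemma normcD_sq (a b : R[i]) :
  normc (a + b) ^+ 2 <= 2 * normc a ^+ 2 + 2 * normc b ^+ 2.
Proof.
have nge0 (z : R[i]) : 0 <= normc z by case: z => ? ? /=; exact: sqrtr_ge0.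
have /le_trans : normc (a + b) ^+ 2 <= (normc a + normc b) ^+ 2.
  by rewrite ler_pXn2r ?nnegrE ?addr_ge0// le_normcD.
apply; rewrite -subr_ge0.
rewrite [X in 0 <= X](_ : _ = (normc a - normc b) ^+ 2) ?sqr_ge0//.
by rewrite !expr2; ring.
Qed.

Lemma sqnorm_ge0 f : (0 <= sqnorm f)%E.
Proof. by apply: esum_ge0 => i _; rewrite lee_fin sqr_ge0. Qed.

Lemma sqnormZ_le a f : (sqnorm (a *: f)%R <= (normc a ^+ 2)%:E * sqnorm f)%E.
Proof.
apply: ge_ereal_sup => _ [A [finA _] <-].
have -> : (\sum_(i \in A) (normc ((a *: f) i) ^+ 2)%:E =
    (normc a ^+ 2)%:E * \sum_(i \in A) (normc (f i) ^+ 2)%:E)%E.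
  rewrite !fsbig_finite//= ge0_sume_distrr; last first.
    by move=> i _; rewrite lee_fin sqr_ge0.
  by apply: eq_bigr => i _; rewrite -EFinM -exprMn -ComplexField.Normc.normcM.
apply: lee_pmul => //; rewrite ?lee_fin ?sqr_ge0//.
  by rewrite fsbig_finite//= sume_ge0// => i _; rewrite lee_fin sqr_ge0.
by apply: ereal_sup_ubound; exists A.
Qed.

Lemma sqnormD_le f g : (sqnorm (f + g)%R <= 2%:E * sqnorm f + 2%:E * sqnorm g)%E.
Proof.
apply: ge_ereal_sup => _ [A [finA _] <-].
pose S h := (\sum_(i \in A) (normc (h i : R[i]) ^+ 2)%:E)%E.
have S_ge0 h : (0 <= S h)%E.
  by rewrite /S fsbig_finite//= sume_ge0// => i _; rewrite lee_fin sqr_ge0.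
have S_le h : (S h <= sqnorm h)%E by apply: ereal_sup_ubound; exists A.
apply: (@le_trans _ _ (2%:E * S f + 2%:E * S g)%E); last first.
  by apply: leeD; apply: lee_pmul => //; rewrite lee_fin.
rewrite /S !fsbig_finite//= !ge0_sume_distrr; do ?[by move=> i _;
  rewrite lee_fin sqr_ge0]; rewrite -big_split/=.
by apply: lee_sum => i _; rewrite -!EFinM -EFinD lee_fin normcD_sq.
Qed.

Lemma l2_submod : submod_closed (@l2_pred R I).
Proof.
split.
  apply/l2P; rewrite /sqnorm esum1// => i _.
  by rewrite ComplexField.Normc.normc0 expr0n.
move=> a f g /l2P lf /l2P lg; apply/l2P.
apply: (le_lt_trans (sqnormD_le _ _)); apply: lte_add_pinfty; last first.
  by rewrite lte_mul_pinfty ?lee_fin.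
rewrite lte_mul_pinfty ?lee_fin//; apply: (le_lt_trans (sqnormZ_le _ _)).
by rewrite lte_mul_pinfty ?lee_fin ?sqr_ge0.
Qed.

HB.instance Definition _ :=
  GRing.isSubmodClosed.Build R[i] (I -> R[i]) (@l2_pred R I) l2_submod.

Record l2 := L2 { l2val :> I -> R[i]; _ : l2val \in @l2_pred R I }.
HB.instance Definition _ := [isSub for l2val].
HB.instance Definition _ := [Choice of l2 by <:].
HB.instance Definition _ := [SubChoice_isSubLmodule of l2 by <:].

End L2.

Section Operators.
Variable R : realType.
Implicit Types I J : choiceType.

Definition l2norm I (f : l2 R I) : R := Num.sqrt (fine (sqnorm f)).

Lemma sqnorm_delta I (i : I) : sqnorm (fun j => (j == i)%:R : R[i]) = 1%E.
Proof.
have -> : sqnorm (fun j => (j == i)%:R : R[i]) =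
    (\esum_(j in [set: I]) if j \in [set i] then 1%:E else 0)%E.
  apply: eq_esum => j _; rewrite in_set1; case: eqP => _.
    by rewrite ComplexField.Normc.normc1 expr1n.
  by rewrite ComplexField.Normc.normc0 expr0n.
by rewrite -esum_mkcond esum_set1.
Qed.

Lemma delta_l2 I (i : I) : (fun j => (j == i)%:R : R[i]) \in @l2_pred R I.
Proof. by apply/l2P; rewrite sqnorm_delta ltry. Qed.

(* The basis vector attached to [i]. *)
Definition delta I (i : I) : l2 R I := L2 (delta_l2 i).

Definition bounded_linear I J (T : l2 R I -> l2 R J) : Prop :=
  linear T /\ exists M : R, forall f, l2norm (T f) <= M * l2norm f.

Definition hilbert_schmidt I J (T : l2 R I -> l2 R J) : Prop :=
  bounded_linear T /\
  (\esum_(i in [set: I]) (l2norm (T (delta i)) ^+ 2)%:E < +oo)%E.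

(* A product of two Hilbert-Schmidt operators. *)
Definition trace_class I (T : l2 R I -> l2 R I) : Prop :=
  exists A B : l2 R I -> l2 R I,
    [/\ hilbert_schmidt A, hilbert_schmidt B & T = A \o B].

(* For x = (x_1, ..., x_k) and y = (y_1, ..., y_k), the coefficient of u^n in
   < T(u)x_1 /\ ... /\ T(u)x_k , y_1 /\ ... /\ y_k >,  T(u) = sum_m T_m u^m,
   where < v_1 /\ ... /\ v_k , w_1 /\ ... /\ w_k > = det < v_a , w_b >.  The
   entry < v , y_b > is the coordinate of v at y_b. *)
Definition wedge_coef I (T : nat -> l2 R I -> l2 R I) (k : nat)
    (x y : 'I_k -> I) (n : nat) : R[i] :=
  \sum_(m : {ffun 'I_k -> 'I_n.+1} | (\sum_a m a)%N == n)
     \det (\matrix_(a < k, b < k) T (m a) (delta (x a)) (y b)).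

(* The k-element subsets A = {x_1, ..., x_k} index the orthonormal basis
   x_1 /\ ... /\ x_k of the k-th exterior power. *)
Definition ksubset I (k : nat) := {A : {fset I} | #|` A| == k}.

Definition ksubset_enum I k (A : ksubset I k) (a : 'I_k) : I :=
  tnth (Tuple (valP A)) a.

(* Coefficient of u^n in the trace of the k-th exterior power of T(u). *)
Definition wedge_trace I (T : nat -> l2 R I -> l2 R I) (k n : nat) : R[i] :=
  isum (fun A : ksubset I k =>
          wedge_coef T (ksubset_enum A) (ksubset_enum A) n).

(* Coefficient of u^n in det(1 + T(u)) for T(u) = T_1 u + T_2 u^2 + ..., i.e.
   [T 0 = 0]; the k-th exterior power of T(u) is then divisible by u^k, so that
   k <= n suffices. *)
Definition fredholm_det I (T : nat -> l2 R I -> l2 R I) (n : nat) : R[i] :=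
  \sum_(k < n.+1) wedge_trace T k n.

End Operators.

(* [weight x y] is only meaningful, and only used, for adjacent [x] and [y]. *)
Record wgraph (R : realType) (V : choiceType) := WGraph {
  adj : rel V;
  adj_sym : symmetric adj;
  adj_irrefl : irreflexive adj;
  adj_connected : forall x y, exists p : seq V, path adj x p /\ last x p = y;
  bounded_valency : exists M : nat, forall (x : V) (A : {fset V}),
    (forall y, y \in A -> adj x y) -> (#|` A| <= M)%N;
  weight : V -> V -> R;
  weight_gt0 : forall x y, adj x y -> 0 < weight x y;
  total_weight_lty :
    (\esum_(e in [set: {e : V * V | adj e.1 e.2}])
       (weight (val e).1 (val e).2)%:E < +oo)%E }.

Section Graph.
Variables (R : realType) (V : choiceType) (X : wgraph R V).

Definition oedge := {e : V * V | adj X e.1 e.2}.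

Definition org (e : oedge) : V := (val e).1.
Definition ter (e : oedge) : V := (val e).2.

Lemma erev_subproof (e : oedge) : adj X (ter e) (org e).
Proof. by rewrite adj_sym; exact: valP e. Qed.

Definition erev (e : oedge) : oedge :=
  exist _ (ter e, org e) (erev_subproof e).

Definition wt (e : oedge) : R := weight X (org e) (ter e).

(* EX, as two-element sets of vertices. *)
Definition uedge := {A : {fset V} |
  `[< exists x y, adj X x y /\ A = [fset x; y]%fset >]}.

(* For the edge {x, y} this is [weight X x y * weight X y x]. *)
Definition edge_weight (e : uedge) : R :=
  \prod_(x <- val e) \prod_(y <- val e | adj X x y) weight X x y.

Definition edge_factor (u : R[i]) (e : uedge) : R[i] :=
  1 - u ^+ 2 * (edge_weight e)%:C.

Definition edge_prod : R[i]^o -> R[i]^o := fun u => iprod (edge_factor u).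

(* z = 1/sqrt(W(e)) or z = -1/sqrt(W(e)) *)
Definition edge_zero (e : uedge) (z : R[i]) : Prop :=
  z = ((Num.sqrt (edge_weight e))^-1)%:C \/
  z = - ((Num.sqrt (edge_weight e))^-1)%:C.

(* The operators [sigma], [tau], [J] in coordinates; their values on basis
   vectors are given by [sigma_delta], [tau_delta] and [J_delta]. *)
Section GraphOperators.

Let B := fine (\esum_(e in [set: oedge]) (wt e)%:E).

Lemma wt_ge0 e : 0 <= wt e.
Proof. by apply/ltW/weight_gt0; exact: valP e. Qed.

Let total_weightE : (\esum_(e in [set: oedge]) (wt e)%:E = B%:E)%E.
Proof.
rewrite fineK// ge0_fin_numE ?(total_weight_lty X)//.
by apply: esum_ge0 => e _; rewrite lee_fin wt_ge0.
Qed.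

Let sum_wt_le (A : set oedge) : finite_set A ->
  (\sum_(e \in A) (wt e)%:E <= B%:E)%E.
Proof.
by move=> fA; rewrite -total_weightE; apply: ereal_sup_ubound; exists A.
Qed.

Let B_ge0 : 0 <= B.
Proof. by rewrite -lee_fin -total_weightE esum_ge0// => e _; rewrite lee_fin wt_ge0. Qed.

Let wt_le e : wt e <= B.
Proof.
by have := sum_wt_le (finite_set1 e); rewrite fsbig_set1 lee_fin.
Qed.

Lemma sqnorm_fin (I : choiceType) (f : l2 R I) : sqnorm f \is a fin_num.
Proof. by rewrite ge0_fin_numE ?sqnorm_ge0//; apply/l2P; case: f. Qed.

Lemma sqr_coord_le (I : choiceType) (f : l2 R I) i :
  ((normc (f i) ^+ 2)%:E <= sqnorm f)%E.
Proof.
apply: ereal_sup_ubound; exists [set i]; first by split.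
by rewrite fsbig_set1.
Qed.

Lemma normcC (r : R) : normc r%:C = `|r|.
Proof. by rewrite /= expr0n/= addr0 sqrtr_sqr. Qed.

Lemma sqnorm_wt (I : choiceType) (f : l2 R I) (h : oedge -> I) :
  (sqnorm (fun e => (wt e)%:C * f (h e))%R <= (B ^+ 2)%:E * sqnorm f)%E.
Proof.
rewrite -[sqnorm f]fineK ?sqnorm_fin//; set N := fine _.
have N_ge0 : 0 <= N by rewrite -lee_fin fineK ?sqnorm_fin// sqnorm_ge0.
have fN i : normc (f i) ^+ 2 <= N.
  by rewrite -lee_fin fineK ?sqnorm_fin// sqr_coord_le.
apply: ge_ereal_sup => _ [A [finA _] <-].
apply: (@le_trans _ _ ((B * N)%:E * \sum_(e \in A) (wt e)%:E)%E).
  rewrite !fsbig_finite//= ge0_sume_distrr; last first.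
    by move=> e _; rewrite lee_fin wt_ge0.
  apply: lee_sum => e _; rewrite -EFinM lee_fin.
  rewrite ComplexField.Normc.normcM normcC ger0_norm ?wt_ge0// exprMn.
  rewrite expr2 -[leLHS]mulrA [leRHS]mulrC; apply: ler_wpM2l.
    exact: wt_ge0.
  by apply: ler_pM; rewrite ?wt_ge0 ?sqr_ge0 ?wt_le.
apply: (@le_trans _ _ ((B * N)%:E * B%:E)%E).
  by apply: lee_pmul; rewrite ?lee_fin ?mulr_ge0// ?sum_wt_le//;
    rewrite fsbig_finite//= sume_ge0// => e _; rewrite lee_fin wt_ge0.
by rewrite -!EFinM lee_fin expr2 mulrAC.
Qed.

Lemma l2_wt (I : choiceType) (f : l2 R I) (h : oedge -> I) :
  (fun e => (wt e)%:C * f (h e)) \in @l2_pred R oedge.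
Proof.
apply/l2P; apply: (le_lt_trans (sqnorm_wt f h)).
by rewrite lte_mul_pinfty ?lee_fin ?sqr_ge0//; apply/l2P; case: f.
Qed.

(* (sigma f)(e) = w(e) f(o(e)) *)
Definition sigma (f : l2 R V) : l2 R oedge := L2 (l2_wt f org).

(* (J g)(e) = w(e) g(e^-1) *)
Definition J (g : l2 R oedge) : l2 R oedge := L2 (l2_wt g erev).

Let ter_bounded : exists M : nat, forall (x : V) (A : {fset oedge}),
  (forall e, e \in A -> ter e = x) -> (#|` A| <= M)%N.
Proof.
have [M HM] := bounded_valency X; exists M => x A Ax.
have orgA : {in A &, injective org}.
  move=> e f /Ax ex /Ax fx ef; apply: val_inj.
  rewrite [LHS]surjective_pairing [RHS]surjective_pairing; congr (_, _) => //.
  by rewrite -/(ter e) -/(ter f) ex fx.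
rewrite -(card_in_imfset imfset_key orgA); apply: (HM x) => y.
move=> /imfsetP[e /= /Ax <- ->]; rewrite adj_sym; exact: valP e.
Qed.

Lemma finite_ter (x : V) : finite_set [set e : oedge | ter e = x].
Proof.
have [M HM] := ter_bounded.
apply: contrapT => /(infinite_set_fset M.+1)[A Ax]; apply/negP; rewrite -ltnNge.
by rewrite ltnS (HM x)// => e /Ax.
Qed.

Definition tau_fun (g : oedge -> R[i]) (x : V) : R[i] :=
  \sum_(e \in [set e | ter e = x]) g e.

Let sqr_sum_le (s : seq oedge) (g : oedge -> R[i]) :
  normc (\sum_(e <- s) g e) ^+ 2 <=
  (2 ^ size s)%:R * \sum_(e <- s) normc (g e) ^+ 2.
Proof.
elim: s => [|e s IH]; first by rewrite !big_nil ComplexField.Normc.normc0 mulr0 expr0n.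
rewrite !big_cons/=; apply: (le_trans (normcD_sq _ _)).
rewrite expnS natrM -mulrA mulrDr [leRHS]mulrDr; apply: lerD; rewrite ler_pM2l//.
by rewrite ler_peMl ?sqr_ge0// ler1n expn_gt0.
Qed.

Let tau_sqnorm : exists K : R, 0 <= K /\
  forall g : l2 R oedge, (sqnorm (tau_fun g) <= K%:E * sqnorm g)%E.
Proof.
have [M HM] := ter_bounded; exists (2 ^ M)%:R; split => // g.
have -> : sqnorm g = (\esum_(x in [set: V]) \esum_(e in [set e | ter e = x])
   (normc (g e) ^+ 2)%:E)%E.
  rewrite esum_esum; last by move=> *; rewrite lee_fin sqr_ge0.
  rewrite /sqnorm (@reindex_esum _ _ _
    ([set: V] `*`` (fun x => [set e | ter e = x])) setT (fun k => k.2))//.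
  split=> // [[x e] [y f]|e _].
    by rewrite !inE/= => -[_ <-] [_ <-] ->.
  by exists (ter e, e).
apply: ge_ereal_sup => _ [A [finA _] <-].
apply: (@le_trans _ _ ((2 ^ M)%:R%:E * \sum_(x \in A)
   \esum_(e in [set e | ter e = x]) (normc (g e) ^+ 2)%:E)%E).
  rewrite !fsbig_finite//= ge0_sume_distrr; last first.
    by move=> x _; apply: esum_ge0 => e _; rewrite lee_fin sqr_ge0.
  apply: lee_sum => x _; rewrite esum_fset; last 2 first.
  - exact: finite_ter.
  - by move=> e _; rewrite lee_fin sqr_ge0.
  rewrite /tau_fun !fsbig_finite/=; do ?exact: finite_ter.
  rewrite sumEFin -EFinM lee_fin; apply: (le_trans (sqr_sum_le _ _)).
  apply: ler_wpM2r; first by apply: sumr_ge0 => e _; rewrite sqr_ge0.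
  rewrite ler_nat leq_exp2l//; apply: (HM x) => e.
  by rewrite in_fset_set ?inE//; exact: finite_ter.
apply: lee_pmul; rewrite ?lee_fin//.
  rewrite fsbig_finite// sume_ge0// => x _.
  by apply: esum_ge0 => e _; rewrite lee_fin sqr_ge0.
by apply: ereal_sup_ubound; exists A.
Qed.

Lemma l2_tau (g : l2 R oedge) : tau_fun g \in @l2_pred R V.
Proof.
have [K [K0 HK]] := tau_sqnorm; apply/l2P; apply: (le_lt_trans (HK g)).
by rewrite lte_mul_pinfty ?lee_fin//; apply/l2P; case: g.
Qed.

(* (tau g)(x) = sum of g(e) over the oriented edges e ending at x *)
Definition tau (g : l2 R oedge) : l2 R V := L2 (l2_tau g).

Let l2_sumE (I : choiceType) (s : seq I) (F : I -> l2 R I) i :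
  (\sum_(j <- s) F j : l2 R I) i = \sum_(j <- s) F j i.
Proof. by elim/big_ind2: _ => // a b c d <- <-. Qed.

Lemma finite_org (x : V) : finite_set [set e : oedge | org e = x].
Proof.
apply: (@sub_finite_set _ _ (erev @` [set e | ter e = x])).
  by move=> e ex; exists (erev e) => //; apply: val_inj; case: e ex => -[].
exact/finite_image/finite_ter.
Qed.

Let l2_scaleE (I : choiceType) a (f : l2 R I) i : (a *: f) i = a * f i.
Proof. by []. Qed.

Let deltaE (I : choiceType) (i j : I) : delta R i j = (j == i)%:R.
Proof. by []. Qed.

Lemma sigma_delta (x : V) :
  sigma (delta R x) = \sum_(e \in [set e | org e = x]) (wt e)%:C *: delta R e.
Proof.
apply/val_inj/funext => f; rewrite fsbig_finite; last exact: finite_org.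
rewrite -[LHS]/((wt f)%:C * delta R x (org f)) deltaE.
rewrite (_ : val _ f = \sum_(e <- fset_set [set e | org e = x])
  ((wt e)%:C *: delta R e : l2 R oedge) f); last exact: l2_sumE.
under eq_bigr do rewrite l2_scaleE deltaE.
case: eqP => [fx|fx].
  rewrite (big_fsetD1 f); last by rewrite in_fset_set ?inE//; exact: finite_org.
  rewrite eqxx big_seq big1 => [|e]; first by rewrite /= addr0.
  by move=> /fsetD1P[/eqP ef _]; case: eqP => [/esym//|_]; rewrite mulr0.
rewrite mulr0 big_seq big1// => e.
rewrite in_fset_set; last exact: finite_org.
by rewrite inE => /= ex; case: eqP => [fe|_]; [case: fx; rewrite fe|rewrite mulr0].
Qed.

Lemma tau_delta (e : oedge) : tau (delta R e) = delta R (ter e).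
Proof.
apply/val_inj/funext => x /=; rewrite /tau_fun fsbig_finite/=; last first.
  exact: finite_ter.
case: eqP => [xe|xe].
  rewrite (big_fsetD1 e)/=; last by rewrite in_fset_set ?inE//; exact: finite_ter.
  rewrite eqxx big_seq big1 ?addr0// => f.
  by rewrite !inE => /andP[/negbTE -> _].
rewrite big_seq big1// => f; rewrite in_fset_set ?inE//=; last exact: finite_ter.
by move=> fx; case: eqP => // fe; case: xe; rewrite -fx fe.
Qed.

Lemma erevK : involutive erev.
Proof. by move=> [[x y] e]; apply: val_inj. Qed.

Lemma J_delta (e : oedge) :
  J (delta R e) = (wt (erev e))%:C *: delta R (erev e).
Proof.
apply/val_inj/funext => f.
rewrite -[LHS]/((wt f)%:C * delta R e (erev f)) deltaE (can2_eq erevK erevK).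
rewrite -[RHS]/((wt (erev e))%:C * delta R (erev e) f) deltaE.
by case: eqP => [->//|_]; rewrite !mulr0.
Qed.

Lemma bounded_of_sqnorm (I I' : choiceType) (T : l2 R I -> l2 R I') (K : R) :
  0 <= K -> linear T -> (forall f, sqnorm (T f) <= K%:E * sqnorm f)%E ->
  bounded_linear T.
Proof.
move=> K0 linT HK; split=> //; exists (Num.sqrt K) => f.
rewrite /l2norm -sqrtrM// ler_wsqrtr// -lee_fin EFinM !fineK ?sqnorm_fin//.
Qed.

Lemma sigma_bounded : bounded_linear sigma.
Proof.
apply: (@bounded_of_sqnorm _ _ _ (B ^+ 2)); rewrite ?sqr_ge0//.
- move=> a f g; apply/val_inj/funext => e /=.
  by rewrite mulrDr mulrCA.
- by move=> f; exact: sqnorm_wt.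
Qed.

Lemma J_bounded : bounded_linear J.
Proof.
apply: (@bounded_of_sqnorm _ _ _ (B ^+ 2)); rewrite ?sqr_ge0//.
- move=> a f g; apply/val_inj/funext => e /=.
  by rewrite mulrDr mulrCA.
- by move=> f; exact: sqnorm_wt.
Qed.

Lemma tau_bounded : bounded_linear tau.
Proof.
have [K [K0 HK]] := tau_sqnorm; apply: (@bounded_of_sqnorm _ _ _ K) => //.
move=> a f g; apply/val_inj/funext => x.
rewrite -[LHS]/(tau_fun (fun e => a * f e + g e) x).
rewrite -[RHS]/(a * tau_fun f x + tau_fun g x) /tau_fun !fsbig_finite; do ?exact: finite_ter.
by rewrite mulr_sumr -big_split.
Qed.

End GraphOperators.

(* Coefficients of -u tau (1 + uJ)^-1 sigma = sum_(n >= 1) (-u)^n tau J^(n-1) sigma *)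
Definition ihara_coef (n : nat) (f : l2 R V) : l2 R V :=
  if n is m.+1 then (-1) ^+ n *: tau (iter m J (sigma f)) else 0.

Definition is_closed_path (p : seq V) : bool :=
  if p is x0 :: s then [&& path (adj X) x0 s, s != [::] & last x0 s == x0]
  else false.

Definition closed_path := {p : seq V | is_closed_path p}.

Definition path_length (p : seq V) : nat := (size p).-1.

Definition path_weight (p : seq V) : R :=
  if p is x0 :: s then \prod_(a <- pairmap (weight X) x0 s) a else 1.

(* (x_0, x_1, ..., x_n) |-> (x_1, ..., x_n, x_1) *)
Definition path_rot (p : seq V) : seq V :=
  if p is x0 :: x1 :: s then rcons (x1 :: s) x1 else p.

Definition reduced (p : seq V) : Prop :=
  forall (x : V) (j : nat), (j.+2 < size p)%N -> nth x p j != nth x p j.+2.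

(* x_1 = x_(n-1) for p = (x_0, ..., x_n) *)
Definition has_tail (p : seq V) : bool :=
  if p is x0 :: s then nth x0 p 1 == nth x0 p (size s).-1 else false.

Definition path_pow (k : nat) (p : seq V) : seq V :=
  if p is x0 :: s then x0 :: flatten (nseq k s) else p.

Definition cyc_eq (p q : closed_path) : bool :=
  `[< clos_refl_sym_trans closed_path
        (fun p q => val q = path_rot (val p)) p q >].

Lemma cyc_eq_refl : reflexive cyc_eq.
Proof. by move=> p; apply/asboolP/rst_refl. Qed.

Lemma cyc_eq_sym : symmetric cyc_eq.
Proof. by move=> p q; apply/asboolP/asboolP => ?; apply: rst_sym. Qed.

Lemma cyc_eq_trans : transitive cyc_eq.
Proof.
move=> q p r /asboolP pq /asboolP qr; apply/asboolP; exact: rst_trans pq qr.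
Qed.

Canonical cyc_eq_equiv := EquivRel cyc_eq cyc_eq_refl cyc_eq_sym cyc_eq_trans.

Definition gcycle := {eq_quot cyc_eq_equiv}.
HB.instance Definition _ := Choice.on gcycle.
HB.instance Definition _ := Quotient.on gcycle.

(* Length and weight do not depend on the representative. *)
Definition cycle_length (c : gcycle) : nat := path_length (val (repr c)).
Definition cycle_weight (c : gcycle) : R := path_weight (val (repr c)).

Definition regular (c : gcycle) : Prop :=
  forall p : closed_path, \pi_gcycle p = c ->
    reduced (val p) /\ ~~ has_tail (val p).

Definition is_cycle_pow (k : nat) (d c : gcycle) : Prop :=
  exists p q : closed_path,
    [/\ \pi_gcycle p = d, \pi_gcycle q = c & val q = path_pow k (val p)].

Definition prime_cycle (c : gcycle) : Prop :=
  ~ exists (k : nat) (d : gcycle),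
      is_cycle_pow k d c /\ (cycle_length d < cycle_length c)%N.

Definition rpcycle := {c : gcycle | `[< regular c /\ prime_cycle c >]}.

Definition zeta_factor (u : R[i]) (c : rpcycle) : R[i] :=
  (1 - (cycle_weight (val c))%:C * u ^+ cycle_length (val c))^-1.

Definition zeta : R[i]^o -> R[i]^o := fun u => iprod (zeta_factor u).

(* Nonzero limits only; in particular no factor 1 - w(p) u^l(p) vanishes. *)
Definition zeta_converges (u : R[i]) : Prop :=
  cvg (partial_prod (zeta_factor u) @ totally) /\ zeta u != 0.

(* [F] is an entire extension of the germ at 0 of 1/zeta. *)
Definition inverse_zeta (F : R[i]^o -> R[i]^o) : Prop :=
  entire F /\ \forall u \near (0 : R[i]^o), F u = (zeta u)^-1.

End Graph.

(* Main.v *)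
(* For a finite set A of edges let T be the matrix of tau sigma - J on the
   orientations of the edges in A, whose powers count non-backtracking walks by
   weight. A non-backtracking closed walk is a rotation of a power of a unique
   prime cycle, so Newton's identities give
     det(1 - u T) = prod (1 - w(p) u^l(p))   over the prime cycles p inside A,
   while det(1 + M N) = det(1 + N M) gives
     det(1 - u T) = det(1 + u J) det(1 - u tau (1 + u J)^-1 sigma)
   and det(1 + u J) = prod (1 - u^2 W(e)) over e in A. Each coefficient of each
   of these products is a sum over finite sets (of cycles, of vertices, of edges)
   that is dominated, uniformly in A, by a convergent one, so the identity passes
   to the limit over A. The column of T at e has absolute sum at most M w(e) if M
   bounds the valency, so the coefficient of u^n in det(1 - u T) is at most
   (M sum_e w(e))^n / n! and 1/Z is entire.
   Cycle weights are compared with traces: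
     sum over l(p) = n of w(p) <= tr T^n <= (sum_e w(e))^n,
   which makes Z converge near 0. *)

From Stdlib Require Import Relation_Operators.
Require Import Defs.
From mathcomp Require Import all_boot all_order all_algebra perm finmap.
From mathcomp Require Import all_classical all_reals all_analysis.
From mathcomp Require Import summability complex ring lra zify.

Set Implicit Arguments.
Unset Strict Implicit.
Unset Printing Implicit Defensive.

Import Order.TTheory GRing.Theory Num.Theory.
Import numFieldNormedType.Exports.
Local Open Scope classical_set_scope.
Local Open Scope complex_scope.
Local Open Scope ring_scope.

(* The determinant is given only as a formal series, so everything is compared coefficient by
   coefficient, and each coefficient involves finite data. A finite [A] may contain infinitely many
   prime cycles, but only those of length at most n reach degree n, and the geometric series of (1 +
   uJ)^-1 can be cut at degree n. The finite identities are therefore polynomial identities modulo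
   u^(n+1), with Newton's identities in the form X p' + s p = 0, which determines p from s and p(0)
   in characteristic 0. The limits are all of one kind. A product of factors 1 + x_i is expanded
   into a sum over finite sets of indices, and the products of nonnegative g_i over all finite sets
   have total at most exp(sum g_i); this yields the dominating sums for cycles, for edges and for
   k-subsets of vertices. Truncating to [A] leaves each single term unchanged once [A] is large, so
   dominated convergence is needed only for terms that are eventually equal. The domination of
   cycles works only on a small disc, which is why the determinant bound with n! is needed
   separately. *)
#[local] Existing Instance totally_filter.

(** * Unordered sums and products *)

Section FsetBigops.
Variables (T : Type) (idx : T) (op : Monoid.com_law idx) (I : choiceType).
Implicit Types (F : I -> T) (A B : {fset I}).

Lemma big_fsetD F A B : (A `<=` B)%fset ->
  \big[op/idx]_(i <- B) F i =
    op (\big[op/idx]_(i <- A) F i) (\big[op/idx]_(i <- (B `\` A)%fset) F i).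
Proof.
move=> AB; have {1}-> : B = (A `|` (B `\` A))%fset.
  apply/fsetP => i; rewrite !inE; case: (boolP (i \in A)) => //= iA.
  by move/fsubsetP: AB => ->.
rewrite -big_cat; apply: perm_big.
apply: uniq_perm; rewrite ?cat_uniq ?fset_uniq ?andbT//=.
  by apply/hasPn => i; rewrite !inE => /andP[].
by move=> i; rewrite mem_cat in_fsetU.
Qed.

End FsetBigops.

Lemma big_fpowersetU1 (T : Type) (idx : T) (op : Monoid.com_law idx)
    (I : choiceType) (F : {fset I} -> T) (a : I) (A : {fset I}) : a \notin A ->
  \big[op/idx]_(Q <- fpowerset (a |` A)%fset) F Q =
    op (\big[op/idx]_(Q <- fpowerset A) F Q)
       (\big[op/idx]_(Q <- fpowerset A) F (a |` Q)%fset).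
Proof.
move=> aA; rewrite (@big_fsetD _ _ _ _ _ (fpowerset A)); last first.
  by rewrite fpowersetS; apply: fsubsetU1.
congr (op _ _); rewrite -[RHS](big_map (fun Q => (a |` Q)%fset) xpredT F).
apply: perm_big; apply: uniq_perm; rewrite ?fset_uniq//.
  rewrite map_inj_in_uniq ?fset_uniq// => P Q; rewrite !fpowersetE => PA QA PQ.
  have aP : a \notin P by apply: contra aA; move/fsubsetP: PA; apply.
  have aQ : a \notin Q by apply: contra aA; move/fsubsetP: QA; apply.
  by rewrite -(fsetU1K aP) -(fsetU1K aQ) PQ.
move=> Q; rewrite inE !fpowersetE; apply/idP/mapP => [/andP[nQ Qa]|[P]].
  exists (Q `\ a)%fset; rewrite ?fpowersetE ?fsubD1set//.
    by rewrite fsubDset.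
  apply/esym/fsetD1K; apply: contraR nQ => aQ; apply/fsubsetP => i iQ.
  move/fsubsetP: Qa => /(_ i iQ); rewrite !inE => /orP[/eqP ia|//].
  by rewrite -ia iQ in aQ.
rewrite fpowersetE => PA ->; rewrite fsetUS// andbT.
by apply: contra aA => /fsubsetP; apply; rewrite !inE eqxx.
Qed.

Lemma fset_ind_U1 (I : choiceType) (P : {fset I} -> Prop) :
  P fset0 -> (forall a A, a \notin A -> P A -> P (a |` A)%fset) -> forall A, P A.
Proof.
move=> P0 P1; elim/finSet_rect => A IH.
have [->//|[a aA]] := fset_0Vmem A.
rewrite -(fsetD1K aA); apply: P1; first by rewrite !inE eqxx.
by apply: IH; exact: fproperD1.
Qed.

(** This expansion turns infinite products into unordered sums over finite sets, where domination
    arguments apply. *)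
Lemma prodr_fset_addr1 (K : comPzRingType) (I : choiceType) (x : I -> K)
    (A : {fset I}) :
  \prod_(i <- A) (1 + x i) = \sum_(Q <- fpowerset A) \prod_(i <- Q) x i.
Proof.
elim/fset_ind_U1: A => [|a A aA IH].
  by rewrite fpowerset0 !big_seq_fset1 !big_seq_fset0.
rewrite big_fsetU1// big_fpowersetU1//= IH mulrDl mul1r; congr (_ + _).
rewrite big_distrr/= big_seq [RHS]big_seq; apply: eq_bigr => Q.
rewrite fpowersetE => /fsubsetP QA; rewrite big_fsetU1//.
by apply: contra aA; exact: QA.
Qed.

Section NonnegativeSums.
Variables (R : realType) (I : choiceType).
Implicit Types (g h : I -> R) (A B : {fset I}) (K : R).

(** For nonnegative [g] this is summability with total at most [K]. The bound stays explicit because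
    it must often be uniform in a parameter. *)
Definition bounded_sums g K := forall A, \sum_(i <- A) g i <= K.

Lemma bounded_sums_ge0 g K : bounded_sums g K -> 0 <= K.
Proof. by move=> /(_ fset0); rewrite big_seq_fset0. Qed.

Lemma bounded_sums_le g h K : (forall i, g i <= h i) ->
  bounded_sums h K -> bounded_sums g K.
Proof. by move=> gh hK A; apply: le_trans (hK A); apply: ler_sum. Qed.

Lemma bounded_sumsZ g K c : 0 <= c -> bounded_sums g K ->
  bounded_sums (fun i => c * g i) (c * K).
Proof. by move=> c0 gK A; rewrite -mulr_sumr ler_wpM2l. Qed.

Lemma bounded_sumsD g h K L : bounded_sums g K -> bounded_sums h L ->
  bounded_sums (fun i => g i + h i) (K + L).
Proof. by move=> gK hL A; rewrite big_split lerD//=. Qed.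

Lemma bounded_sums_pt g K i : bounded_sums g K -> g i <= K.
Proof. by move=> /(_ [fset i]%fset); rewrite big_seq_fset1. Qed.

Lemma ler_sum_fsubset g A B : (forall i, 0 <= g i) -> (A `<=` B)%fset ->
  \sum_(i <- A) g i <= \sum_(i <- B) g i.
Proof.
by move=> g0 AB; rewrite (@big_fsetD _ _ _ _ g _ _ AB) /= lerDl sumr_ge0.
Qed.

(** A finite set whose sum comes within [e] of the supremum of all finite sums leaves at most [e]
    for any set disjoint from it. *)
Lemma bounded_sums_tail g K (e : R) : bounded_sums g K -> 0 < e ->
  exists A0, forall A, [disjoint A & A0]%fset -> \sum_(i <- A) g i <= e.
Proof.
move=> gK e0; pose S := [set s | exists A, s = \sum_(i <- A) g i].
have S_sup : has_sup S.
  split; first by exists (\sum_(i <- fset0) g i), fset0.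
  by exists K => _ [A ->].
have [_ [A0 ->] SA0] := sup_adherent e0 S_sup; exists A0 => A AA0.
have : \sum_(i <- (A0 `|` A)%fset) g i <= sup S.
  by apply: sup_upper_bound => //; exists (A0 `|` A)%fset.
rewrite (@big_fsetD _ _ _ _ g A0)/=; last exact: fsubsetUl.
rewrite fsetDUl fsetDv fset0U; move/fsetDidPl: AA0 => ->; lra.
Qed.

End NonnegativeSums.

Lemma bounded_sums_nat (R : realType) (g : nat -> R) K :
  (forall n, 0 <= g n) -> (forall N, \sum_(n < N) g n <= K) -> bounded_sums g K.
Proof.
move=> g0 gK A; have [N AN] : exists N, forall i, i \in A -> (i < N)%N.
  exists (\max_(i <- A) (i : nat)).+1 => i iA; rewrite ltnS.
  exact: (@leq_bigmax_seq _ (A : seq nat) xpredT (fun i => i)).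
apply: le_trans (gK N); rewrite -(big_mkord xpredT).
rewrite [leRHS](bigID (fun i => i \in A))/= -[leLHS]addr0 lerD ?sumr_ge0//.
rewrite -[leRHS]big_filter le_eqVlt; apply/orP; left; apply/eqP; apply: perm_big; apply: uniq_perm; rewrite ?fset_uniq ?filter_uniq ?iota_uniq//.
move=> i; rewrite mem_filter mem_index_iota; case: (boolP (i \in A)) => //=.
by move/AN => ->.
Qed.

(** The sets in [F] are subsets of one finite [A], and the sum over all subsets of [A] is the
    product of the 1 + g i, at most exp of the sum of the g i. *)
Lemma bounded_sums_prod (R : realType) (I : choiceType) (g : I -> R) K :
  (forall i, 0 <= g i) -> bounded_sums g K ->
  bounded_sums (fun Q : {fset I} => \prod_(i <- Q) g i) (expR K).
Proof.
move=> g0 gK F; pose A : {fset I} := (\bigcup_(Q <- F) Q)%fset.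
apply: (@le_trans _ _ (\sum_(Q <- fpowerset A) \prod_(i <- Q) g i)).
  apply: ler_sum_fsubset => [Q|]; first by apply: prodr_ge0.
  by apply/fsubsetP => Q QF; rewrite fpowersetE; exact: bigfcup_sup.
rewrite -prodr_fset_addr1; apply: (@le_trans _ _ (expR (\sum_(i <- A) g i))).
  rewrite expR_sum; apply: ler_prod => i _.
  by rewrite addr_ge0//= expR_ge1Dx.
by rewrite ler_expR.
Qed.

Section ComplexSums.
Variable R : realType.
Local Notation C := R[i].
Implicit Types (I : choiceType) (z : C).

Lemma normc_ge0 z : 0 <= normc z.
Proof. by case: z => ? ? /=; exact: sqrtr_ge0. Qed.

Lemma normr_normc z : `|z| = (normc z)%:C.
Proof. by []. Qed.

Lemma normcX z n : normc (z ^+ n) = normc z ^+ n.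
Proof.
elim: n => [|n IH]; first by rewrite !expr0 ComplexField.Normc.normc1.
by rewrite !exprS ComplexField.Normc.normcM IH.
Qed.

Lemma normcNE z : normc (- z) = normc z.
Proof. by case: z => a b; rewrite /= !sqrrN. Qed.

Lemma normcD_le (z w : C) : normc (z + w) <= normc z + normc w.
Proof. exact: le_normcD. Qed.

Lemma normcB_le (z w : C) : normc (z - w) <= normc z + normc w.
Proof. by rewrite -[in leRHS](normcNE w); exact: normcD_le. Qed.

Lemma normcB (z w : C) : normc (z - w) = normc (w - z).
Proof. by rewrite -normcNE opprB. Qed.

Lemma normc_eq0 z : (normc z == 0) = (z == 0).
Proof.
apply/eqP/eqP => [/ComplexField.Normc.eq0_normc//|->].
exact: ComplexField.Normc.normc0.
Qed.

Lemma normc_prod (I : Type) (r : seq I) (F : I -> C) :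
  normc (\prod_(i <- r) F i) = \prod_(i <- r) normc (F i).
Proof.
elim/big_rec2: _ => [|i x y _ <-]; first exact: ComplexField.Normc.normc1.
by rewrite ComplexField.Normc.normcM.
Qed.

Lemma normc_sum (I : Type) (r : seq I) (P : pred I) (F : I -> C) :
  normc (\sum_(i <- r | P i) F i) <= \sum_(i <- r | P i) normc (F i).
Proof.
elim/big_rec2: _ => [|i x y _ xy]; first by rewrite ComplexField.Normc.normc0.
by apply: le_trans (normcD_le _ _) _; rewrite lerD2l.
Qed.

Lemma Re_le_normc z : `|complex.Re z| <= normc z.
Proof.
case: z => a b /=; rewrite -sqrtr_sqr ler_wsqrtr// lerDl sqr_ge0//.
Qed.

Lemma Im_le_normc z : `|complex.Im z| <= normc z.
Proof.
case: z => a b /=; rewrite -sqrtr_sqr ler_wsqrtr// lerDr sqr_ge0//.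
Qed.

(** The norm on [R[i]] takes values in [R[i]]; since a positive complex number is real, real
    tolerances and the real-valued [normc] suffice. *)
Lemma cvgcP (T : Type) (F : set_system T) (FF : Filter F) (f : T -> C^o) (l : C^o) :
  f @ F --> l <->
  forall e : R, 0 < e -> \forall t \near F, normc (f t - l) < e.
Proof.
split=> [/cvgrPdist_lt fl e e0|fl].
  have := fl e%:C; rewrite ltcR => /(_ e0); apply: filterS => t.
  by rewrite normr_normc ltcR normcB.
apply/cvgrPdist_lt => -[e e']; rewrite ltcE/= => /andP[/eqP -> e0].
by apply: filterS (fl _ e0) => t; rewrite normcB -ltcR -normr_normc.
Qed.

Lemma totallyP I (P : set {fset I}) :
  (exists A, forall B, (A `<=` B)%fset -> P B) <-> totally P.
Proof. by split=> [[A PA]|[A _ PA]]; exists A. Qed.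

Lemma near_totally_sub I (A : {fset I}) : \forall B \near totally, (A `<=` B)%fset.
Proof. by exists A. Qed.

Lemma near_fset_all I (T : Type) (F : set_system T) (FF : Filter F)
    (A : {fset I}) (P : I -> T -> Prop) :
  (forall i, \forall t \near F, P i t) ->
  \forall t \near F, forall i, i \in A -> P i t.
Proof. by move=> Pi; apply: (@filter_bigI _ _ A P F FF) => i _; exact: Pi. Qed.

Definition abs_summable I (f : I -> C) :=
  exists K, bounded_sums (fun i => normc (f i)) K.

Lemma abs_summable_le I (f : I -> C) (g : I -> R) K :
  (forall i, normc (f i) <= g i) -> bounded_sums g K -> abs_summable f.
Proof. by move=> fg gK; exists K; exact: bounded_sums_le gK. Qed.

Lemma abs_summableD I (f g : I -> C) :
  abs_summable f -> abs_summable g -> abs_summable (fun i => f i + g i).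
Proof.
move=> [K fK] [L gL]; apply: abs_summable_le (bounded_sumsD fK gL) => i.
exact: normcD_le.
Qed.

Lemma abs_summableZ I (a : C) (f : I -> C) :
  abs_summable f -> abs_summable (fun i => a * f i).
Proof.
move=> [K fK]; apply: abs_summable_le (bounded_sumsZ (normc_ge0 a) fK) => i.
by rewrite ComplexField.Normc.normcM.
Qed.

Let nonneg_limit I (g : I -> R) K : (forall i, 0 <= g i) -> bounded_sums g K ->
  exists s, forall e : R, 0 < e -> totally (fun A : {fset I} => `|\sum_(i <- A) g i - s| < e).
Proof.
move=> g0 gK; pose S := [set s | exists A : {fset I}, s = \sum_(i <- A) g i].
have S_sup : has_sup S.
  split; first by exists (\sum_(i <- fset0) g i), fset0.
  by exists K => _ [A ->].
exists (sup S) => e e0.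
have [_ [A0 ->] SA0] := sup_adherent e0 S_sup; apply/totallyP; exists A0 => A A0A.
have le1 : \sum_(i <- A) g i <= sup S by apply: sup_upper_bound => //; exists A.
have le2 := ler_sum_fsubset g0 A0A.
by rewrite ler0_norm; lra.
Qed.

(** [h] is the difference of the nonnegative families [h + g] and [g], both covered by
    [nonneg_limit]. *)
Let real_limit I (h g : I -> R) K : (forall i, `|h i| <= g i) -> bounded_sums g K ->
  exists s, forall e : R, 0 < e -> totally (fun A : {fset I} => `|\sum_(i <- A) h i - s| < e).
Proof.
move=> hg gK; have g0 i : 0 <= g i by apply: le_trans (hg i).
have [s sP] := nonneg_limit g0 gK.
have hg0 i : 0 <= h i + g i by have := hg i; rewrite ler_norml => /andP[]; lra.
have hgK : bounded_sums (fun i => h i + g i) (K + K).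
  apply: bounded_sumsD (gK) => //; apply: bounded_sums_le gK => i.
  by have := hg i; rewrite ler_norml => /andP[].
have [t tP] := nonneg_limit hg0 hgK.
exists (t - s) => e e0; have e2 : 0 < e / 2 by lra.
apply: filterS2 (sP _ e2) (tP _ e2) => A; rewrite big_split/= => H1 H2.
set a := \sum_(i <- A) h i in H2 *; set b := \sum_(i <- A) g i in H1 H2.
rewrite (_ : a - (t - s) = (a + b - t) - (b - s)); last by ring.
by apply: le_lt_trans (ler_normB _ _) _; lra.
Qed.

(** Real and imaginary parts are dominated by [normc] and converge separately. This guarantees that
    the [lim] inside [isum] is a genuine limit and not a default value. *)
Lemma isum_near I (f : I -> C) : abs_summable f -> forall e : R, 0 < e ->
  totally (fun A : {fset I} => normc (\sum_(i <- A) f i - isum f) < e).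
Proof.
move=> [K fK].
have [a aP] := real_limit (fun i => Re_le_normc (f i)) fK.
have [b bP] := real_limit (fun i => Im_le_normc (f i)) fK.
suff fl : partial_sum (f : I -> C^o) @ totally --> (Complex a b : C^o).
  have -> : isum f = Complex a b by apply: cvg_lim.
  move: fl => /cvgcP fl e e0; apply: filterS (fl e e0) => A.
  by rewrite /partial_sum -(big_seq_fsetE _ A xpredT f).
apply/cvgcP => e e0; have e2 : 0 < e / 2 by lra.
apply: filterS2 (aP _ e2) (bP _ e2) => A.
rewrite /partial_sum -(big_seq_fsetE _ A xpredT f)/= => H1 H2.
have -> : \sum_(i <- A) f i - Complex a b =
   (\sum_(i <- A) complex.Re (f i) - a)%:C + 'i%C * (\sum_(i <- A) complex.Im (f i) - b)%:C.
  rewrite -!(raddf_sum (@complex.Re R)) -!(raddf_sum (@complex.Im R)) /=.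
  case: (\sum_(i <- A) f i) => u v; simpc; congr (Complex _ _); ring.
apply: le_lt_trans (normcD_le _ _) _.
rewrite ComplexField.Normc.normcM !normcC /= expr0n expr1n add0r sqrtr1 mul1r.
lra.
Qed.

Lemma isum_unique I (f : I -> C) (l : C) :
  (forall e : R, 0 < e -> totally (fun A : {fset I} => normc (\sum_(i <- A) f i - l) < e)) ->
  isum f = l.
Proof.
move=> fl; apply: cvg_lim => //; apply/cvgcP => e e0; apply: filterS (fl e e0) => A.
by rewrite /partial_sum -(big_seq_fsetE _ A xpredT f).
Qed.

Lemma isum_fset I (f : I -> C) (A : {fset I}) :
  (forall i, i \notin A -> f i = 0) -> isum f = \sum_(i <- A) f i.
Proof.
move=> fA; apply: cvg_lim => //; apply/(@cvgcP _ totally) => e e0; apply/totallyP; exists A => B AB.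
rewrite /partial_sum -(big_seq_fsetE _ B xpredT f)/=.
rewrite (@big_fsetD _ _ _ _ f _ _ AB)/= [X in _ + X - _]big1_seq ?addr0.
  by rewrite subrr ComplexField.Normc.normc0.
by move=> i /=; rewrite inE => /andP[/fA].
Qed.

Lemma normc_lt_eq0 z : (forall e : R, 0 < e -> normc z <= e) -> z = 0.
Proof.
move=> ze; apply/eqP; rewrite -normc_eq0 eq_le normc_ge0 andbT.
by apply/ler_addgt0Pr => e e0; rewrite add0r ze.
Qed.

Lemma isum_le I (f : I -> C) K : bounded_sums (fun i => normc (f i)) K ->
  normc (isum f) <= K.
Proof.
move=> fK; apply/ler_addgt0Pr => e e0.
have /totallyP[A /(_ A (fsubset_refl A)) fA] := isum_near (ex_intro _ K fK) e0.
rewrite -[isum f](subKr (\sum_(i <- A) f i)).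
apply: le_trans (normcB_le _ _) _; apply: lerD; last by exact: ltW.
exact: le_trans (normc_sum _ _ _) (fK A).
Qed.

Lemma isumB I (f g : I -> C) : abs_summable f -> abs_summable g ->
  isum f - isum g = isum (fun i => f i - g i).
Proof.
move=> sf sg; apply/esym/isum_unique => e e0; have e2 : 0 < e / 2 by lra.
apply: filterS2 (isum_near sf e2) (isum_near sg e2) => A H1 H2.
rewrite sumrB [X in normc X](_ : _ = (\sum_(i <- A) f i - isum f) -
   (\sum_(i <- A) g i - isum g)); last by ring.
by apply: le_lt_trans (normcB_le _ _) _; lra.
Qed.

Lemma isumZ I (a : C) (f : I -> C) : abs_summable f ->
  isum (fun i => a * f i) = a * isum f.
Proof.
move=> sf; apply: isum_unique => e e0; have a1 : 0 < normc a + 1 by have := normc_ge0 a; lra.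
apply: filterS (isum_near sf (divr_gt0 e0 a1)) => A; rewrite ltr_pdivlMr// => H.
rewrite -mulr_sumr -mulrBr ComplexField.Normc.normcM mulrC.
apply: le_lt_trans H; rewrite ler_wpM2l ?normc_ge0//; lra.
Qed.

(** The finite set [A0] depends on [g] alone and not on the two families, which makes the
    convergence results below uniform in parameters. *)
Lemma isum_tail I (g : I -> R) K e : bounded_sums g K -> 0 < e ->
  exists A0 : {fset I}, forall f f' : I -> C,
    (forall i, normc (f i) <= g i) -> (forall i, normc (f' i) <= g i) ->
    (forall i, i \in A0 -> f i = f' i) -> normc (isum f - isum f') < e.
Proof.
(* Outside [A0] the terms of the two families differ by at most 2 g, so the total is at most 2 (e /
   3), strictly below [e]. *)
move=> gK e0; have e3 : 0 < e / 3 by lra.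
have [A0 A0P] := bounded_sums_tail gK e3; exists A0 => f f' fg fg' ff.
rewrite isumB; do ?exact: abs_summable_le gK.
suff : normc (isum (fun i => f i - f' i)) <= 2 * (e / 3) by lra.
apply: isum_le => A.
apply: (@le_trans _ _ (\sum_(i <- (A `\` A0)%fset) normc (f i - f' i))).
  rewrite (@big_fsetD _ _ _ _ _ _ _ (fsubsetIl A A0))/= big1_seq ?add0r.
    by rewrite fsetDIr fsetDv fset0U.
  move=> i /andP[_]; rewrite inE => /andP[_ /ff ->].
  by rewrite subrr ComplexField.Normc.normc0.
apply: (@le_trans _ _ (\sum_(i <- (A `\` A0)%fset) 2 * g i)).
  apply: ler_sum => i _; apply: le_trans (normcB_le _ _) _.
  by have := fg i; have := fg' i; lra.
rewrite -mulr_sumr ler_wpM2l//; apply: A0P.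
by apply/fdisjointP => i; rewrite inE => /andP[].
Qed.

(** Dominated convergence for families whose terms are eventually equal to their limits, as happens
    with truncations. *)
Lemma isum_dominated I (T : Type) (F : set_system T) (FF : ProperFilter F)
    (f_ : T -> I -> C) (f : I -> C) (g : I -> R) K :
  (forall t i, normc (f_ t i) <= g i) -> bounded_sums g K ->
  (forall i, \forall t \near F, f_ t i = f i) ->
  isum (f_ t) @[t --> F] --> (isum f : C^o).
Proof.
move=> fg gK ff; apply/cvgcP => e e0.
have fg' i : normc (f i) <= g i.
  by have /filter_ex[t <-] := ff i; exact: fg.
have [A0 A0P] := isum_tail gK e0.
by apply: filterS (near_fset_all FF A0 ff) => t tA; exact: A0P.
Qed.

End ComplexSums.

Lemma bounded_sums_uniq (R : realType) (I : choiceType) (g : I -> R) K (s : seq I) :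
  bounded_sums g K -> uniq s -> \sum_(i <- s) g i <= K.
Proof.
move=> gK us; apply: le_trans (gK [fset i in s]%fset).
rewrite le_eqVlt; apply/orP; left; apply/eqP; apply: perm_big.
by apply: uniq_perm; rewrite ?fset_uniq// => i; rewrite !inE.
Qed.

Lemma bounded_sums_inj (R : realType) (I J : choiceType) (h : J -> I)
    (g : I -> R) K :
  injective h -> bounded_sums g K -> bounded_sums (g \o h) K.
Proof.
move=> hI gK A; rewrite -[leLHS](big_map h xpredT g).
by apply: bounded_sums_uniq gK _; rewrite map_inj_uniq ?fset_uniq.
Qed.

Section Products.
Variables (R : realType) (I : choiceType).
Local Notation C := R[i].
Implicit Types (x y : I -> C) (g : I -> R) (Q : {fset I}).

(** The product over [A] is the sum over the subsets of [A]. It agrees with the full sum on the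
    finite family [F0] of sets that matter as soon as [A] contains their union. Since [A0] is chosen
    from [g], the estimate is uniform in [x]. *)
Lemma prod_tail g K e : (forall i, 0 <= g i) -> bounded_sums g K -> 0 < e ->
  exists A0 : {fset I}, forall A x, (A0 `<=` A)%fset ->
    (forall i, normc (x i) <= g i) ->
    normc (\prod_(i <- A) (1 + x i) - isum (fun Q => \prod_(i <- Q) x i)) < e.
Proof.
move=> g0 gK e0; have [F0 F0P] := isum_tail (bounded_sums_prod g0 gK) e0.
exists (\bigcup_(Q <- F0) Q)%fset => A x A0A xg.
pose f Q := if (Q `<=` A)%fset then \prod_(i <- Q) x i else 0.
have -> : \prod_(i <- A) (1 + x i) = isum f.
  rewrite prodr_fset_addr1 (@isum_fset _ _ f (fpowerset A)).
    by rewrite big_seq [RHS]big_seq; apply: eq_bigr => Q; rewrite fpowersetE /f => ->.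
  by move=> Q; rewrite fpowersetE /f => /negbTE ->.
have px Q : normc (\prod_(i <- Q) x i) <= \prod_(i <- Q) g i.
  by rewrite normc_prod; apply: ler_prod => i _; rewrite normc_ge0/=.
apply: F0P => // Q; rewrite /f; case: ifP => // QA.
- by rewrite ComplexField.Normc.normc0; apply: prodr_ge0.
- move=> QF0; rewrite (fsubset_trans _ A0A) in QA => //.
  exact: bigfcup_sup.
Qed.

Lemma partial_prod_cvg x : abs_summable x ->
  partial_prod (fun i => 1 + x i) @ totally -->
    (isum (fun Q => \prod_(i <- Q) x i) : C^o).
Proof.
move=> [K xK]; apply/(@cvgcP _ _ totally) => e e0.
have [A0 A0P] := prod_tail (fun i => normc_ge0 (x i)) xK e0.
by apply/totallyP; exists A0 => A /A0P; apply.
Qed.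

Lemma iprod_isum x : abs_summable x ->
  iprod (fun i => 1 + x i) = isum (fun Q => \prod_(i <- Q) x i).
Proof. by move=> sx; apply: cvg_lim => //; exact: partial_prod_cvg. Qed.

(** The difference is - x i / (1 + x i), of modulus at most 2 |x i| where |x i| is at most 1/2. The
    finitely many other indices are dominated by their own terms. *)
Lemma abs_summable_inv x : abs_summable x -> (forall i, 1 + x i != 0) ->
  abs_summable (fun i => (1 + x i)^-1 - 1).
Proof.
move=> [K xK] x1; have h0 : 0 < 2^-1 :> R by lra.
have [A0 A0P] := bounded_sums_tail xK h0.
pose g i := (if i \in A0 then normc ((1 + x i)^-1 - 1) else 0) + 2 * normc (x i).
apply: (@abs_summable_le _ _ _ g (\sum_(i <- A0) normc ((1 + x i)^-1 - 1) + 2 * K)).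
  move=> i; rewrite /g; case: (boolP (i \in A0)) => iA.
    by rewrite lerDl mulr_ge0 ?normc_ge0.
  have xi : normc (x i) <= 2^-1.
    have := A0P [fset i]%fset; rewrite big_seq_fset1; apply.
    by apply/fdisjointP => j; rewrite inE => /eqP ->.
  have -> : (1 + x i)^-1 - 1 = - x i / (1 + x i).
    apply: (mulIf (x1 i)).
    by rewrite mulrBl mulVf// mul1r divfK// opprD addrA subrr add0r.
  rewrite add0r ComplexField.Normc.normcM normcNE mulrC ler_wpM2r ?normc_ge0//.
  rewrite ComplexField.Normc.normcV invf_ple ?posrE//; last first.
    by rewrite lt_def normc_eq0 x1 normc_ge0.
  have := normcD_le (1 + x i) (- x i); rewrite addrK ComplexField.Normc.normc1 normcNE.
  lra.
apply: bounded_sumsD; last exact: bounded_sumsZ.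
move=> A; rewrite (@big_fsetD _ _ _ _ _ _ _ (fsubsetIl A A0))/= addrC big1_seq ?add0r; last first.
  move=> i /andP[_]; rewrite !inE negb_and => /andP[/orP[iA'|iA'] iA].
    by rewrite iA in iA'.
  by rewrite (negbTE iA').
apply: (@le_trans _ _ (\sum_(i <- (A `&` A0)%fset) normc ((1 + x i)^-1 - 1))).
  by apply: ler_sum => i _; case: ifP => // _; exact: normc_ge0.
by apply: ler_sum_fsubset => [i|]; rewrite ?normc_ge0 ?fsubsetIr.
Qed.

(** The products of the 1 + x i and of their inverses both converge, and their partial products
    multiply to 1. Hence so do the limits, and neither vanishes. *)
Lemma partial_prod_inv_cvg x : abs_summable x -> (forall i, 1 + x i != 0) ->
  let P : C := isum (fun Q => \prod_(i <- Q) x i) in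
  P != 0 /\ partial_prod (fun i => (1 + x i)^-1) @ totally --> (P^-1 : C^o).
Proof.
move=> sx x1 P; have sy := abs_summable_inv sx x1.
have Px := partial_prod_cvg sx; have Py := partial_prod_cvg sy.
pose Q : C := isum (fun Q => \prod_(i <- Q) ((1 + x i)^-1 - 1)).
rewrite -/Q in Py.
have yE : (fun i => 1 + ((1 + x i)^-1 - 1)) = (fun i => (1 + x i)^-1).
  by apply/funext => i; rewrite addrC subrK.
rewrite yE in Py.
have PQ1 : P * Q = 1.
  have := cvgM Px Py; rewrite -/P.
  have -> : partial_prod (fun i => 1 + x i) \* partial_prod (fun i => (1 + x i)^-1)
     = cst (1 : C^o).
    apply/funext => A; rewrite /partial_prod /= -big_split/= big1// => i _.
    by rewrite divff.
  move=> /(_ _)/(@cvgcP _ _ totally) H.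
  apply/esym/eqP; rewrite -subr_eq0; apply/eqP/normc_lt_eq0 => e e0.
  by have /filter_ex[A /ltW] := H e e0.
have P0 : P != 0.
  by apply/eqP => P0; move: PQ1; rewrite P0 mul0r => /esym/eqP; rewrite oner_eq0.
have PV : P^-1 = Q by apply: (mulfI P0); rewrite divff.
split; first exact: P0.
rewrite PV; exact: Py.
Qed.

End Products.

(** * Entire power series *)

Section PowerSeries.
Variable R : realType.
Local Notation C := R[i].
Implicit Types (c : nat -> C) (z h : C).

Definition fseries c : C^o -> C^o := fun z => isum (fun n => c n * z ^+ n).

Definition entire_coefs c := forall r : R, 0 <= r ->
  exists K, bounded_sums (fun n => normc (c n) * r ^+ n) K.

Definition dcoef c n := n.+1%:R * c n.+1.

Lemma normc_natr n : normc (n%:R : C) = n%:R.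
Proof. by rewrite -(rmorph_nat (real_complex R)) normcC ger0_norm. Qed.

Lemma fseries_summable c z : entire_coefs c -> abs_summable (fun n => c n * z ^+ n).
Proof.
move=> /(_ _ (normc_ge0 z))[K cK]; apply: abs_summable_le cK => n.
by rewrite ComplexField.Normc.normcM normcX.
Qed.

Lemma entire_dcoef c : entire_coefs c -> entire_coefs (dcoef c).
Proof.
(* The factor 2^(n+1) absorbs n + 1, and r + 1 is at least 1, so that its power n + 1 dominates
   r^n. *)
move=> ec r r0; have r1 : 0 <= 2 * (r + 1) by lra.
have [K cK] := ec _ r1; exists K.
apply: bounded_sums_le (bounded_sums_inj succn_inj cK) => n /=.
rewrite ComplexField.Normc.normcM normc_natr -mulrA mulrCA ler_wpM2l ?normc_ge0//.
rewrite exprMn; apply: ler_pM => //; first by rewrite exprn_ge0.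
  by rewrite -natrX ler_nat ltnW// ltn_expl.
apply: (@le_trans _ _ ((r + 1) ^+ n)).
  by apply: lerXn2r; rewrite ?nnegrE; lra.
by rewrite exprS ler_peMl ?exprn_ge0//; lra.
Qed.

(** Induction on [n]: the remainder for n + 1 is z + h times the remainder for n, plus n h^2
    z^(n-1); the constants close up because n^2 + n is at most (n + 1)^2. At n = 0 the exponent
    [n.-1] is harmless, its coefficient being 0. *)
Lemma expr_taylor_bound z h (r : R) n : 1 <= r -> normc z <= r -> normc (z + h) <= r ->
  normc ((z + h) ^+ n - z ^+ n - h * (n%:R * z ^+ n.-1)) <= n%:R ^+ 2 * normc h ^+ 2 * r ^+ n.
Proof.
move=> r1 zr zhr; have r0 : 0 <= r by lra.
elim: n => [|n IH].
  rewrite !expr0 subrr mul0r mulr0 subr0 ComplexField.Normc.normc0.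
  by rewrite expr0n/= !mul0r.
have -> : (z + h) ^+ n.+1 - z ^+ n.+1 - h * (n.+1%:R * z ^+ n.+1.-1) =
   (z + h) * ((z + h) ^+ n - z ^+ n - h * (n%:R * z ^+ n.-1)) + n%:R * h ^+ 2 * z ^+ n.-1.
  case: n {IH} => [|n] /=; first by rewrite !expr0 !expr1; ring.
  by rewrite !exprS -!natr1; ring.
apply: le_trans (normcD_le _ _) _; rewrite !ComplexField.Normc.normcM !normcX normc_natr.
have zn : normc z ^+ n.-1 <= r ^+ n.+1.
  apply: (@le_trans _ _ (r ^+ n.-1)); first by apply: lerXn2r; rewrite ?nnegrE ?normc_ge0.
  by rewrite ler_weXn2l//; lia.
have h2 : 0 <= normc h ^+ 2 by rewrite exprn_ge0 ?normc_ge0.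
apply: (@le_trans _ _ (r * (n%:R ^+ 2 * normc h ^+ 2 * r ^+ n) +
    n%:R * normc h ^+ 2 * r ^+ n.+1)).
  apply: lerD; first by apply: ler_pM => //; rewrite ?normc_ge0.
  by rewrite ler_wpM2l// mulr_ge0.
rewrite (exprS r) [leLHS](_ : _ = (n%:R ^+ 2 + n%:R) * (normc h ^+ 2 * (r * r ^+ n))); last by ring.
rewrite -[leRHS]mulrA; apply: ler_wpM2r; first by rewrite mulr_ge0// mulr_ge0// exprn_ge0.
rewrite -natr1; have : 0 <= n%:R :> R by []. nra.
Qed.

Lemma fseries_taylor_bound c z : entire_coefs c -> exists K, forall h, normc h <= 1 ->
  normc (fseries c (z + h) - fseries c z - h * fseries (dcoef c) z) <= K * normc h ^+ 2.
Proof.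
(* [r] is at least 1 and bounds both |z| and |z + h|. In the radius 4 r the factor 4^n = (2^n)^2
   absorbs the n^2 of [expr_taylor_bound]. *)
move=> ec; set r := normc z + 1.
have r0 : 0 <= 4 * r by have := normc_ge0 z; rewrite /r; lra.
have [K cK] := ec _ r0; exists K => h h1.
have sD : abs_summable (fun n => c n * (n%:R * z ^+ n.-1)).
  apply: abs_summable_le cK => n; rewrite ComplexField.Normc.normcM.
  rewrite ler_wpM2l ?normc_ge0// ComplexField.Normc.normcM normc_natr normcX.
  rewrite exprMn; apply: ler_pM => //; rewrite ?exprn_ge0 ?normc_ge0//.
    by rewrite -natrX ler_nat ltnW// ltn_expl.
  apply: (@le_trans _ _ (r ^+ n.-1)).
    by apply: lerXn2r; rewrite ?nnegrE /r; have := normc_ge0 z; lra.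
  by apply: ler_weXn2l; [rewrite /r; have := normc_ge0 z; lra|lia].
(* The termwise derivative, indexed like the original series, has a zero term at n = 0; removing it
   and shifting by one gives the series of [dcoef]. *)
have -> : fseries (dcoef c) z = isum (fun n => c n * (n%:R * z ^+ n.-1)).
  apply/esym; apply: isum_unique => e e0.
  have /totallyP[A0 A0P] := isum_near (fseries_summable z (entire_dcoef ec)) e0.
  apply/totallyP; exists [fset n.+1 | n in A0]%fset => A A0A.
  pose B := [fset n.-1 | n in (A `\ 0%N)]%fset.
  have -> : \sum_(n <- A) c n * (n%:R * z ^+ n.-1) = \sum_(n <- B) dcoef c n * z ^+ n.
    rewrite big_imfset/=; last first.
      by move=> [|m] [|n]; rewrite !inE//= => _ _ ->.
    have [A0'|A0'] := boolP (0%N \in A); last first.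
      rewrite (_ : (A `\ 0%N)%fset = A); last first.
        by apply/fsetP => -[|n]; rewrite !inE//= (negbTE A0').
      rewrite big_seq [RHS]big_seq; apply: eq_bigr => -[|n] nA.
        by rewrite nA in A0'.
      by rewrite /dcoef /=; ring.
    rewrite (big_fsetD1 0%N)//= mul0r mulr0 add0r.
    rewrite big_seq [RHS]big_seq; apply: eq_bigr => -[|n]; rewrite !inE//= => nA.
    by rewrite /dcoef /=; ring.
  apply: A0P; apply/fsubsetP => n nA0; apply/imfsetP; exists n.+1 => //=.
  by rewrite !inE/=; move/fsubsetP: A0A; apply; apply/imfsetP; exists n.
rewrite -isumZ// isumB; do ?exact: fseries_summable.
rewrite isumB; last 2 first.
- apply: abs_summableD; first exact: fseries_summable.
  have := abs_summableZ (-1) (fseries_summable z ec).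
  by congr abs_summable; apply/funext => n; rewrite mulN1r.
- exact: abs_summableZ.
rewrite mulrC; apply: isum_le; apply: bounded_sums_le; last first.
  by apply: bounded_sumsZ cK; rewrite exprn_ge0 ?normc_ge0.
move=> n /=; rewrite [X in normc X](_ : _ = c n *
  ((z + h) ^+ n - z ^+ n - h * (n%:R * z ^+ n.-1))); last by ring.
rewrite ComplexField.Normc.normcM.
rewrite [leRHS]mulrCA; apply: ler_wpM2l; first exact: normc_ge0.
apply: le_trans (@expr_taylor_bound z h r n _ _ _) _.
- by rewrite /r; have := normc_ge0 z; lra.
- by rewrite /r; lra.
- by apply: le_trans (normcD_le _ _) _; rewrite /r; lra.
rewrite mulrAC mulrC ler_wpM2l ?exprn_ge0 ?normc_ge0// exprMn.
apply: ler_wpM2r; first by rewrite exprn_ge0// /r; have := normc_ge0 z; lra.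
have -> : 4 = 2 ^+ 2 :> R by rewrite expr2; ring.
rewrite -exprM mulnC exprM; apply: lerXn2r; rewrite ?nnegrE ?exprn_ge0//.
by rewrite -natrX ler_nat ltnW// ltn_expl.
Qed.

Lemma fseries_quotient_cvg c z : entire_coefs c ->
  (h^-1 *: (fseries c (h + z) - fseries c z)) @[h --> (0 : C^o)^'] -->
    fseries (dcoef c) z.
Proof.
move=> ec; have [K cK] := fseries_taylor_bound z ec.
have K0 : 0 <= K.
  have := cK 1; rewrite ComplexField.Normc.normc1 expr1n mulr1.
  by move=> /(_ (lexx _)); apply: le_trans; exact: normc_ge0.
apply/cvgcP => e e0.
(* The difference quotient is off by at most K |h|; the denominator is K + 1 because K may be 0. *)
have d0 : 0 < Num.min 1 (e / (K + 1)) by rewrite lt_min ltr01 divr_gt0//; lra.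
have /= : \forall h \near (0 : C^o)^', `|h| < (Num.min 1 (e / (K + 1)))%:C :> C.
  by apply: dnbhs0_lt; rewrite ltcR.
have : \forall h \near (0 : C^o)^', h != 0 by exact: nbhs_dnbhs_neq.
apply: filterS2 => h h0; rewrite normr_normc ltcR lt_min => /andP[h1 hK].
have hn0 : 0 < normc h by rewrite lt_def normc_eq0 h0 normc_ge0.
have := cK h (ltW h1); rewrite [h + z]addrC.
set D := fseries (dcoef c) z; set F := _ - fseries c z => FD.
have -> : h^-1 *: F - D = h^-1 * (F - h * D).
  by rewrite mulrBr mulKf.
rewrite ComplexField.Normc.normcM ComplexField.Normc.normcV.
rewrite mulrC ltr_pdivrMr//; apply: le_lt_trans FD _.
rewrite expr2 mulrA ltr_pM2r//; move: hK; rewrite ltr_pdivlMr; last by lra.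
by apply: le_lt_trans; rewrite mulrDr mulr1 mulrC lerDl ltW.
Qed.

Lemma derive1_fseries c : entire_coefs c -> derive1 (fseries c) = fseries (dcoef c).
Proof.
by move=> ec; apply/funext => z; apply: cvg_lim => //; exact: fseries_quotient_cvg.
Qed.

Lemma entire_fseries c : entire_coefs c -> entire (fseries c).
Proof.
move=> ec z; apply/cvg_ex; exists (fseries (dcoef c) z).
have E : (fun h : C^o => h^-1 *: ((fseries c \o shift z) (h *: 1) - fseries c z)) =
    (fun h : C^o => h^-1 *: (fseries c (h + z) - fseries c z)).
  by apply/funext => h; rewrite /= [h *: 1]mulr1.
by rewrite E; exact: fseries_quotient_cvg.
Qed.

Lemma fseries0 c : fseries c 0 = c 0%N.
Proof.
rewrite /fseries (@isum_fset _ _ _ [fset 0%N]%fset).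
  by rewrite big_seq_fset1 expr0 mulr1.
by move=> n; rewrite inE => n0; rewrite expr0n (negbTE n0) mulr0.
Qed.

Lemma taylor_fseries c n : entire_coefs c -> taylor (fseries c) n = c n.
Proof.
move=> ec; rewrite /taylor.
have [eD ->] : entire_coefs (iter n dcoef c) /\
    derive1n n (fseries c) = fseries (iter n dcoef c).
  elim: n => [//|n [IH1 IH2]]; split; first exact: entire_dcoef.
  by rewrite /derive1n iterS -/(derive1n n _) IH2 derive1_fseries.
have dE k : k`!%:R * iter n dcoef c k = (n + k)`!%:R * c (n + k)%N.
  elim: n k {eD} => [//|n IH] k; rewrite iterS /dcoef -/dcoef mulrA -natrM.
  by rewrite mulnC -factS IH addnS.
rewrite fseries0; have := dE 0%N; rewrite fact0 mul1r addn0 => ->.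
by rewrite mulrAC divff ?mul1r// pnatr_eq0 -lt0n fact_gt0.
Qed.

(** An extension of the germ of 1/Z is known only near 0. The induction carries equality on a
    neighbourhood, since differentiating at a point requires equality around it. *)
Lemma taylor_near (F G : C^o -> C^o) n :
  (\forall u \near (0 : C^o), F u = G u) -> taylor F n = taylor G n.
Proof.
move=> FG; rewrite /taylor; congr (_ / _).
suff : \forall u \near (0 : C^o), derive1n n F u = derive1n n G u by exact: nbhs_singleton.
elim: n => [//|n IH]; rewrite /derive1n !iterS -!/(derive1n n _).
apply: filterS (near_join IH) => u Hu.
by rewrite !derive1E; exact: near_eq_derive.
Qed.

End PowerSeries.

(** * Regrouping an unordered sum by degree into a power series *)

Section Regrouping.
Variables (R : realType) (I : choiceType).
Local Notation C := R[i].
Implicit Types f g : I -> C.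

Lemma isumD f g : abs_summable f -> abs_summable g ->
  isum f + isum g = isum (fun i => f i + g i).
Proof.
move=> sf sg; have sg' := abs_summableZ (-1) sg.
rewrite -[isum g]opprK -[- isum g]mulN1r -isumZ// isumB//.
by congr isum; apply/funext => i; rewrite mulN1r opprK.
Qed.

Lemma isum_sum (J : choiceType) (s : seq J) (f : J -> I -> C) :
  (forall j, abs_summable (f j)) ->
  \sum_(j <- s) isum (f j) = isum (fun i => \sum_(j <- s) f j i) /\
  abs_summable (fun i => \sum_(j <- s) f j i).
Proof.
move=> sf; elim: s => [|j s [IH1 IH2]].
  rewrite big_nil; split.
    by rewrite (@isum_fset _ _ _ fset0) ?big_seq_fset0// => i; rewrite big_nil.
  apply: (@abs_summable_le _ _ _ (fun=> 0) 0) => [i|A].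
    by rewrite big_nil ComplexField.Normc.normc0.
  by rewrite big1.
rewrite big_cons IH1 isumD//; split.
  by congr isum; apply/funext => i; rewrite big_cons.
have := abs_summableD (sf j) IH2; congr abs_summable.
by apply/funext => i; rewrite big_cons.
Qed.

Variables (phi : I -> nat) (r K : R) (f : I -> C).
Hypotheses (r0 : 0 < r) (fK : bounded_sums (fun i => normc (f i) * r ^+ phi i) K).

(** The coefficient of u^n in the sum of the f i u^(phi i). *)
Definition degree_coef (n : nat) : C := isum (fun i => f i *+ (phi i == n)).

Lemma degree_summable n : abs_summable (fun i => f i *+ (phi i == n)).
Proof.
apply: (abs_summable_le _ (@bounded_sumsZ _ _ _ K (r ^- n) _ fK)) => [i|]; last first.
  by rewrite invr_ge0 exprn_ge0 ?ltW.
have rn : r ^+ n != 0 by rewrite expf_neq0 ?gt_eqF.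
case: eqP => [<-|_]; first by rewrite mulr1n mulrCA mulVf ?mulr1// expf_neq0 ?gt_eqF.
rewrite mulr0n ComplexField.Normc.normc0.
by rewrite mulr_ge0 ?invr_ge0 ?mulr_ge0 ?exprn_ge0 ?normc_ge0 ?ltW.
Qed.

(** Every index has a single degree, so after replacing the infinite sums by sums over a common
    finite [A] no term is counted twice. *)
Lemma degree_coef_bound : bounded_sums (fun n => normc (degree_coef n) * r ^+ n) K.
Proof.
move=> S; apply/ler_addgt0Pr => e e0.
(* The errors [d n], weighted by r^n, add up to at most [e] over [S]; the successor keeps the
   denominator nonzero for empty [S]. *)
pose d n : R := e / (#|` S|.+1%:R * r ^+ n).
have d0 n : 0 < d n by rewrite divr_gt0// mulr_gt0 ?exprn_gt0.
have := near_fset_all (totally_filter (I := I)) S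
  (fun n => isum_near (degree_summable n) (d0 n)).
move=> [A _ /(_ A (fsubset_refl A))] /= HA.
apply: (@le_trans _ _ (\sum_(n <- S) (\sum_(i <- A) (normc (f i) * r ^+ phi i) *+ (phi i == n)
   + e / #|` S|.+1%:R))).
  rewrite big_seq [leRHS]big_seq; apply: ler_sum => n nS.
  have rn : 0 < r ^+ n by rewrite exprn_gt0.
  rewrite -ler_pdivlMr//; apply: (@le_trans _ _
    (normc (\sum_(i <- A) f i *+ (phi i == n)) + d n)).
    rewrite -[degree_coef n](subKr (\sum_(i <- A) f i *+ (phi i == n))).
    apply: le_trans (normcB_le _ _) _; rewrite lerD2l; apply: ltW; exact: HA.
  rewrite ler_pdivlMr// mulrDl; apply: lerD.
    rewrite mulrC -ler_pdivlMl//; apply: le_trans (normc_sum _ _ _) _.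
    rewrite ler_pdivlMl// mulr_sumr; apply: ler_sum => i _.
    by case: eqP => [->|_]; rewrite ?mulr1n ?mulr0n 1?mulrC// ComplexField.Normc.normc0 mul0r.
  by rewrite /d invfM mulrA divfK ?gt_eqF.
rewrite big_split/=; apply: lerD.
  rewrite exchange_big/=; apply: le_trans (fK A).
  apply: ler_sum => i _; rewrite sumrMnr.
  have [iS|iS] := boolP (phi i \in S).
    rewrite (big_fsetD1 (phi i))//= eqxx big1_seq ?addn0 ?mulr1n// => n.
    by rewrite !inE => /andP[_ /andP[/negbTE nf _]]; rewrite eq_sym nf.
  rewrite big1_seq ?mulr0n ?mulr_ge0 ?normc_ge0 ?exprn_ge0 ?ltW// => n /andP[_ nS].
  by case: eqP => // nf; rewrite nf nS in iS.
rewrite big_const_seq count_predT iter_addr_0 -[e / _ *+ _]mulr_natr.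
rewrite mulrAC ler_pdivrMr//; apply: ler_wpM2l; first exact: ltW.
by rewrite ler_nat cardfE -cardfE.
Qed.

(** Both sides are limits over finite sets [S] of degrees: [f_ S] keeps the terms with degree in
    [S], and its sum is the partial sum over [S] of the power series. *)
Lemma isum_degree u : normc u <= r ->
  isum (fun i => f i * u ^+ phi i) = fseries degree_coef u.
Proof.
move=> ur; have fu i : normc (f i * u ^+ phi i) <= normc (f i) * r ^+ phi i.
  rewrite ComplexField.Normc.normcM normcX ler_wpM2l ?normc_ge0//.
  by apply: lerXn2r; rewrite ?nnegrE ?normc_ge0// ltW.
pose f_ (S : {fset nat}) i := (f i * u ^+ phi i) *+ (phi i \in S).
have /cvgcP cf : isum (f_ S) @[S --> totally] --> (isum (fun i => f i * u ^+ phi i) : C^o).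
  apply: (isum_dominated _ _ fK) => [S i|i].
    rewrite /f_; case: (_ \in _); rewrite ?mulr1n ?fu// mulr0n.
    by rewrite ComplexField.Normc.normc0 mulr_ge0 ?normc_ge0 ?exprn_ge0 ?ltW.
  exists [fset phi i]%fset => // S /= /fsubsetP /(_ (phi i)).
  by rewrite inE eqxx /f_ => /(_ isT) ->.
apply/esym/isum_unique => e e0; apply: filterS (cf e e0) => S; congr (normc (_ - _) < _).
have [E _] := isum_sum S (fun n => abs_summableZ (u ^+ n) (degree_summable n)).
rewrite (eq_bigr (fun n => isum (fun i => u ^+ n * (f i *+ (phi i == n))))); last first.
  by move=> n _; rewrite (isumZ _ (degree_summable n)) mulrC.
rewrite E; congr isum; apply/funext => i; rewrite /f_.
have [iS|iS] := boolP (phi i \in S).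
  rewrite (big_fsetD1 (phi i))//= eqxx big1_seq ?addr0 ?mulr1n 1?mulrC// => n.
  by rewrite !inE => /andP[_ /andP[/negbTE nf _]]; rewrite eq_sym nf mulr0n mulr0.
rewrite big1_seq ?mulr0n// => n /andP[_ nS].
by case: eqP => [nf|]; rewrite ?mulr0n ?mulr0//; rewrite nf nS in iS.
Qed.

End Regrouping.

(** * Determinants and Newton identities *)

Section Determinants.
Variable K : comNzRingType.

(** One block matrix is factored in two ways, through its two Schur complements. *)
Lemma det_1add_mulmxC m n (A : 'M[K]_(m, n)) (B : 'M[K]_(n, m)) :
  \det (1%:M + A *m B) = \det (1%:M + B *m A).
Proof.
have E1 : block_mx 1%:M (- A) B 1%:M =
    block_mx 1%:M 0 B 1%:M *m block_mx 1%:M (- A) 0 (1%:M + B *m A).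
  rewrite mulmx_block !mul1mx !mulmx1 ?mul0mx ?mulmx0 !addr0 mulmxN.
  by rewrite addrC addrK.
have E2 : block_mx 1%:M (- A) B 1%:M =
    block_mx (1%:M + A *m B) (- A) 0 1%:M *m block_mx 1%:M 0 B 1%:M.
  by rewrite mulmx_block !mul1mx !mulmx1 ?mul0mx ?mulmx0 !add0r mulNmx addrK.
have := congr1 determinant E1; rewrite {1}E2 !det_mulmx !det_lblock !det_ublock.
by rewrite !det1 !mul1r !mulr1.
Qed.

Lemma det_block_1 n (B C : 'M[K]_n) :
  \det (block_mx 1%:M B C 1%:M) = \det (1%:M - C *m B).
Proof.
have -> : block_mx 1%:M B C 1%:M =
    block_mx 1%:M 0 C 1%:M *m block_mx 1%:M B 0 (1%:M - C *m B).
  rewrite mulmx_block !mul1mx !mulmx1 ?mul0mx ?mulmx0 !addr0.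
  by rewrite addrC subrK.
by rewrite det_mulmx det_lblock det_ublock !det1 !mul1r.
Qed.

(** Its determinant is the principal minor on [S]; filling up with rows of the identity gives all
    minors the same matrix type. *)
Definition minor_mx n (M : 'M[K]_n) (S : {set 'I_n}) : 'M[K]_n :=
  \matrix_(i, j) if i \in S then M i j else (i == j)%:R.

(** For each permutation the product over the rows is expanded, [S] being the set of rows where the
    summand from [M] is taken. *)
Lemma det_1add_minors n (M : 'M[K]_n) :
  \det (1%:M + M) = \sum_(S : {set 'I_n}) \det (minor_mx M S).
Proof.
rewrite /determinant exchange_big/=; apply: eq_bigr => s _.
rewrite -big_distrr/=; congr (_ * _).
under eq_bigr do rewrite mxE addrC.
rewrite bigA_distr/=; apply: eq_bigr => S _; apply: eq_bigr => i _.
by rewrite !mxE.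
Qed.

(** With [H] the selection matrix of [h], the padded minor is 1 + H^T (H (M - 1)). Exchanging the
    factors leaves the size k matrix 1 + H (M - 1) H^T, which is H M H^T because H H^T = 1. *)
Lemma det_minor_mxsub n k (M : 'M[K]_n) (h : 'I_k -> 'I_n) : injective h ->
  \det (minor_mx M [set i in codom h]%SET) = \det (mxsub h h M).
Proof.
move=> hI; pose H : 'M[K]_(k, n) := \matrix_(a, i) (h a == i)%:R.
have HM p (A : 'M[K]_(n, p)) : H *m A = rowsub h A.
  apply/matrixP => a j; rewrite !mxE (bigD1 (h a))//= mxE eqxx mul1r.
  by rewrite big1 ?addr0// => i ia; rewrite mxE eq_sym (negbTE ia) mul0r.
have MH p (A : 'M[K]_(p, n)) : A *m H^T = colsub h A.
  apply/matrixP => j a; rewrite !mxE (bigD1 (h a))//= !mxE eqxx mulr1.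
  by rewrite big1 ?addr0// => i ia; rewrite !mxE eq_sym (negbTE ia) mulr0.
have -> : minor_mx M [set i in codom h]%SET = 1%:M + H^T *m (H *m (M - 1%:M)).
  apply/matrixP => i j; rewrite !mxE HM.
  under eq_bigr do rewrite !mxE.
  rewrite !inE; case: (boolP (i \in codom h)) => [/codomP[a ->]|ih].
    rewrite (bigD1 a)//= eqxx mul1r big1 ?addr0; first by ring.
    by move=> b ba; rewrite (inj_eq hI) (negbTE ba) mul0r.
  rewrite big1 ?addr0// => a _; case: eqP => [ia|_]; last by rewrite mul0r.
  by move: ih; rewrite -ia codom_f.
rewrite det_1add_mulmxC -mulmxA MH HM; congr determinant.
apply/matrixP => a b; rewrite !mxE (inj_eq hI); ring.
Qed.

Lemma det_block_diag n (a b : 'rV[K]_n) :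
  \det (block_mx 1%:M (diag_mx a) (diag_mx b) 1%:M) = \prod_i (1 - a 0 i * b 0 i).
Proof.
rewrite det_block_1 mulmx_diag.
have -> : 1%:M - diag_mx (\row_j (b 0 j * a 0 j)) = diag_mx (\row_j (1 - a 0 j * b 0 j)).
  apply/matrixP => i j; rewrite !mxE; case: eqP => [->|_]; rewrite ?mulr1n ?mulr0n ?subr0//.
  by rewrite mulrC.
by rewrite det_diag; apply: eq_bigr => i _; rewrite mxE.
Qed.

(** The index [(i + k) %% k.+1] is the cyclic predecessor of [i], so the trace runs over closed
    words of indices. *)
Lemma mxtrace_expr n k (T : 'M[K]_n) :
  \tr (T ^+ k.+1) =
  \sum_(t : k.+1.-tuple 'I_n) \prod_(i < k.+1)
    T (nth (thead t) t ((i + k) %% k.+1)) (nth (thead t) t i).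
Proof.
have powE m a b : (T ^+ m) a b =
    \sum_(t : m.-tuple 'I_n | last a t == b) \prod_(x <- pairmap T a t) x.
  elim: m a b => [|m IH] a b.
    rewrite expr0 mxE; case: eqP => [->|ab].
      rewrite (big_pred1 [tuple])/=; first by rewrite big_nil.
      by move=> t; rewrite tuple0/= eqxx.
    by rewrite big_pred0// => t; rewrite tuple0/=; apply/eqP.
  rewrite exprS mxE.
  under eq_bigr do rewrite IH big_distrr/=.
  rewrite pair_big_dep/= (reindex (fun t : m.+1.-tuple 'I_n => (thead t, [tuple of behead t])))/=.
    apply: eq_big => [t|t _]; case/tupleP: t => c t; rewrite /= ?theadE//.
    by rewrite big_cons.
  exists (fun p : 'I_n * m.-tuple 'I_n => cons_tuple p.1 p.2) => [t _|[c t] _].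
    by case/tupleP: t => c t; apply: val_inj; rewrite /= theadE.
  by congr pair; rewrite ?theadE//; apply: val_inj.
rewrite /mxtrace; under eq_bigr do rewrite powE.
rewrite (exchange_big_dep xpredT)//=; apply: eq_bigr => t _.
rewrite (big_pred1 (last (thead t) t)); last first.
  by move=> a; case/tupleP: t => c t; rewrite /= eq_sym.
set a := last _ _; rewrite (big_nth 0) size_pairmap size_tuple big_mkord.
apply: eq_bigr => -[i ik] _; rewrite /= (nth_pairmap (thead t)) ?size_tuple//.
congr (T _ _).
case: i ik => [|i] ik /=; last by rewrite addSnnS modnDr modn_small// ltnW.
by rewrite add0n modn_small// /a (last_nth (thead t)) size_tuple.
Qed.

End Determinants.

(** * Polynomial identities up to a fixed degree *)

Section TruncatedPoly.
Variable K : comNzRingType.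
Implicit Types p q : {poly K}.

Definition coef_eq N p q := forall k, (k <= N)%N -> p`_k = q`_k.

Lemma coef_eq_mul N p p' q q' :
  coef_eq N p p' -> coef_eq N q q' -> coef_eq N (p * q) (p' * q').
Proof.
move=> pp' qq' k kN; rewrite !coefM; apply: eq_bigr => -[j jk] _ /=.
by rewrite pp' ?qq'//; lia.
Qed.

Lemma coef_eq_prod N (I : Type) (r : seq I) (p q : I -> {poly K}) :
  (forall i, coef_eq N (p i) (q i)) ->
  coef_eq N (\prod_(i <- r) p i) (\prod_(i <- r) q i).
Proof.
move=> pq; elim: r => [|i r IH]; first by rewrite !big_nil.
by rewrite !big_cons; exact: coef_eq_mul.
Qed.

Lemma coef_eq_det N n (A B : 'M[{poly K}]_n) :
  (forall i j, coef_eq N (A i j) (B i j)) -> coef_eq N (\det A) (\det B).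
Proof.
move=> AB k kN; rewrite /determinant !coef_sum; apply: eq_bigr => s _.
by apply: coef_eq_mul kN => // j jN; apply: coef_eq_prod.
Qed.

(* The Bass factorization up to degree N. Matrices act on row vectors, so
   [sg *m J ^+ k *m ta] is the matrix of tau J^k sigma. *)
Lemma bass_factorization N (m n : nat) (sg : 'M[K]_(m, n)) (ta : 'M[K]_(n, m))
    (J : 'M[K]_n) :
  coef_eq N (\det (1%:M - 'X *: map_mx polyC (ta *m sg - J)))
    (\det (1%:M + 'X *: map_mx polyC J) *
     \det (1%:M + \sum_(k < N) (- 'X) ^+ k.+1 *: map_mx polyC (sg *m (J ^+ k) *m ta))).
Proof.
(* [S] is the geometric series of (1 + uJ)^-1 cut after N terms; multiplied by 1 - Y it gives 1 -
   Y^N. *)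
pose Y := (- 'X : {poly K}) *: map_mx polyC J.
pose S := \sum_(k < N) Y ^+ k.
have YE k : Y ^+ k = (- 'X) ^+ k *: map_mx polyC (J ^+ k).
  elim: k => [|k IH]; first by rewrite !expr0 scale1r map_mx1.
  rewrite exprS IH -[Y * _]/(Y *m _) /Y -scalemxAl -scalemxAr scalerA -exprS.
  by rewrite (exprS J) -[J * _]/(J *m _) map_mxM.
have XJ : 1%:M + 'X *: map_mx polyC J = 1%:M - Y by rewrite /Y scaleNr opprK.
have geo : (1%:M - Y) *m S = 1%:M - Y ^+ N.
  elim: N @S => [|N IH] /=; first by rewrite big_ord0 expr0 mulmx0 subrr.
  rewrite big_ord_recr/= mulmxDr IH mulmxBl mul1mx exprS -[Y * _]/(Y *m _).
  by rewrite addrA subrK.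
have -> : \sum_(k < N) (- 'X) ^+ k.+1 *: map_mx polyC (sg *m (J ^+ k) *m ta) =
    (- map_mx polyC sg) *m ('X *: (S *m map_mx polyC ta)).
  rewrite mulNmx -scalemxAr mulmxA mulmx_sumr mulmx_suml scaler_sumr -sumrN.
  apply: eq_bigr => k _; rewrite YE -scalemxAr -scalemxAl scalerA !map_mxM.
  by rewrite exprS mulNr scaleNr.
rewrite det_1add_mulmxC -det_mulmx XJ mulmxDr mulmx1.
rewrite -!scalemxAl -scalemxAr !mulmxA geo mulmxN.
set st := map_mx polyC ta *m map_mx polyC sg.
have -> : 1%:M - Y + 'X *: - ((1%:M - Y ^+ N) *m map_mx polyC ta *m map_mx polyC sg) =
    1%:M - 'X *: map_mx polyC (ta *m sg - J) + 'X *: (Y ^+ N *m st).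
  rewrite -mulmxA -/st mulmxBl mul1mx map_mxB map_mxM -/st /Y scaleNr opprK.
  by apply/matrixP => i j; rewrite !mxE; ring.
(* The leftover ['X *: (Y ^+ N *m st)] is divisible by X^(N+1), hence invisible in the entries up to
   degree N. *)
apply: coef_eq_det => i j k kN; set A := 1%:M - _.
rewrite [(A + _) i j]mxE coefD.
have EZ (a : {poly K}) (B : 'M[{poly K}]_n) : (a *: B) i j = a * B i j by rewrite mxE.
rewrite YE -scalemxAl !EZ mulrA.
pose c : {poly K} := (map_mx polyC (J ^+ N) *m st) i j; rewrite -/c.
have -> : 'X * (- 'X) ^+ N * c = 'X^(N.+1) * ((-1) ^+ N * c).
  by rewrite (exprNn 'X) exprS; ring.
by rewrite coefXnM ltnS kN addr0.
Qed.

End TruncatedPoly.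

Section Newton.
Variable K : numFieldType.
Implicit Types (p q s t : {poly K}) (c : K) (l : nat).

(* [s] is the negative of the logarithmic derivative X p'/p, up to degree N. *)
Definition newton N p s := coef_eq N ('X * p^`() + s * p) 0.

Lemma newtonM N p q s t : newton N p s -> newton N q t -> newton N (p * q) (s + t).
Proof.
move=> ps qt k kN.
have -> : 'X * (p * q)^`() + (s + t) * (p * q) =
    ('X * p^`() + s * p) * q + ('X * q^`() + t * q) * p.
  by rewrite derivM; ring.
rewrite coefD.
have -> := coef_eq_mul ps (fun k _ => erefl q`_k) kN.
have -> := coef_eq_mul qt (fun k _ => erefl p`_k) kN.
by rewrite !mul0r coef0 addr0.
Qed.

Lemma newton1 N : newton N 1 0.
Proof. by move=> k _; rewrite derivC mulr0 mul0r addr0. Qed.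

Lemma newton_prod N (I : Type) (r : seq I) (p s : I -> {poly K}) :
  (forall i, newton N (p i) (s i)) ->
  newton N (\prod_(i <- r) p i) (\sum_(i <- r) s i).
Proof.
move=> ps; elim: r => [|i r IH]; first by rewrite !big_nil; exact: newton1.
by rewrite !big_cons; apply: newtonM.
Qed.

(** Since s has no constant term, the coefficient of degree k + 1 in X p' + s p is (k + 1) p_(k+1)
    plus a combination of lower coefficients of p, and k + 1 is invertible. *)
Lemma newton_unique N p q s : s`_0 = 0 -> p`_0 = q`_0 ->
  newton N p s -> newton N q s -> coef_eq N p q.
Proof.
move=> s0 pq0 ps qs; suff H k : (k <= N)%N -> (p - q)`_k = 0.
  by move=> k /H/eqP; rewrite coefB subr_eq0 => /eqP.
elim/ltn_ind: k => k IH kN.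
case: k => [|k] in IH kN *; first by rewrite coefB pq0 subrr.
have : ('X * (p - q)^`() + s * (p - q))`_k.+1 = 0.
  rewrite derivB !mulrBr; have := ps _ kN; have := qs _ kN.
  rewrite coef0 => E1 E2; rewrite addrACA -opprD coefB E1 E2 subrr//.
move: (p - q) IH => D IH; rewrite coefD coefXM/= coef_deriv coefM big_ord_recl/= s0 mul0r add0r.
rewrite big1 ?addr0; last first.
  by move=> [j jk] _; rewrite IH ?mulr0//= /bump /=; lia.
by move=> /eqP; rewrite mulrn_eq0/= => /eqP.
Qed.

(** The expansion of - X p'/p for p = 1 - c X^l: the sum over j > 0 of l c^j X^(j l), truncated. *)
Definition power_poly N c l : {poly K} :=
  \poly_(k < N.+1) (if (0 < k)%N && (l %| k)%N then l%:R * c ^+ (k %/ l) else 0).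

Lemma newton_factor N c l : (0 < l)%N ->
  newton N (1 - c *: 'X^l) (power_poly N c l).
Proof.
move=> l0 k kN; rewrite coef0 derivB derivC sub0r derivZ derivXn.
rewrite mulrN -scalerAr mulrnAr -exprS prednK// mulrBr mulr1 -scalerAr.
rewrite !coefD !coefN !coefZ coefMn coefXn coefMXn !coef_poly ltnS kN.
have [kl|lk] := ltnP k l.
  rewrite mulr0 subr0 (ltn_eqF kl) mul0rn mulr0 oppr0 add0r.
  case: k kN kl => [//|k] kN kl /=.
  by rewrite gtnNdvd.
rewrite ltnS (leq_trans (leq_subr _ _) kN) subn_gt0 (leq_trans l0 lk)/=.
rewrite dvdn_subl//.
move: lk; rewrite leq_eqVlt => /orP[/eqP <-|lk].
  by rewrite eqxx ltnn/= mulr0 subr0 dvdnn divnn l0 expr1; ring.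
rewrite (gtn_eqF lk) lk mul0rn mulr0 oppr0 add0r/=.
case: (boolP (l %| k)%N) => [lk'|_]; last by rewrite mulr0 subrr.
rewrite -{1}(subnK (ltnW lk)) divnDr ?dvdnn// divnn l0 addn1 exprS; ring.
Qed.

End Newton.

Section NewtonDet.
Variable C : numClosedFieldType.

Definition trace_poly N n (T : 'M[C]_n) : {poly C} :=
  \poly_(k < N.+1) (if (0 < k)%N then \tr (T ^+ k) else 0).

(** The factor is written with ['X^1] so that [newton_factor] applies with l = 1. *)
Lemma det_1sub_trig n (U : 'M[C]_n) : is_trig_mx U ->
  \det (1%:M - 'X *: map_mx polyC U) = \prod_i (1 - U i i *: 'X^1).
Proof.
move=> Utrig; rewrite det_trig.
  by apply: eq_bigr => i _; rewrite !mxE eqxx expr1 -mul_polyC mulrC.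
apply/is_trig_mxP => i j ij; rewrite !mxE (is_trig_mxP Utrig)// mulr0 subr0.
by case: eqP ij => // ->; rewrite ltnn.
Qed.

(** Schur triangularization over an algebraically closed field makes the determinant a product of
    linear factors and the traces of powers the power sums of the diagonal. Logarithmic derivatives
    then add up factor by factor. *)
Lemma newton_det N n (T : 'M[C]_n) :
  newton N (\det (1%:M - 'X *: map_mx polyC T)) (trace_poly N T).
Proof.
case: n T => [|n] T.
  rewrite det_mx00 (_ : trace_poly _ _ = 0); first exact: newton1.
  apply/polyP => k; rewrite coef_poly coef0; case: ifP => // _.
  by rewrite /mxtrace big_ord0 if_same.
have [P /unitarymx_unit Pu H] := Schur T (ltn0Sn n).
have {H} : is_trig_mx (conjmx P T) := H.
rewrite conjumx//; set U := P *m T *m invmx P => Utrig.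
have trigM (A B : 'M[C]_n.+1) : is_trig_mx A -> is_trig_mx B ->
    is_trig_mx (A *m B) /\ forall i, (A *m B) i i = A i i * B i i.
  move=> /is_trig_mxP tA /is_trig_mxP tB; split.
    apply/is_trig_mxP => i j ij; rewrite mxE big1// => k _.
    have [ki|ik] := leqP k i; first by rewrite (tB k j) ?mulr0// (leq_ltn_trans ki).
    by rewrite tA ?mul0r.
  move=> i; rewrite mxE (bigD1 i)//= big1 ?addr0// => k ki.
  have [ik|ik|/val_inj ik] := ltngtP k i; last by rewrite ik eqxx in ki.
    by rewrite tB ?mulr0.
  by rewrite tA ?mul0r.
have UX k : is_trig_mx (U ^+ k) /\ forall i, (U ^+ k) i i = U i i ^+ k.
  elim: k => [|k [IH1 IH2]].
    split=> [|i]; last by rewrite !expr0 mxE eqxx.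
    by apply/is_trig_mxP => i j ij; rewrite expr0 mxE; case: eqP ij => // ->; rewrite ltnn.
  have [E1 E2] := trigM _ _ Utrig IH1; rewrite exprS; split=> // i.
  by rewrite exprS -IH2; exact: E2.
have TU k : \tr (T ^+ k) = \sum_i U i i ^+ k.
  under eq_bigr do rewrite -(UX k).2.
  have -> : U ^+ k = P *m T ^+ k *m invmx P.
    elim: k => [|k IH]; first by rewrite !expr0 mulmx1 mulmxV.
    rewrite exprS IH -[U * _]/(U *m _) /U exprS -[T * _]/(T *m _) !mulmxA.
    by rewrite mulmxKV.
  by rewrite -/(mxtrace _) mxtrace_mulC mulmxA mulVmx// mul1mx.
have -> : \det (1%:M - 'X *: map_mx polyC T) = \prod_i (1 - U i i *: 'X^1).
  transitivity (\det (1%:M - 'X *: map_mx polyC U)).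
    have PK : map_mx polyC P *m map_mx polyC (invmx P) = 1%:M :> 'M[{poly C}]_n.+1.
      by rewrite -map_mxM mulmxV// map_mx1.
    have -> : 1%:M - 'X *: map_mx polyC U = map_mx polyC P *m
        (1%:M - 'X *: map_mx polyC T) *m map_mx polyC (invmx P).
      rewrite mulmxBr mulmx1 mulmxBl PK -scalemxAr -scalemxAl.
      by rewrite -!map_mxM.
    by rewrite !det_mulmx mulrAC -det_mulmx PK det1 mul1r.
  exact: det_1sub_trig.
have -> : trace_poly N T = \sum_i power_poly N (U i i) 1.
  apply/polyP => k; rewrite coef_sum !coef_poly.
  under eq_bigr do rewrite coef_poly dvd1n andbT divn1 mul1r.
  case: ifP => _; last by rewrite big1.
  by case: ifP => _; rewrite ?TU// big1.
by apply: newton_prod => i; exact: newton_factor.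
Qed.

End NewtonDet.

(** * Coefficient bounds for determinants *)

Section CoefBound.
Variable R : realType.
Local Notation C := R[i].
Implicit Types (p : {poly C}) (q : {poly R}).

Definition majorant p q := forall k, normc p`_k <= q`_k.

Lemma majorantM p q p' q' :
  majorant p q -> majorant p' q' -> majorant (p * p') (q * q').
Proof.
move=> pq pq' k; rewrite !coefM; apply: le_trans (normc_sum _ _ _) _.
apply: ler_sum => i _; rewrite ComplexField.Normc.normcM.
by apply: ler_pM; rewrite ?normc_ge0.
Qed.

Lemma majorant1 : majorant 1 1.
Proof. by move=> k; rewrite !coef1 normc_natr. Qed.

Lemma majorant_sum I (r : seq I) (P : pred I) (p : I -> {poly C}) (q : I -> {poly R}) :
  (forall i, P i -> majorant (p i) (q i)) ->
  majorant (\sum_(i <- r | P i) p i) (\sum_(i <- r | P i) q i).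
Proof.
move=> pq k; rewrite !coef_sum; apply: le_trans (normc_sum _ _ _) _.
by apply: ler_sum => i Pi; exact: pq.
Qed.

Lemma majorant_prod I (r : seq I) (p : I -> {poly C}) (q : I -> {poly R}) :
  (forall i, majorant (p i) (q i)) ->
  majorant (\prod_(i <- r) p i) (\prod_(i <- r) q i).
Proof.
move=> pq; elim: r => [|i r IH]; first by rewrite !big_nil; exact: majorant1.
by rewrite !big_cons; exact: majorantM.
Qed.

Definition nneg_coefs q := forall k, 0 <= q`_k.

Lemma nneg_coefsM q q' : nneg_coefs q -> nneg_coefs q' -> nneg_coefs (q * q').
Proof.
by move=> q0 q0' k; rewrite coefM sumr_ge0// => i _; rewrite mulr_ge0.
Qed.

Lemma nneg_coefs_prod I (r : seq I) (q : I -> {poly R}) :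
  (forall i, nneg_coefs (q i)) -> nneg_coefs (\prod_(i <- r) q i).
Proof.
move=> q0; elim: r => [|i r IH]; last by rewrite big_cons; exact: nneg_coefsM.
by rewrite big_nil => k; rewrite coef1.
Qed.

(* Coefficientwise, prod (1 + x_i X) is at most exp (X * sum x_i). *)
Lemma coef_prod_linear_le I (r : seq I) (x : I -> R) k : (forall i, 0 <= x i) ->
  (\prod_(i <- r) (1 + x i *: 'X))`_k <= (\sum_(i <- r) x i) ^+ k / k`!%:R.
Proof.
move=> x0; elim: r k => [|i r IH] k.
  by rewrite !big_nil coef1 expr0n; case: k => [|k]; rewrite ?fact0 ?divr1 ?mul0r.
rewrite !big_cons mulrDl mul1r -scalerAl coefD coefZ coefXM.
set s := \sum_(j <- r) x j; have s0 : 0 <= s by apply: sumr_ge0.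
case: k => [|k]; first by have := IH 0%N; rewrite /= mulr0 addr0 !expr0.
apply: (@le_trans _ _ (s ^+ k.+1 / k.+1`!%:R + x i * (s ^+ k / k`!%:R))).
  by apply: lerD; [exact: IH|rewrite ler_wpM2l].
have kf : 0 < (k.+1`!%:R : R) by rewrite ltr0n fact_gt0.
rewrite ler_pdivlMr// mulrDl divfK ?gt_eqF// factS natrM.
rewrite [X in _ + X](_ : _ = k.+1%:R * x i * s ^+ k); last first.
  by field; rewrite pnatr_eq0 -lt0n fact_gt0.
elim: k {IH kf} => [|k IH]; first by rewrite !expr1 expr0 mulr1 mul1r addrC.
rewrite exprS [leRHS]exprS.
apply: (@le_trans _ _ ((x i + s) * (s ^+ k.+1 + k.+1%:R * x i * s ^+ k))); last first.
  by rewrite ler_wpM2l// addr_ge0.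
rewrite -[X in X <= _]addr0 -natr1 exprS.
have : 0 <= (k%:R + 1) * x i * x i * s ^+ k.
  by rewrite !mulr_ge0 ?addr_ge0 ?exprn_ge0.
rewrite -natr1; lra.
Qed.

(** Without signs, the sum over permutations is at most the sum over all maps, as every term has
    nonnegative coefficients. That larger sum factors as the product of 1 + y_i X, where y_i is the
    absolute sum of row i. *)
Lemma det_coef_bound n (T : 'M[C]_n) (x : 'I_n -> R) k :
  (forall i, \sum_j normc (T i j) <= x i) ->
  normc (\det (1%:M - 'X *: map_mx polyC T))`_k <= (\sum_i x i) ^+ k / k`!%:R.
Proof.
move=> Tx; pose q i j : {poly R} := (i == j)%:R + normc (T i j) *: 'X.
have q0 i j : nneg_coefs (q i j).
  move=> m; rewrite coefD coefZ coefX -polyC_natr coefC addr_ge0//.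
    by case: ifP.
  by rewrite mulr_ge0 ?normc_ge0.
have M1 : majorant (\det (1%:M - 'X *: map_mx polyC T))
    (\sum_(s : {perm 'I_n}) \prod_i q i (s i)).
  apply: majorant_sum => s _ m.
  rewrite (_ : normc _ = normc (\prod_i (1%:M - 'X *: map_mx polyC T : 'M[{poly C}]_n) i (s i))`_m); last first.
    by case: (odd_perm s); rewrite ?expr1 ?expr0 ?mulN1r ?mul1r ?coefN ?normcNE.
  suff H : majorant (\prod_i (1%:M - 'X *: map_mx polyC T : 'M[{poly C}]_n) i (s i))
    (\prod_i q i (s i)) by exact: H.
  apply: majorant_prod => i l; rewrite !mxE coefB coefD coefZ coefXM coefC coefX -polyC_natr !coefC.
  apply: le_trans (normcB_le _ _) _; apply: lerD.
    rewrite -[in leRHS]polyC_natr coefC.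
    by case: ifP => _; rewrite ?normc_natr// ComplexField.Normc.normc0.
  by case: l => [|[|l]]; rewrite [X in normc X]/= ?mulr1 ?mulr0 ?ComplexField.Normc.normc0.
apply: le_trans (M1 k) _.
apply: (@le_trans _ _ (\sum_(f : {ffun 'I_n -> 'I_n}) \prod_i q i (f i))`_k).
  rewrite !coef_sum.
  rewrite (eq_bigr (fun s : {perm 'I_n} => (\prod_i q i (pval s i))`_k)); last first.
    move=> s _; have -> // : \prod_i q i (s i) = \prod_i q i (pval s i).
    by apply: eq_bigr => i _; rewrite pvalE.
  rewrite -(big_imset (fun f : {ffun 'I_n -> 'I_n} => (\prod_i q i (f i))`_k) (in2W val_inj))/=.
  rewrite [leRHS](bigID (fun f => f \in [set pval s | s in xpredT]%SET))/=.
  rewrite -[leLHS]addr0; apply: lerD; last first.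
    by apply: sumr_ge0 => f _; apply: nneg_coefs_prod.
  rewrite le_eqVlt; apply/orP; left; apply/eqP; apply: eq_bigl => f.
  by apply/imsetP/imsetP => -[s _ ->]; exists s.
rewrite -bigA_distr_bigA/=.
pose y i := \sum_j normc (T i j).
have -> : \prod_i \sum_j q i j = \prod_i (1 + y i *: 'X).
  apply: eq_bigr => i _; rewrite big_split/= -scaler_suml; congr (_ + _).
  by rewrite (bigD1 i)//= eqxx big1 ?addr0// => j ji; rewrite eq_sym (negbTE ji).
have y0 i : 0 <= y i by apply: sumr_ge0 => j _; exact: normc_ge0.
apply: le_trans (coef_prod_linear_le _ _ y0) _.
rewrite ler_wpM2r ?invr_ge0//; apply: lerXn2r; rewrite ?nnegrE ?sumr_ge0//.
  by move=> i _; exact: le_trans (y0 i) (Tx i).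
by apply: ler_sum => i _; exact: Tx.
Qed.

End CoefBound.

(** * The product over the edges *)

Section EntireFunctions.
Variable R : realType.
Local Notation C := R[i].
Implicit Types f g : C^o -> C^o.

Lemma entire_mul f g : entire f -> entire g -> entire (fun u => f u * g u).
Proof. by move=> ef eg z; exact: (derivableM (ef z) (eg z)). Qed.

Lemma entire_affine (c z : C) : entire (fun u : C^o => c * (u + z) : C^o).
Proof.
apply: entire_mul => u; first exact: derivable_cst.
by apply: derivableD; [exact: derivable_id|exact: derivable_cst].
Qed.

Lemma entire_prod (I : Type) (s : seq I) (h : I -> C^o -> C^o) :
  (forall i, entire (h i)) -> entire (fun u => \prod_(i <- s) h i u).
Proof.
move=> eh; elim: s => [|i s IH].
  rewrite (_ : (fun u => _) = cst 1) => [z|]; first exact: derivable_cst.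
  by apply/funext => u; rewrite big_nil.
rewrite (_ : (fun u => _) = (fun u => h i u * \prod_(j <- s) h j u)).
  exact: (entire_mul (eh i) IH).
by apply/funext => u; rewrite big_cons.
Qed.

Lemma totally_cvg_unique (I : choiceType) (F : {fset I} -> C^o) (a b : C^o) :
  F @ totally --> a -> F @ totally --> b -> a = b.
Proof.
move=> /(@cvgcP _ _ totally) Fa /(@cvgcP _ _ totally) Fb.
apply/eqP; rewrite -subr_eq0; apply/eqP/normc_lt_eq0 => e e0.
have e2 : 0 < e / 2 by lra.
have /(_ _)/filter_ex[A [/= Ha Hb]] := filterI (Fa _ e2) (Fb _ e2).
have -> : a - b = (F A - b) - (F A - a) by ring.
by apply: le_trans (normcB_le _ _) _; lra.
Qed.

(** On the unit ball around u every n above 1 + |u| is a bound; the covering form of compactness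
    makes n uniform. *)
Lemma compact_normc_bounded (K : set C^o) : compact K ->
  exists r : R, 0 < r /\ forall u, K u -> normc u <= r.
Proof.
move=> cK; have := (compact_near_coveringP K).1 cK nat \oo%classic
  (fun n u => normc u < n%:R) _.
case=> [u _|N _ /(_ N (leqnn N)) HN].
  near=> u' n => /=; have u'u : normc (u' - u) < 1.
    near: u'; rewrite -nbhs_nearE.
    have /cvgcP /(_ 1 ltr01) : id @ (u : C^o) --> (u : C^o) by exact: cvg_id.
    by [].
  rewrite -[u'](subrK u); apply: le_lt_trans (normcD_le _ _) _.
  apply: (@lt_trans _ _ (1 + normc u)); first by rewrite ltrD2r.
  near: n; exact: nbhs_infty_gtr.
by exists (N%:R + 1); split=> [|u /HN/ltW]; rewrite ?ltr_wpDl//; lra.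
Unshelve. all: by end_near. Qed.

Lemma family_compact_cvg (I : choiceType) (F : {fset I} -> C^o -> C^o) (f : C^o -> C^o) :
  (forall r e : R, 0 < r -> 0 < e -> exists A0 : {fset I}, forall A u,
     (A0 `<=` A)%fset -> normc u <= r -> normc (F A u - f u) < e) ->
  {family compact, F @ totally --> f}.
Proof.
move=> H; apply/fam_cvgP => K /compact_normc_bounded[r [r0 Kr]] P /uniform_nbhs.
move=> [E [+ EP]]; rewrite -entourage_ballE => -[e /= + eE].
case: e eE => e e' eE; rewrite ltcE/= => /andP[/eqP e'0 e0]; subst e'.
have [A0 A0P] := H r e r0 e0; exists A0 => // A /= A0A.
apply: EP => u /Kr ur; apply: eE; rewrite /= -ball_normE /=.
by have := A0P A u A0A ur; rewrite normcB -ltcR -normr_normc.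
Qed.

End EntireFunctions.

Section QuadraticProduct.
Variables (R : realType) (I : choiceType) (W : I -> R) (K : R).
Hypotheses (W0 : forall i, 0 <= W i) (WK : bounded_sums W K).
Local Notation C := R[i].

(** The coefficients of the product of the 1 - u^2 W i: a finite set [Q] of indices contributes in
    degree 2 |Q|. *)
Definition quad_coef : nat -> C :=
  degree_coef (fun Q : {fset I} => (2 * #|` Q|)%N) (fun Q => \prod_(i <- Q) - (W i)%:C).

Lemma quad_bound (r : R) : 0 <= r ->
  bounded_sums (fun Q : {fset I} => normc (\prod_(i <- Q) - (W i)%:C : C) * r ^+ (2 * #|` Q|))
    (expR (r ^+ 2 * K)).
Proof.
move=> r0; have := bounded_sums_prod (fun i => mulr_ge0 (sqr_ge0 r) (W0 i))
  (bounded_sumsZ (sqr_ge0 r) WK).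
apply: bounded_sums_le => Q; rewrite normc_prod exprM.
rewrite big_split big_const_seq count_predT iter_mulr_1 mulrC.
rewrite le_eqVlt; apply/orP; left; apply/eqP; congr (_ * _).
by apply: eq_bigr => i _; rewrite normcNE normcC ger0_norm.
Qed.

Lemma quad_entire : entire_coefs quad_coef.
Proof.
(* The radius is enlarged because [degree_coef_bound] asks for a positive one. *)
move=> r r0; have r1 : 0 < r + 1 by lra.
have := degree_coef_bound r1 (quad_bound (ltW r1)); set M := expR _ => HM.
exists M; apply: bounded_sums_le HM => n; rewrite ler_wpM2l ?normc_ge0//.
by apply: lerXn2r; rewrite ?nnegrE; lra.
Qed.

Lemma quad_summable (u : C) : abs_summable (fun i => - (u ^+ 2 * (W i)%:C)).
Proof.
apply: (abs_summable_le _ (bounded_sumsZ (sqr_ge0 (normc u)) WK)) => i.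
by rewrite normcNE ComplexField.Normc.normcM normcX normcC ger0_norm.
Qed.

Lemma quad_isum (u : C) :
  isum (fun Q : {fset I} => \prod_(i <- Q) - (u ^+ 2 * (W i)%:C)) = fseries quad_coef u.
Proof.
have r1 : 0 < normc u + 1 by have := normc_ge0 u; lra.
rewrite -(isum_degree r1 (quad_bound (ltW r1))); last by lra.
congr isum; apply/funext => Q; rewrite exprM.
under eq_bigr do rewrite -mulrN.
by rewrite big_split/= big_const_seq count_predT iter_mulr_1 mulrC.
Qed.

Lemma quad_cvg (u : C) :
  partial_prod (fun i => 1 - u ^+ 2 * (W i)%:C) @ totally --> fseries quad_coef u.
Proof. by rewrite -quad_isum; exact: (partial_prod_cvg (quad_summable u)). Qed.

Lemma quad_family_cvg : {family compact,
  (fun (A : {fset I}) (u : C^o) => partial_prod (fun i => 1 - u ^+ 2 * (W i)%:C) A) @ totally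
   --> fseries quad_coef}.
Proof.
apply: family_compact_cvg => r e r0 e0.
have [A0 A0P] := prod_tail (fun i => mulr_ge0 (sqr_ge0 r) (W0 i))
  (bounded_sumsZ (sqr_ge0 r) WK) e0.
exists A0 => A u A0A ur; rewrite -quad_isum; apply: A0P => // i.
rewrite normcNE ComplexField.Normc.normcM normcX normcC ger0_norm//.
by rewrite ler_wpM2r//; apply: lerXn2r; rewrite ?nnegrE ?normc_ge0// ltW.
Qed.

(** If no factor vanishes, [partial_prod_inv_cvg] makes the limit nonzero; a vanishing factor makes
    the partial products eventually 0. *)
Lemma quad_eq0 (u : C) :
  fseries quad_coef u = 0 <-> exists i, 1 - u ^+ 2 * (W i)%:C = 0.
Proof.
split=> [u0|[i ui]].
  apply: contrapT => H; have [//|] := partial_prod_inv_cvg (quad_summable u).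
    by move=> i; apply/eqP => ui; apply: H; exists i.
  by rewrite quad_isum u0 eqxx.
apply: (totally_cvg_unique (@quad_cvg u)); apply/(@cvgcP _ _ totally) => e e0.
apply/totallyP; exists [fset i]%fset => A; rewrite fsub1set => iA.
rewrite /partial_prod (big_fsetD1 i)//= ui mul0r subr0.
by rewrite ComplexField.Normc.normc0.
Qed.

(** A vanishing factor means that the summable family u^2 W i has a term of modulus 1 at u = z, so
    its index belongs to any set outside of which the sums stay below 1/2. *)
Lemma quad_finite (z : C) : exists A : {fset I}, forall i,
  i \in A <-> 1 - z ^+ 2 * (W i)%:C = 0.
Proof.
have [M HM] := quad_summable z; have h1 : 0 < 2^-1 :> R by lra.
have [A0 A0P] := bounded_sums_tail HM h1.
exists [fset i in A0 | 1 - z ^+ 2 * (W i)%:C == 0]%fset => i; rewrite !inE/=.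
split=> [/andP[_ /eqP//]|zi]; rewrite zi eqxx andbT; apply: contraT => iA0.
have : [disjoint [fset i] & A0]%fset.
  by apply/fdisjointP => j; rewrite inE => /eqP ->.
move/A0P; rewrite big_seq_fset1 normcNE; move/eqP: zi; rewrite subr_eq0 => /eqP <-.
by rewrite ComplexField.Normc.normc1; lra.
Qed.

End QuadraticProduct.

Section QuadraticZeros.
Variables (R : realType) (I : choiceType) (W : I -> R) (K : R).
Hypotheses (W0 : forall i, 0 <= W i) (WK : bounded_sums W K).
Local Notation C := R[i].

(** [W'] switches off the factors that vanish at [z] while keeping the index type; by [quad_eq0] the
    remaining product is nonzero at [z]. *)
Lemma quad_zero_of_order (z : C) (A : {fset I}) :
  (forall i, i \in A <-> 1 - z ^+ 2 * (W i)%:C = 0) ->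
  zero_of_order (fseries (quad_coef W)) z #|` A|.
Proof.
move=> AP; pose W' i := if i \in A then 0 else W i.
have W'0 i : 0 <= W' i by rewrite /W'; case: ifP.
have W'K : bounded_sums W' K.
  by apply: bounded_sums_le WK => i; rewrite /W'; case: ifP.
have fE u : fseries (quad_coef W) u =
    (\prod_(i <- A) (1 - u ^+ 2 * (W i)%:C)) * fseries (quad_coef W') u.
  apply: (totally_cvg_unique (@quad_cvg _ _ _ _ W0 WK u)).
  have := cvgM (cvg_cst (\prod_(i <- A) (1 - u ^+ 2 * (W i)%:C) : C^o))
    (@quad_cvg _ _ _ _ W'0 W'K u).
  move=> /(_ _ _) /(@cvgcP _ _ totally) H; apply/(@cvgcP _ _ totally) => e e0.
  apply: filterS2 (H e e0) (near_totally_sub A) => B + AB.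
  congr (normc (_ - _) < _); rewrite /= /partial_prod.
  rewrite (@big_fsetD _ _ _ _ (fun i => 1 - u ^+ 2 * (W' i)%:C) _ _ AB).
  rewrite [RHS](@big_fsetD _ _ _ _ (fun i => 1 - u ^+ 2 * (W i)%:C) _ _ AB)/=.
  congr (_ * _); rewrite big_seq big1 ?mul1r.
    rewrite big_seq [RHS]big_seq; apply: eq_bigr => i; rewrite inE.
    by move=> /andP[/negbTE iA _]; rewrite /W' iA.
  by move=> i iA; rewrite /W' iA mulr0 subr0.
(* For i in [A] the relation W i z^2 = 1 gives 1 - u^2 W i = (u - z) (- W i (u + z)), and u + z
   takes the nonzero value 2 z at [z]. *)
exists (fun u => (\prod_(i <- A) (- (W i)%:C * (u + z))) * fseries (quad_coef W') u); split.
- apply: entire_mul; first by apply: entire_prod => i; exact: entire_affine.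
  exact/entire_fseries/(quad_entire W'0 W'K).
- rewrite mulf_neq0//.
    rewrite prodf_seq_neq0; apply/allP => i /AP zi /=.
    have : (W i)%:C * z ^+ 2 != 0 by rewrite mulrC; move/eqP: zi; rewrite subr_eq0 => /eqP <-; exact: oner_neq0.
    rewrite mulf_eq0 negb_or expf_eq0/= => /andP[Wi z0].
    by rewrite mulf_neq0 ?oppr_eq0// -mulr2n mulrn_eq0.
  apply/eqP => G0; have [k Hk] := proj1 (@quad_eq0 _ _ _ _ W'0 W'K z) G0; move: k Hk => i; rewrite /W'; case: (boolP (i \in A)) => iA.
    by rewrite mulr0 subr0 => /eqP; rewrite oner_eq0.
  by move/AP => iA'; rewrite iA' in iA.
- move=> u; rewrite fE mulrA; congr (_ * _).
  transitivity (\prod_(i <- A) ((u - z) * (- (W i)%:C * (u + z)))).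
    rewrite big_seq [RHS]big_seq; apply: eq_bigr => i /AP/eqP.
    by rewrite subr_eq0 => /eqP Wz; rewrite {1}Wz; ring.
  by rewrite big_split/= big_const_seq count_predT iter_mulr_1.
Qed.

End QuadraticZeros.

Section WeightedGraph.
Variables (R : realType) (V : choiceType) (X : wgraph R V).
Local Notation C := R[i].
Local Notation edge := (oedge X).

Lemma wt_gt0 (e : edge) : 0 < wt e.
Proof. by apply: weight_gt0; exact: valP e. Qed.

Definition total_wt : R := fine (\esum_(e in [set: edge]) (wt e)%:E).

Lemma wt_bounded : bounded_sums (@wt R V X) total_wt.
Proof.
move=> A; rewrite -lee_fin -sumEFin /total_wt fineK; last first.
  rewrite ge0_fin_numE ?(total_weight_lty X)//.
  by apply: esum_ge0 => e _; rewrite lee_fin wt_ge0.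
apply: esum_ge; exists [set` A]; first by split; [exact: finite_fset|].
by rewrite -fsbig_seq ?fset_uniq.
Qed.

Lemma total_wt_ge0 : 0 <= total_wt.
Proof. exact: bounded_sums_ge0 wt_bounded. Qed.

Lemma wt_le_total (e : edge) : wt e <= total_wt.
Proof. exact: bounded_sums_pt wt_bounded. Qed.

Lemma erev_inj : injective (@erev R V X).
Proof. exact: can_inj (@erevK R V X). Qed.

Lemma adj_neq x y : adj X x y -> x != y.
Proof. by apply: contraTneq => ->; rewrite adj_irrefl. Qed.

Lemma erev_neq (e : edge) : erev e != e.
Proof.
apply/eqP => /(congr1 (@org R V X)) E.
have {}E : ter e = org e := E.
by have := adj_neq (valP e); rewrite -/(org e) -/(ter e) E eqxx.
Qed.

Lemma oedge_eq (e f : edge) : org e = org f -> ter e = ter f -> e = f.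
Proof.
move=> E1 E2; apply: val_inj; rewrite [LHS]surjective_pairing [RHS]surjective_pairing.
by rewrite -/(org e) -/(ter e) E1 E2.
Qed.

Lemma und_subproof (e : edge) :
  `[< exists x y, adj X x y /\ [fset org e; ter e]%fset = [fset x; y]%fset >].
Proof. by apply/asboolP; exists (org e), (ter e); split=> //; exact: valP e. Qed.

Definition und (e : edge) : uedge X :=
  exist _ [fset org e; ter e]%fset (und_subproof e).

Lemma und_erev (e : edge) : und (erev e) = und e.
Proof. by apply: val_inj; rewrite /= fsetUC. Qed.

Lemma und_eq (e f : edge) : und e = und f -> f = e \/ f = erev e.
Proof.
move=> /(congr1 val) /= E.
have fe := adj_neq (valP f); have ee := adj_neq (valP e).
rewrite -/(org f) -/(ter f) in fe; rewrite -/(org e) -/(ter e) in ee.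
have : org f \in [fset org e; ter e]%fset by rewrite E !inE eqxx.
have : ter f \in [fset org e; ter e]%fset by rewrite E !inE eqxx orbT.
rewrite !inE => /orP[]/eqP t /orP[]/eqP o.
- by rewrite t o eqxx in fe.
- by right; exact: oedge_eq.
- by left; exact: oedge_eq.
- by rewrite t o eqxx in fe.
Qed.

Lemma und_surj (a : uedge X) : exists e : edge, und e == a.
Proof.
case: a => A H; have /asboolP[x [y [xy AE]]] := H.
by exists (exist _ (x, y) xy); apply/eqP/val_inj; rewrite /= AE.
Qed.

Definition orient (a : uedge X) : edge := xchoose (und_surj a).

Lemma orientK : cancel orient und.
Proof. by move=> a; apply/eqP; exact: (xchooseP (und_surj a)). Qed.

Lemma edge_weight_und (e : edge) : edge_weight (und e) = wt e * wt (erev e).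
Proof.
have ee := adj_neq (valP e); rewrite -/(org e) -/(ter e) in ee.
have S2 (F : V -> R) (P : pred V) : \prod_(x <- [fset org e; ter e]%fset | P x) F x =
    (if P (org e) then F (org e) else 1) * (if P (ter e) then F (ter e) else 1).
  by rewrite big_mkcond big_fsetU1 ?inE//= big_seq_fset1.
have a1 : adj X (org e) (ter e) := valP e.
have a2 : adj X (ter e) (org e) := valP (erev e).
by rewrite /edge_weight /= S2 !S2 !adj_irrefl a1 a2 mul1r mulr1.
Qed.

Lemma edge_weight_gt0 (a : uedge X) : 0 < edge_weight a.
Proof. by rewrite -(orientK a) edge_weight_und mulr_gt0 ?wt_gt0. Qed.

Lemma edge_weight_ge0 (a : uedge X) : 0 <= edge_weight a.
Proof. exact/ltW/edge_weight_gt0. Qed.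

(** W(a) is at most the total weight times the weight of the chosen orientation, and distinct edges
    have distinct orientations. *)
Lemma edge_weight_bounded : bounded_sums (@edge_weight R V X) (total_wt * total_wt).
Proof.
apply: bounded_sums_le (bounded_sumsZ total_wt_ge0
  (bounded_sums_inj (can_inj orientK) wt_bounded)) => a /=.
by rewrite -{1}(orientK a) edge_weight_und mulrC ler_pM ?wt_ge0 ?wt_le_total.
Qed.

Lemma edge_zeroP (e : uedge X) (z : C) : edge_zero e z <-> edge_factor z e = 0.
Proof.
rewrite /edge_zero /edge_factor; set s := Num.sqrt _.
have s0 : 0 < s by rewrite sqrtr_gt0 edge_weight_gt0.
have -> : edge_weight e = s ^+ 2 by rewrite sqr_sqrtr ?edge_weight_ge0.
have sC : s%:C != 0 :> C by rewrite -(rmorph0 (real_complex R)) (inj_eq (@complexI R)) gt_eqF.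
rewrite fmorphV rmorphXn/= -exprMn; split=> [[->|->]|/eqP].
- by rewrite mulVf// expr1n subrr.
- by rewrite mulNr mulVf// sqrrN expr1n subrr.
rewrite subr_eq0 eq_sym sqrf_eq1 => /orP[]/eqP H; [left|right].
  by apply: (mulIf sC); rewrite mulVf.
by apply: (mulIf sC); rewrite mulNr mulVf.
Qed.

Lemma edge_prodE : edge_prod X = fseries (quad_coef (@edge_weight R V X)).
Proof.
apply/funext => u; rewrite -(quad_isum edge_weight_ge0 edge_weight_bounded).
by rewrite -(iprod_isum (quad_summable edge_weight_ge0 edge_weight_bounded u)).
Qed.

Lemma edge_prod_facts :
  [/\ {family compact,
        (fun (A : {fset uedge X}) (u : C^o) =>
           partial_prod (edge_factor u) A) @ totally --> edge_prod X},
      entire (edge_prod X),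
      (forall z, edge_prod X z = 0 <-> exists e : uedge X, edge_zero e z)
    & (forall z, exists A : {fset uedge X},
         (forall e, e \in A <-> edge_zero e z) /\
         zero_of_order (edge_prod X) z #|` A|)].
Proof.
have W0 := edge_weight_ge0; have WK := edge_weight_bounded.
rewrite edge_prodE; split.
- exact: (quad_family_cvg W0 WK).
- exact/entire_fseries/(quad_entire W0 WK).
- move=> z; rewrite (quad_eq0 W0 WK).
  by split=> -[e /edge_zeroP ez]; exists e.
- move=> z; have [A AP] := quad_finite W0 WK z; exists A.
  split; last exact: (quad_zero_of_order W0 WK).
  by move=> e; rewrite edge_zeroP AP.
Qed.

End WeightedGraph.

(** * Trace class coefficients *)

Section FiberSums.
Variables (R : realType) (I J : choiceType) (g : J -> R) (h : J -> I) (K : R).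
Hypotheses (g0 : forall j, 0 <= g j) (gK : bounded_sums g K).

Definition fiber_sum (i : I) : R :=
  fine (\esum_(j in [set: J]) (g j *+ (h j == i))%:E).

Lemma esum_le_bound (T : choiceType) (f : T -> R) L :
  bounded_sums f L -> (\esum_(j in [set: T]) (f j)%:E <= L%:E)%E.
Proof.
move=> fL; apply: ge_ereal_sup => _ [A [finA _] <-].
by rewrite fsbig_finite//= sumEFin lee_fin.
Qed.

Let g0n i j : (0 <= (g j *+ (h j == i))%:E)%E.
Proof. by rewrite lee_fin mulrn_wge0. Qed.

Lemma fiber_sumE i :
  (fiber_sum i)%:E = \esum_(j in [set: J]) (g j *+ (h j == i))%:E.
Proof.
rewrite fineK// ge0_fin_numE; last exact: esum_ge0.
apply: le_lt_trans (ltry K); apply: esum_le_bound.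
by apply: bounded_sums_le gK => j; case: eqP => // _; rewrite mulr0n.
Qed.

Lemma fiber_sum_ge (A : {fset J}) i : \sum_(j <- A) g j *+ (h j == i) <= fiber_sum i.
Proof.
rewrite -lee_fin fiber_sumE -sumEFin.
apply: esum_ge; exists [set` A]; first by split; [exact: finite_fset|].
by rewrite -fsbig_seq ?fset_uniq.
Qed.

Lemma fiber_sum_ge0 i : 0 <= fiber_sum i.
Proof. by have := fiber_sum_ge fset0 i; rewrite big_seq_fset0. Qed.

Lemma fiber_sum_ge1 j : g j <= fiber_sum (h j).
Proof. by have := fiber_sum_ge [fset j]%fset (h j); rewrite big_seq_fset1 eqxx. Qed.

Lemma fiber_sum_bounded : bounded_sums fiber_sum K.
Proof.
move=> A; rewrite -lee_fin -sumEFin.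
rewrite (eq_bigr _ (fun i _ => fiber_sumE i)) -esum_sum//.
under eq_esum do rewrite sumEFin.
apply: esum_le_bound; apply: bounded_sums_le gK => j.
have [jA|jA] := boolP (h j \in A).
  rewrite (big_fsetD1 (h j))//= eqxx big1_seq ?addr0// => i.
  by rewrite !inE => /andP[_ /andP[/negbTE nf _]]; rewrite eq_sym nf.
rewrite big1_seq// => i /andP[_ iA].
by case: eqP => // ji; rewrite ji iA in jA.
Qed.

End FiberSums.

Section TraceClass.
Variables (R : realType) (V : choiceType) (X : wgraph R V).
Local Notation C := R[i].
Local Notation edge := (oedge X).

Lemma sqnorm_le_bound (I : choiceType) (f : I -> C) K :
  bounded_sums (fun i => normc (f i) ^+ 2) K -> (sqnorm f <= K%:E)%E.
Proof.
move=> fK; apply: ge_ereal_sup => _ [A [finA _] <-].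
by rewrite fsbig_finite//= sumEFin lee_fin.
Qed.

Lemma l2norm_sqr (I : choiceType) (f : l2 R I) : l2norm f ^+ 2 = fine (sqnorm f).
Proof. by rewrite /l2norm sqr_sqrtr// fine_ge0// sqnorm_ge0. Qed.

Lemma l2norm_ge0 (I : choiceType) (f : l2 R I) : 0 <= l2norm f.
Proof. exact: sqrtr_ge0. Qed.

Lemma coord_le_l2norm (I : choiceType) (f : l2 R I) i : normc (f i) <= l2norm f.
Proof.
rewrite -(ler_pXn2r (ltn0Sn 1)) ?nnegrE ?normc_ge0 ?l2norm_ge0// l2norm_sqr.
by rewrite -lee_fin fineK ?sqnorm_fin//; exact: sqr_coord_le.
Qed.

Section Weighting.
Variables (I J : choiceType) (a : J -> R) (h : J -> I) (K : R).
Hypothesis aK : bounded_sums (fun j => a j ^+ 2) K.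

Let aC (f : l2 R I) j := (a j)%:C * f (h j).

Let aC_bound f : bounded_sums (fun j => normc (aC f j) ^+ 2) (l2norm f ^+ 2 * K).
Proof.
apply: bounded_sums_le (bounded_sumsZ (sqr_ge0 (l2norm f)) aK) => j.
rewrite ComplexField.Normc.normcM normcC exprMn real_normK ?num_real// mulrC.
rewrite ler_wpM2r ?sqr_ge0//; apply: lerXn2r; rewrite ?nnegrE ?normc_ge0 ?l2norm_ge0//.
exact: coord_le_l2norm.
Qed.

Let aC_l2 f : aC f \in @l2_pred R J.
Proof. by apply/l2P; apply: le_lt_trans (sqnorm_le_bound (aC_bound f)) (ltry _). Qed.

Definition weighting (f : l2 R I) : l2 R J := L2 (aC_l2 f).

Lemma weighting_bounded : bounded_linear weighting.
Proof.
have K0 := bounded_sums_ge0 aK.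
apply: (bounded_of_sqnorm K0) => [c f g|f].
  by apply/val_inj/funext => j; rewrite /= /aC /= mulrDr mulrCA.
apply: le_trans (sqnorm_le_bound (aC_bound f)) _.
by rewrite EFinM l2norm_sqr fineK ?sqnorm_fin// muleC.
Qed.

(** The squared norm of the image of the basis vector at i is the sum of the a j^2 over the fibre of
    [h] above i, and the fibres partition the index set. *)
Lemma weighting_hs : hilbert_schmidt weighting.
Proof.
split; first exact: weighting_bounded.
apply: le_lt_trans (ltry K); apply: esum_le_bound.
apply: bounded_sums_le (fiber_sum_bounded h (fun j => sqr_ge0 (a j)) aK) => i.
rewrite l2norm_sqr le_eqVlt; apply/orP; left; apply/eqP; congr fine.
apply: eq_esum => j _; congr EFin.
rewrite -[weighting _ j]/((a j)%:C * (h j == i)%:R).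
rewrite ComplexField.Normc.normcM normcC exprMn real_normK ?num_real//.
by case: eqP; rewrite ?ComplexField.Normc.normc1 ?ComplexField.Normc.normc0 ?expr1n ?expr0n ?mulr1 ?mulr0.
Qed.

End Weighting.

Lemma bounded_linear_comp (I J L : choiceType) (S : l2 R J -> l2 R L) (T : l2 R I -> l2 R J) :
  bounded_linear S -> bounded_linear T -> bounded_linear (S \o T).
Proof.
move=> [linS [M HM]] [linT [N HN]]; split=> [c f g|]; first by rewrite /= linT linS.
exists (`|M| * `|N|) => f /=.
apply: (@le_trans _ _ (`|M| * l2norm (T f))).
  by apply: le_trans (HM _) _; rewrite ler_wpM2r ?l2norm_ge0 ?ler_norm.
rewrite -mulrA ler_wpM2l//; apply: le_trans (HN _) _.
by rewrite ler_wpM2r ?l2norm_ge0 ?ler_norm.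
Qed.

Lemma bounded_linear_scale (I : choiceType) (c : C) :
  bounded_linear (fun f : l2 R I => c *: f).
Proof.
apply: (bounded_of_sqnorm (sqr_ge0 (normc c))) => [d f g|f]; last exact: sqnormZ_le.
by rewrite scalerDr !scalerA mulrC.
Qed.

Lemma bounded_linear_id (I : choiceType) : bounded_linear (@id (l2 R I)).
Proof. by split=> //; exists 1 => f; rewrite mul1r. Qed.

Lemma hilbert_schmidt_comp (I J L : choiceType) (S : l2 R J -> l2 R L) (T : l2 R I -> l2 R J) :
  bounded_linear S -> hilbert_schmidt T -> hilbert_schmidt (S \o T).
Proof.
move=> bS [bT hT]; split; first exact: bounded_linear_comp.
have [_ [M HM]] := bS.
have T0 i : (0 <= (l2norm (T (delta R i)) ^+ 2)%:E)%E by rewrite lee_fin sqr_ge0.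
apply: (@le_lt_trans _ _ ((M ^+ 2)%:E * \esum_(i in [set: I]) (l2norm (T (delta R i)) ^+ 2)%:E)%E).
  apply: ge_ereal_sup => _ [A [finA _] <-].
  apply: (@le_trans _ _ ((M ^+ 2)%:E * \sum_(i \in A) (l2norm (T (delta R i)) ^+ 2)%:E)%E).
    rewrite !fsbig_finite//= ge0_sume_distrr//; apply: lee_sum => i _.
    rewrite -EFinM lee_fin -exprMn; apply: lerXn2r; rewrite ?nnegrE ?l2norm_ge0//.
    exact: le_trans (l2norm_ge0 _) (HM _).
  apply: lee_pmul; rewrite ?lee_fin ?sqr_ge0//.
    by rewrite fsbig_finite//= sume_ge0.
  by apply: ereal_sup_ubound; exists A.
by rewrite lte_mul_pinfty ?lee_fin ?sqr_ge0.
Qed.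

Definition out_wt (x : V) : R := fiber_sum (@wt R V X) (@org R V X) x.

Let out_wt_ge0 x : 0 <= out_wt x.
Proof. exact: fiber_sum_ge0 (@wt_ge0 R V X) (@wt_bounded R V X) x. Qed.

Let wt_out (e : edge) : wt e <= out_wt (org e).
Proof. exact: fiber_sum_ge1 (@wt_ge0 R V X) (@wt_bounded R V X) e. Qed.

Lemma out_wt_bounded : bounded_sums out_wt (total_wt X).
Proof. exact: fiber_sum_bounded (@wt_ge0 R V X) (@wt_bounded R V X). Qed.

Let root_out (x : V) : R := Num.sqrt (out_wt x).

Let root_out_sqr : bounded_sums (fun x => root_out x ^+ 2) (total_wt X).
Proof.
by apply: bounded_sums_le out_wt_bounded => x; rewrite sqr_sqrtr.
Qed.

Let wt_div (e : edge) : R := wt e / root_out (org e).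

(** The square is w(e)^2 divided by the outgoing weight at o(e), of which w(e) is one summand; so it
    is at most w(e). *)
Let wt_div_sqr : bounded_sums (fun e => wt_div e ^+ 2) (total_wt X).
Proof.
apply: bounded_sums_le (@wt_bounded R V X) => e.
have o0 : 0 < out_wt (org e) by apply: lt_le_trans (wt_gt0 e) (wt_out e).
rewrite exprMn exprVn sqr_sqrtr// ler_pdivrMr// expr2.
by rewrite ler_wpM2l ?wt_ge0.
Qed.

(* tau J^m sigma = (tau J^m sigma') D with D the multiplication by the square
   root of the outgoing weight and sigma = sigma' D. *)
Lemma ihara_trace_class n : trace_class (@ihara_coef R V X n).
Proof.
case: n => [|m].
  have z0 : bounded_sums (fun x : V => (0 : R) ^+ 2) 0 by move=> A; rewrite expr0n big1.
  exists (weighting id z0), (weighting id z0); split; try exact: weighting_hs.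
  apply/funext => f; apply/val_inj/funext => x.
  by rewrite /= mul0r.
exists (fun f => (-1) ^+ m.+1 *: tau (iter m (@J R V X) (weighting (@org R V X) wt_div_sqr f))).
exists (weighting id root_out_sqr); split; last first.
- apply/funext => f; rewrite /ihara_coef /=; congr (_ *: tau (iter m _ _)).
  apply/val_inj/funext => e /=.
  have o0 : 0 < root_out (org e).
    by rewrite sqrtr_gt0; apply: lt_le_trans (wt_gt0 e) (wt_out e).
  by rewrite /wt_div mulrA -rmorphM/= divfK ?gt_eqF.
- exact: weighting_hs.
- have bJ k : bounded_linear (iter k (@J R V X)).
    elim: k => [|k IH]; first exact: bounded_linear_id.
    exact: (bounded_linear_comp (@J_bounded R V X) IH).
  have bS : bounded_linear (fun g => (-1) ^+ m.+1 *: tau (iter m (@J R V X) g)).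
    have bT := bounded_linear_comp (@tau_bounded R V X) (bJ m).
    exact: (bounded_linear_comp (bounded_linear_scale V ((-1) ^+ m.+1)) bT).
  exact: hilbert_schmidt_comp bS (weighting_hs _ _).
Qed.

End TraceClass.

(** * Cycles and closed walks *)

Section ClosedWalks.
Variables (R : realType) (V : choiceType) (X : wgraph R V).
Implicit Types (f g : nat -> V) (p q : closed_path X).

Definition shift_fun (T : Type) (i : nat) (f : nat -> T) : nat -> T := fun j => f (j + i)%N.

Definition has_period (T : Type) (n : nat) (f : nat -> T) := forall i, f (i + n)%N = f i.

Lemma periodic_mul T n k (f : nat -> T) : has_period n f -> has_period (k * n) f.
Proof.
move=> fn; elim: k => [|k IH] i; first by rewrite mul0n addn0.
by rewrite mulSn addnA IH fn.
Qed.

Lemma periodic_modn T n (f : nat -> T) i : has_period n f -> f (i %% n)%N = f i.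
Proof.
move=> fn; rewrite {2}(divn_eq i n) addnC; exact/esym/periodic_mul.
Qed.

Lemma periodic_shift T n i (f : nat -> T) : has_period n f -> has_period n (shift_fun i f).
Proof. by move=> fn j; rewrite /shift_fun addnAC fn. Qed.

Lemma shift_fun_period T n (f : nat -> T) k : has_period n f -> shift_fun (k * n) f = f.
Proof. by move=> fn; apply/funext => j; exact: periodic_mul. Qed.

Lemma shift_shift T i j (f : nat -> T) : shift_fun i (shift_fun j f) = shift_fun (i + j) f.
Proof. by apply/funext => k; rewrite /shift_fun addnA. Qed.

(* [i * n - i] stands for [- i] modulo [n]. *)
Lemma shift_funK T n i (f : nat -> T) : (0 < n)%N -> has_period n f ->
  shift_fun (i * n - i) (shift_fun i f) = f.
Proof.
move=> n0 fn; rewrite shift_shift subnK; last by rewrite leq_pmulr.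
exact: shift_fun_period.
Qed.

Lemma periodic_unshift T n m i (f : nat -> T) : (0 < n)%N -> has_period n f ->
  has_period m (shift_fun i f) -> has_period m f.
Proof.
move=> n0 fn; rewrite -{2}(shift_funK i n0 fn); exact: periodic_shift.
Qed.

(** Closed paths are handled as periodic functions on [nat]: rotating a path becomes shifting the
    argument, without indices modulo n. *)
Definition closed_walk f n :=
  [/\ (0 < n)%N, has_period n f & forall i, adj X (f i) (f i.+1)].

Lemma closed_walk_shift f n i : closed_walk f n -> closed_walk (shift_fun i f) n.
Proof.
move=> [n0 fn fa]; split=> //; first exact: periodic_shift.
by move=> j; rewrite /shift_fun addSn.
Qed.

Lemma mkseq_inj f g n : (0 < n)%N -> has_period n f -> has_period n g ->
  mkseq f n.+1 = mkseq g n.+1 -> f = g.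
Proof.
move=> n0 fn gn E; apply/funext => i.
rewrite -(periodic_modn i fn) -(periodic_modn i gn).
have := congr1 (fun s => nth (f 0%N) s (i %% n)) E.
by rewrite !nth_mkseq// ltnS ltnW ?ltn_pmod.
Qed.

Lemma mkseq_catD f m n : mkseq f (m + n) = mkseq f m ++ mkseq (shift_fun m f) n.
Proof.
rewrite /mkseq iotaD map_cat add0n; congr (_ ++ _).
by rewrite -[m in iota m]addn0 iotaDl -map_comp; apply: eq_map => i; rewrite /shift_fun /= addnC.
Qed.

Lemma mkseqSl f n : mkseq f n.+1 = f 0%N :: mkseq (shift_fun 1 f) n.
Proof. exact: (mkseq_catD f 1 n). Qed.

Lemma closed_walk_path f n : closed_walk f n -> is_closed_path X (mkseq f n.+1).
Proof.
move=> [n0 fn fa]; rewrite mkseqSl /=; apply/and3P; split.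
- apply/(pathP (f 0%N)) => i; rewrite size_mkseq => iN.
  rewrite -(mkseqSl f) nth_mkseq; last by rewrite ltnS ltnW.
  by rewrite nth_mkseq// /shift_fun addn1.
- by rewrite -size_eq0 size_mkseq -lt0n.
- rewrite (last_nth (f 0%N)) -(mkseqSl f) size_mkseq nth_mkseq//.
  by rewrite -[n]add0n fn.
Qed.

Definition walk_path f n (H : closed_walk f n) : closed_path X :=
  exist _ (mkseq f n.+1) (closed_walk_path H).

Lemma closed_path_walk p : exists f, closed_walk f (path_length (val p)) /\
  val p = mkseq f (path_length (val p)).+1.
Proof.
case: p => -[//|x0 s] /=; rewrite /path_length /=.
move=> /and3P[/(pathP x0) ps s0 /eqP ls]; have n0 : (0 < size s)%N by case: s s0 {ps ls}.
pose f i := nth x0 (x0 :: s) (i %% size s).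
have fn : has_period (size s) f by move=> i; rewrite /f modnDr.
have fE i : (i <= size s)%N -> f i = nth x0 (x0 :: s) i.
  rewrite leq_eqVlt => /orP[/eqP ->|iN]; last by rewrite /f modn_small.
  by rewrite /f modnn -last_nth ls.
exists f; split; last first.
  apply: (@eq_from_nth _ x0); rewrite ?size_mkseq// => i iN.
  by rewrite nth_mkseq// fE.
split=> // i; have iN : (i %% size s < size s)%N by rewrite ltn_pmod.
have -> : f i.+1 = f (i %% size s).+1.
  by rewrite -(periodic_modn i.+1 fn) -(periodic_modn (_ %% _).+1 fn) -addn1 -modnDml addn1.
rewrite -(periodic_modn i fn) (fE _ (ltnW iN)) (fE _ iN); exact: ps.
Qed.

Definition cp_fun p : nat -> V := sval (cid (closed_path_walk p)).

Definition cp_len p : nat := path_length (val p).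

Lemma cp_walk p : closed_walk (cp_fun p) (cp_len p).
Proof. by rewrite /cp_fun; case: cid => f []. Qed.

Lemma cp_val p : val p = mkseq (cp_fun p) (cp_len p).+1.
Proof. by rewrite /cp_fun; case: cid => f []. Qed.

Lemma cp_unique p f n : closed_walk f n -> val p = mkseq f n.+1 ->
  cp_len p = n /\ cp_fun p = f.
Proof.
move=> fw pE; have nE : cp_len p = n by rewrite /cp_len /path_length pE size_mkseq.
split=> //; have [n0 pn _] := cp_walk p; have [_ fn _] := fw.
by move: pE; rewrite cp_val nE in pn n0 *; exact: mkseq_inj.
Qed.

Lemma path_rot_mkseq f n : closed_walk f n ->
  path_rot (mkseq f n.+1) = mkseq (shift_fun 1 f) n.+1.
Proof.
move=> [n0 fn _]; case: n n0 fn => [//|n] _ fn.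
rewrite [in RHS]/mkseq -[in RHS](addn1 n.+1) iotaD map_cat cats1 add0n.
rewrite (mkseqSl f) (mkseqSl (shift_fun 1 f)).
rewrite -[LHS]/(rcons (shift_fun 1 f 0%N :: mkseq (shift_fun 1 (shift_fun 1 f)) n)
  (shift_fun 1 f 0%N)) -mkseqSl; congr rcons.
by rewrite /shift_fun [(n.+1 + 1)%N]addnC fn.
Qed.

Lemma path_pow_mkseq f n k : closed_walk f n ->
  path_pow k (mkseq f n.+1) = mkseq f (k * n).+1.
Proof.
move=> [n0 fn _]; rewrite !mkseqSl /=; congr (_ :: _).
have := periodic_shift 1 fn; move: (shift_fun 1 f) => g gn.
elim: k => [|k IH] //=; rewrite mulSn mkseq_catD IH.
by rewrite (_ : shift_fun n g = g)// -[n]mul1n shift_fun_period.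
Qed.

Lemma path_weight_mkseq f n :
  path_weight X (mkseq f n.+1) = \prod_(i < n) weight X (f i) (f i.+1).
Proof.
elim: n f => [|n IH] f; first by rewrite /= big_nil big_ord0.
rewrite big_ord_recl mkseqSl mkseqSl /= big_cons; congr (_ * _).
rewrite -/(path_weight X (shift_fun 1 f 0%N :: mkseq (shift_fun 1 (shift_fun 1 f)) n)).
rewrite -mkseqSl IH; apply: eq_bigr => i _.
by rewrite /shift_fun !addn1.
Qed.

(** The generating move is the shift by one. Shifts compose, and by periodicity each is undone by
    another shift, which accounts for the symmetric closure. *)
Lemma cyc_eqP p q : cyc_eq p q <->
  cp_len q = cp_len p /\ exists i, cp_fun q = shift_fun i (cp_fun p).
Proof.
split=> [/asboolP|[lqp [i0 fqp]]].
  elim=> {p q} [p q|p|p q _ [lqp [i0 fqp]]|p q r _ [l1 [i1 f1]] _ [l2 [i2 f2]]].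
  - rewrite (cp_val p) path_rot_mkseq; last exact: cp_walk.
    move=> pq; have [l f] := cp_unique (closed_walk_shift 1 (cp_walk p)) pq.
    by split=> //; exists 1%N.
  - by split=> //; exists 0%N; rewrite -{1}(shift_fun_period 0 (n := 0) (f := cp_fun p))// => j; rewrite addn0.
  - split=> //; exists (i0 * cp_len p - i0)%N; rewrite fqp.
    by have [n0 fn _] := cp_walk p; rewrite shift_funK.
  - by split; [rewrite l2|exists (i2 + i1)%N; rewrite f2 f1 shift_shift].
apply/asboolP.
pose pw k := walk_path (closed_walk_shift k (cp_walk p)).
have step k : clos_refl_sym_trans _ (fun p q => val q = path_rot (val p)) p (pw k).
  elim: k => [|k IH].
    rewrite (_ : pw 0%N = p); first exact: rst_refl.
    apply: val_inj; rewrite /= cp_val; congr mkseq.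
    by apply/funext => j; rewrite /shift_fun addn0.
  apply: rst_trans IH _; apply: rst_step.
  transitivity (path_rot (mkseq (shift_fun k (cp_fun p)) (cp_len p).+1)) => //.
  rewrite path_rot_mkseq ?shift_shift ?add1n//.
  exact: closed_walk_shift (cp_walk p).
rewrite (_ : q = pw i0)//; apply: val_inj.
by rewrite cp_val /= lqp fqp.
Qed.

End ClosedWalks.

Section Cycles.
Variables (R : realType) (V : choiceType) (X : wgraph R V).
Implicit Types (f g : nat -> V) (p q : closed_path X) (c d : gcycle X).
Local Open Scope quotient_scope.

Definition cycle_fun c : nat -> V := cp_fun (repr c).

Lemma cycle_walk c : closed_walk X (cycle_fun c) (cycle_length c).
Proof. exact: cp_walk. Qed.

Lemma cycle_length_gt0 c : (0 < cycle_length c)%N.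
Proof. by have [] := cycle_walk c. Qed.

Lemma cycle_weightE c : cycle_weight c =
  \prod_(i < cycle_length c) weight X (cycle_fun c i) (cycle_fun c i.+1).
Proof. by rewrite /cycle_weight cp_val path_weight_mkseq. Qed.

Lemma pi_gcycleP p c : \pi_(gcycle X) p = c <->
  cp_len p = cycle_length c /\ exists i, cp_fun p = shift_fun i (cycle_fun c).
Proof.
rewrite -[X in _ <-> X]cyc_eqP -{1}[c]reprK; split=> [/eqmodP|H].
  by rewrite /= => H; rewrite cyc_eq_sym.
by apply/eqmodP; rewrite /= cyc_eq_sym.
Qed.

Lemma gcycle_eq c d i : cycle_length c = cycle_length d ->
  cycle_fun c = shift_fun i (cycle_fun d) -> c = d.
Proof.
by move=> l f; rewrite -[c]reprK; apply/pi_gcycleP; split=> //; exists i.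
Qed.

Lemma walk_pi f n (H : closed_walk X f n) :
  let c := \pi_(gcycle X) (walk_path H) in
  cycle_length c = n /\ exists i, f = shift_fun i (cycle_fun c).
Proof.
move=> c; have [l1 f1] := cp_unique (p := walk_path H) H erefl.
have /pi_gcycleP[l2 [i0 f2]] : \pi_(gcycle X) (walk_path H) = c by [].
by split; [rewrite -l2|exists i0; rewrite -f2].
Qed.

(** Rotating by j brings any backtracking to the start of a path, where [reduced] forbids it.
    Conversely a tail is a backtracking across the endpoint, at the indices n - 1, n, n + 1. *)
Lemma regularP c : regular c <-> forall j, cycle_fun c j != cycle_fun c j.+2.
Proof.
have [n0 fn fa] := cycle_walk c; split=> [rc j|H p /pi_gcycleP[lp [i0 fp]]].
  have w := closed_walk_shift j (cycle_walk c).
  (* [reduced] is vacuous in length 1, which is excluded because the graph has no loops. *)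
  have n2 : (1 < cycle_length c)%N.
    rewrite ltn_neqAle n0 andbT; apply/eqP => n1; have := adj_neq (fa 0%N).
    by rewrite -[1%N]add0n n1 fn eqxx.
  have [|rd _] := rc (walk_path w).
    apply/pi_gcycleP; have [-> ->] := cp_unique (p := walk_path w) w erefl.
    by split=> //; exists j.
  have {}rd : reduced (mkseq (shift_fun j (cycle_fun c)) (cycle_length c).+1) := rd.
  have := rd (cycle_fun c 0%N) 0%N; rewrite size_mkseq ltnS => /(_ n2).
  by rewrite !nth_mkseq.
have [np pp _] := cp_walk p; split=> [x j|].
  rewrite cp_val size_mkseq => jp; rewrite !nth_mkseq//; last by lia.
  by rewrite fp /shift_fun.
rewrite cp_val mkseqSl /has_tail -mkseqSl size_mkseq.
rewrite !nth_mkseq//; last by rewrite ltnS leq_pred.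
have -> : cp_fun p 1%N = cp_fun p (cp_len p).-1.+2.
  have -> : (cp_len p).-1.+2 = (1 + cp_len p)%N by lia.
  by rewrite pp.
by rewrite eq_sym fp /shift_fun !addSn H.
Qed.

(** The remainder of a period modulo the least positive one is again a period, hence 0. *)
Lemma minimal_period (T : Type) n (f : nat -> T) : (0 < n)%N -> has_period n f ->
  exists m, [/\ (0 < m)%N, has_period m f & forall k, has_period k f -> (m %| k)%N].
Proof.
move=> n0 fn; have exm : exists m, (0 < m)%N && `[< has_period m f >].
  by exists n; rewrite n0; apply/asboolP.
case: (ex_minnP exm) => m /andP[m0 /asboolP fm] mmin; exists m; split=> // k fk.
rewrite /dvdn; apply: contraT; rewrite -lt0n => km0.
have : (m <= k %% m)%N.
  apply: mmin; rewrite km0; apply/asboolP => i.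
  by rewrite -(periodic_mul (k %/ m) fm) -addnA [(_ %% _ + _)%N]addnC -divn_eq fk.
by rewrite leqNgt ltn_pmod.
Qed.

(** If the least period is smaller than the length, the walk over one least period is a shorter
    root. Conversely the length of a root is a period, so it cannot be smaller than a length
    dividing all periods. *)
Lemma prime_cycleP c : prime_cycle c <->
  forall k, has_period k (cycle_fun c) -> (cycle_length c %| k)%N.
Proof.
have w := cycle_walk c; have [n0 fn fa] := w; split=> [pc|H].
  have [m [m0 fm mP]] := minimal_period n0 fn.
  have wm : closed_walk X (cycle_fun c) m by split.
  have [lm _] := walk_pi wm.
  have [mn|nm] := ltnP m (cycle_length c); last first.
    move=> k /mP; congr (_ %| _)%N; apply/eqP; rewrite eqn_leq nm andbT.
    by apply: dvdn_leq => //; exact: mP.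
  case: pc; exists (cycle_length c %/ m)%N, (\pi_(gcycle X) (walk_path wm)).
  split; last by rewrite lm.
  exists (walk_path wm), (repr c); split=> //; first exact: reprK.
  transitivity (path_pow (cycle_length c %/ m) (mkseq (cycle_fun c) m.+1)) => //.
  by rewrite (path_pow_mkseq _ wm) divnK ?mP//; exact: cp_val.
move=> [k [d [[p [q [pd /pi_gcycleP[lq [i0 fq]] qp]]] ld]]].
have /pi_gcycleP[lp _] := pd.
have wp := cp_walk p; have [np pp _] := wp.
have : val q = mkseq (cp_fun p) (k * cp_len p).+1 by rewrite qp cp_val (path_pow_mkseq _ wp).
move=> qE.
have lE : cp_len q = (k * cp_len p)%N by rewrite /cp_len /path_length qE size_mkseq.
have [nq pq _] := cp_walk q.
have wk : closed_walk X (cp_fun p) (k * cp_len p).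
  by have [_ _ ap] := wp; split=> //; [rewrite -lE|exact: periodic_mul].
have [_ fE] := cp_unique wk qE.
have : (cycle_length c %| cycle_length d)%N.
  apply: H; apply: (periodic_unshift (i := i0) n0 fn); by rewrite -fq fE -lp.
by move=> /(dvdn_leq (cycle_length_gt0 d)); rewrite leqNgt ld.
Qed.

End Cycles.

(** * Non-backtracking closed walks as powers of prime cycles *)

Section TraceFormula.
Variables (R : realType) (V : choiceType) (X : wgraph R V).
Local Notation C := R[i].
Implicit Types (f g : nat -> V) (c : rpcycle X).

Local Open Scope quotient_scope.
Local Notation cfun c := (cycle_fun (val c)).
Local Notation clen c := (cycle_length (val c)).

Definition nb_walk f n := closed_walk X f n /\ forall j, f j != f j.+2.

Lemma nb_walk_rpcycle c : nb_walk (cfun c) (clen c).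
Proof.
split; first exact: cycle_walk.
by case: c => c H; have /asboolP[/regularP] := H.
Qed.

Lemma rpcycle_prime c k : has_period k (cfun c) -> (clen c %| k)%N.
Proof.
by case: c => c H; have /asboolP[_ /prime_cycleP] := H; apply.
Qed.

Lemma nb_walk_shift f n i : nb_walk f n -> nb_walk (shift_fun i f) n.
Proof. by move=> [fw fn]; split=> [|j]; [exact: closed_walk_shift|exact: fn]. Qed.

Lemma nb_walk_mul f n k : (0 < k)%N -> nb_walk f n -> nb_walk f (k * n).
Proof.
move=> k0 [[n0 fn fa] fb]; split=> //; split=> //; first by rewrite muln_gt0 k0.
exact: periodic_mul.
Qed.

(* By this and [nb_walk_decomp_inj], the non-backtracking closed walks of length
   n are parametrized by the pairs of a regular prime cycle p with l(p) | n and a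
   rotation i < l(p); hence tr T^n = sum of l(p) w(p)^(n / l(p)) over l(p) | n. *)
Lemma nb_walk_decomp f n : nb_walk f n ->
  exists c i, [/\ (clen c %| n)%N, (i < clen c)%N & f = shift_fun i (cfun c)].
Proof.
move=> [[n0 fn fa] fb]; have [m [m0 fm mP]] := minimal_period n0 fn.
have w : closed_walk X f m by split.
have [lm [i0 fi]] := walk_pi w; set c0 := \pi_(gcycle X) _ in lm fi.
have [_ cn _] := cycle_walk c0.
have rc : `[< regular c0 /\ prime_cycle c0 >].
  apply/asboolP; split.
    apply/regularP => j; have := fb (i0 * cycle_length c0 - i0 + j)%N.
    rewrite fi /shift_fun.
    have E k : (i0 * cycle_length c0 - i0 + k + i0)%N = (k + i0 * cycle_length c0)%N.
      by have := cycle_length_gt0 c0; nia.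
    by rewrite -!addnS !E !(periodic_mul _ cn).
  apply/prime_cycleP => k ck; rewrite lm; apply: mP.
  by rewrite fi; exact: periodic_shift.
exists (exist _ c0 rc), (i0 %% cycle_length c0)%N; split=> /=.
- by rewrite lm; exact: mP.
- by rewrite ltn_pmod// cycle_length_gt0.
- rewrite {1}fi; apply/funext => j; rewrite /shift_fun.
  by rewrite -(periodic_modn (j + i0)%N cn) -(periodic_modn (j + _ %% _)%N cn) modnDmr.
Qed.

(** By primality each length divides the other, so both cycles are the same up to rotation; then the
    difference of the rotations is a period below the length, hence 0. *)
Lemma nb_walk_decomp_inj c d i j : (i < clen c)%N -> (j < clen d)%N ->
  shift_fun i (cfun c) = shift_fun j (cfun d) -> c = d /\ i = j.
Proof.
move=> ic jd E; have [c0 cn _] := cycle_walk (val c); have [d0 dn _] := cycle_walk (val d).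
have ld : clen c = clen d.
  apply/eqP; rewrite eqn_dvd; apply/andP; split; apply: rpcycle_prime.
    by apply: (periodic_unshift c0 cn (i := i)); rewrite E; exact: periodic_shift.
  by apply: (periodic_unshift d0 dn (i := j)); rewrite -E; exact: periodic_shift.
have cd : c = d.
  apply: val_inj; apply: (@gcycle_eq _ _ _ _ _ (i * clen c - i + j)%N) => //.
  by rewrite -shift_shift -E shift_funK.
split=> //; subst d.
wlog ij : i j ic jd E / (i <= j)%N.
  by move=> H; have [/H|/ltnW/H] := leqP i j; [apply|move=> <-].
have : (clen c %| j - i)%N.
  apply: rpcycle_prime => k; rewrite /= -(periodic_mul i cn k).
  have := congr1 (fun f => f (k + (i * clen c - i))%N) E; rewrite /shift_fun.
  have -> : (k + (i * clen c - i) + i)%N = (k + i * clen c)%N by nia.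
  have -> : (k + (i * clen c - i) + j)%N = (k + (j - i) + i * clen c)%N by nia.
  by rewrite (periodic_mul i cn (k + _)) => ->.
move=> dvd; apply/eqP; rewrite eqn_leq ij -subn_eq0; apply: contraT => ne.
by have := dvdn_leq (_ : 0 < j - i)%N dvd; rewrite lt0n => /(_ ne); lia.
Qed.

(** The step weights are periodic, so each of the [k] rounds has the same product, and the product
    over one period does not depend on the starting point. *)
Lemma word_weight_power c k i :
  path_weight X (mkseq (shift_fun i (cfun c)) (k * clen c).+1) = cycle_weight (val c) ^+ k.
Proof.
rewrite path_weight_mkseq.
have [c0 cn _] := cycle_walk (val c).
pose h j := weight X (cfun c j) (cfun c j.+1).
have hn : has_period (clen c) h by move=> j; rewrite /h -addSn !cn.
have prodn (g : nat -> R) m : has_period m g -> \prod_(j < k * m) g j = (\prod_(j < m) g j) ^+ k.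
  move=> gm; elim: k => [|k' IH]; first by rewrite mul0n big_ord0 expr0.
  rewrite mulSnr exprSr -IH -(big_mkord xpredT) -(big_mkord xpredT g) -[X in _ * X](big_mkord xpredT g).
  rewrite (@big_cat_nat _ _ _ (k' * m))//= ?leq_addr//; congr (_ * _).
  rewrite -{1}[(k' * m)%N]add0n big_addn addKn.
  by apply: eq_bigr => j _; rewrite periodic_mul.
rewrite (eq_bigr (fun j : 'I__ => shift_fun i h j)); last by move=> j _; rewrite /h /shift_fun addSn.
rewrite prodn; last exact: periodic_shift.
rewrite cycle_weightE; congr (_ ^+ k).
transitivity (\prod_(j < clen c) h j); last by [].
rewrite -(big_mkord xpredT h) -(big_mkord xpredT (shift_fun i h)).
elim: i => [|i IH]; first by apply: eq_bigr => j _; rewrite /shift_fun addn0.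
rewrite -IH; have := c0; case: (clen c) hn => [//|l] hn _.
rewrite big_nat_recr//= [RHS]big_nat_recl//= mulrC; congr (_ * _).
  by rewrite /shift_fun addnS -addSn addnC hn.
by apply: eq_bigr => j _; rewrite /shift_fun addnS addSn.
Qed.

End TraceFormula.

(** * The zeta function as a limit of determinants *)

Section FiniteTruncation.
Variables (R : realType) (V : choiceType) (X : wgraph R V) (A : {fset uedge X}).
Local Notation C := R[i].
Local Notation edge := (oedge X).
Local Notation cfun c := (cycle_fun (val c)).
Local Notation clen c := (cycle_length (val c)).
Implicit Types (f : nat -> V) (c : rpcycle X).

Local Notation n := (size (enum_fset A)).

Definition half_edge (i : 'I_n) : edge := orient (tnth (in_tuple (enum_fset A)) i).

(** An edge and its reverse sit at the same place of the two halves, so that the matrix of [J]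
    consists of diagonal blocks. *)
Definition edge_of (i : 'I_(n + n)) : edge :=
  match fintype.split i with inl a => half_edge a | inr a => erev (half_edge a) end.

Lemma edge_of_l a : edge_of (lshift n a) = half_edge a.
Proof. by rewrite /edge_of (unsplitK (inl a)). Qed.

Lemma edge_of_r a : edge_of (rshift n a) = erev (half_edge a).
Proof. by rewrite /edge_of (unsplitK (inr a)). Qed.

Lemma und_half a : und (half_edge a) = tnth (in_tuple (enum_fset A)) a.
Proof. exact: orientK. Qed.

Lemma tnth_A_inj : injective (tnth (in_tuple (enum_fset A))).
Proof. by apply/tuple_uniqP; exact: fset_uniq. Qed.

Lemma edge_of_inj : injective edge_of.
Proof.
move=> i j; rewrite /edge_of -{2}(fintype.splitK i) -{2}(fintype.splitK j).
case: (fintype.split i) => a; case: (fintype.split j) => b E.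
- by congr unsplit; congr inl; apply: tnth_A_inj; rewrite -!und_half E.
- have ab : a = b by apply: tnth_A_inj; rewrite -!und_half E und_erev.
  by have := erev_neq (half_edge b); rewrite -E ab eqxx.
- have ab : a = b by apply: tnth_A_inj; rewrite -!und_half -E und_erev.
  by have := erev_neq (half_edge a); rewrite E ab eqxx.
- by congr unsplit; congr inr; apply: tnth_A_inj; rewrite -!und_half (erev_inj E).
Qed.

Lemma und_edge_of i : und (edge_of i) \in A.
Proof.
rewrite /edge_of; case: (fintype.split i) => a; rewrite ?und_erev und_half; exact: mem_tnth.
Qed.

Lemma edge_of_surj (e : edge) : und e \in A -> exists i, edge_of i = e.
Proof.
move=> eA; have /tnthP[a ea] : und e \in in_tuple (enum_fset A) by [].
have U : und (half_edge a) = und e by rewrite und_half -ea.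
have [->|->] := und_eq U; first by exists (lshift n a); rewrite edge_of_l.
by exists (rshift n a); rewrite edge_of_r.
Qed.

Lemma sum_wt_edge_of : \sum_i wt (edge_of i) <= total_wt X.
Proof.
rewrite -(big_map edge_of xpredT (@wt R V X)); apply: bounded_sums_uniq (@wt_bounded R V X) _.
by rewrite map_inj_uniq ?index_enum_uniq//; exact: edge_of_inj.
Qed.

(** The Hashimoto edge matrix of the finite graph, weighted by the second edge. *)
Definition edge_mx : 'M[C]_(n + n) := \matrix_(i, j)
  if (ter (edge_of i) == org (edge_of j)) && (edge_of j != erev (edge_of i))
  then (wt (edge_of j))%:C else 0.

Definition adj_in x y : bool := ([fset x; y] \in [fset val a | a in A])%fset.

Lemma adj_inP x y : adj_in x y ->
  exists i, org (edge_of i) = x /\ ter (edge_of i) = y.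
Proof.
move=> /imfsetP[a /= aA E]; have Ea := orientK a.
have /edge_of_surj[i0 iE] : und (orient a) \in A by rewrite Ea.
have /edge_of_surj[j0 jE] : und (erev (orient a)) \in A by rewrite und_erev Ea.
have E2 : [fset org (orient a); ter (orient a)]%fset = [fset x; y]%fset.
  by rewrite E -{3}Ea.
have ee : org (orient a) != ter (orient a) := adj_neq (valP (orient a)).
have : org (orient a) \in [fset x; y]%fset by rewrite -E2 !inE eqxx.
have : ter (orient a) \in [fset x; y]%fset by rewrite -E2 !inE eqxx orbT.
rewrite !inE => /orP[]/eqP t /orP[]/eqP o.
- by rewrite t o eqxx in ee.
- by exists j0; rewrite jE.
- by exists i0; rewrite iE.
- by rewrite t o eqxx in ee.
Qed.

Lemma adj_in_edge_of i : adj_in (org (edge_of i)) (ter (edge_of i)).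
Proof. by apply/imfsetP; exists (und (edge_of i)) => //; exact: und_edge_of. Qed.

Section Words.
Variable k : nat.
Implicit Type t : k.+1.-tuple 'I_(n + n).

Definition tuple_edge t (j : nat) : edge := edge_of (nth (thead t) t (j %% k.+1)).

Definition tuple_walk t (j : nat) : V := org (tuple_edge t j).

Definition tuple_weight t : C := \prod_(i < k.+1)
  edge_mx (nth (thead t) t ((i + k) %% k.+1)) (nth (thead t) t i).

Lemma tuple_edge_period t : has_period k.+1 (tuple_edge t).
Proof. by move=> j; rewrite /tuple_edge modnDr. Qed.

(** A nonzero term of the trace has only nonzero factors, and each of them forces two consecutive
    edges to match without backtracking. Together with [tuple_of_walk] this identifies the terms
    with walks. *)
Lemma tuple_weight_neq0 t : tuple_weight t != 0 ->
  [/\ nb_walk X (tuple_walk t) k.+1, forall j, adj_in (tuple_walk t j) (tuple_walk t j.+1),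
    forall j, ter (tuple_edge t j) = tuple_walk t j.+1
    & tuple_weight t = (path_weight X (mkseq (tuple_walk t) k.+2))%:C].
Proof.
rewrite /tuple_weight => P0.
have ep := tuple_edge_period t.
(* Modulo k + 1, the index j + k is the predecessor of j. *)
have step j : ter (tuple_edge t (j + k)) = org (tuple_edge t j) /\
    tuple_edge t j != erev (tuple_edge t (j + k)).
  rewrite -(periodic_modn j ep) -(periodic_modn (j + k) ep) -modnDml periodic_modn//.
  have jk : (j %% k.+1 < k.+1)%N by rewrite ltn_pmod.
  move/prodf_neq0: P0 => /(_ (Ordinal jk) isT); rewrite mxE /=.
  rewrite /tuple_edge modn_mod; case: ifP => [/andP[/eqP E1 E2] _|_]; first by split.
  by rewrite eqxx.
have ter_walk j : ter (tuple_edge t j) = tuple_walk t j.+1.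
  by rewrite -ep -addSnnS; have [-> _] := step j.+1.
have nb j : tuple_edge t j.+1 != erev (tuple_edge t j).
  by have [_] := step j.+1; rewrite addSnnS ep.
have wp : has_period k.+1 (tuple_walk t) by move=> j; rewrite /tuple_walk ep.
split=> //.
- split; first split=> //.
    by move=> j; rewrite -ter_walk; exact: (valP (tuple_edge t j)).
  move=> j; apply: contra (nb j) => /eqP E; apply/eqP; apply: oedge_eq => /=.
    by rewrite -[RHS]/(ter (tuple_edge t j)) ter_walk.
  by rewrite ter_walk -E.
- by move=> j; rewrite -ter_walk; exact: adj_in_edge_of.
- rewrite path_weight_mkseq rmorph_prod; apply: eq_bigr => i _.
  move/prodf_neq0: P0 => /(_ i isT); rewrite mxE; case: ifP => [_ _|]; last by rewrite eqxx.
  rewrite -ter_walk /wt /tuple_walk /tuple_edge modn_small//.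
Qed.

Lemma tuple_of_walk f : nb_walk X f k.+1 -> (forall j, adj_in (f j) (f j.+1)) ->
  exists t, tuple_walk t = f /\ tuple_weight t != 0.
Proof.
move=> [[_ fp fa] fb] fA.
have /choice[idx idxP] j := adj_inP (fA j).
pose t : k.+1.-tuple 'I_(n + n) := [tuple idx i | i < k.+1].
have tE j : nth (thead t) t (j %% k.+1) = idx (j %% k.+1)%N.
  have jk : (j %% k.+1 < k.+1)%N by rewrite ltn_pmod.
  by rewrite -(tnth_nth _ t (Ordinal jk)) tnth_mktuple.
have orgE j : org (tuple_edge t j) = f j.
  by rewrite /tuple_edge tE (idxP _).1 periodic_modn.
have terE j : ter (tuple_edge t j) = f j.+1.
  rewrite /tuple_edge tE (idxP _).2 -(periodic_modn j.+1 fp) -(periodic_modn (_ %% _).+1 fp).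
  by rewrite -[in LHS]addn1 modnDml addn1.
exists t; split; first exact/funext/orgE.
apply/prodf_neq0 => i _; rewrite mxE.
have e1 : edge_of (nth (thead t) t i) = tuple_edge t i by rewrite /tuple_edge modn_small.
rewrite e1 -/(tuple_edge t (i + k)) terE orgE -addnS fp eqxx /=.
have -> : tuple_edge t i != erev (tuple_edge t (i + k)).
  apply/eqP => E; have := fb (i + k)%N; rewrite -!addnS -addSnnS fp -(terE i) E.
  by rewrite -[ter (erev _)]/(org _) orgE eqxx.
by rewrite -(rmorph0 (real_complex R)) (inj_eq (@complexI R)) gt_eqF// wt_gt0.
Qed.

End Words.

Definition cycle_in c := forall j, adj_in (cfun c j) (cfun c j.+1).

(** A cycle inside [A] of length k + 1 is spelled by a tuple of k + 1 of the finitely many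
    orientations; bounding the length leaves finitely many tuples. *)
Lemma short_cycles_exist N : exists S : {fset rpcycle X},
  forall c, c \in S <-> ((clen c <= N)%N /\ cycle_in c).
Proof.
pose W : seq (seq V) := flatten [seq [seq mkseq (tuple_walk t) k.+2 |
  t <- enum {: k.+1.-tuple 'I_(n + n)}] | k <- iota 0 N].
pose h c := mkseq (cfun c) (clen c).+1.
pose D := [set c : rpcycle X | (clen c <= N)%N /\ cycle_in c].
have hI : injective h.
  move=> c d E; have [c0 cn _] := cycle_walk (val c); have [d0 dn _] := cycle_walk (val d).
  have l : clen c = clen d by have := congr1 size E; rewrite !size_mkseq => -[].
  have fE : cfun c = cfun d.
    apply: (mkseq_inj c0 cn); first by rewrite l.
    by rewrite -[LHS]/(h c) E /h l.
  by apply/val_inj/(gcycle_eq (i := 0) l); rewrite fE; apply/funext => j; rewrite /shift_fun addn0.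
have Dfin : finite_set D.
  apply: (@sub_finite_set _ _ (h @^-1` [set` W])); last first.
    by apply: finite_preimage => [? ? _ _|]; [exact: hI|exact: finite_seq].
  move=> c [lc cA] /=; have := cycle_length_gt0 (val c).
  have := nb_walk_rpcycle c; rewrite /h; case E : (clen c) lc => [//|k] kN wc _.
  have [t [tc _]] := tuple_of_walk wc cA.
  apply/flatten_mapP; exists k; first by rewrite mem_iota.
  by apply/mapP; exists t; rewrite ?mem_enum// tc.
exists (fset_set D) => c; rewrite in_fset_set//; split=> [/set_mem//|H].
exact: mem_set.
Qed.

(** Both sides are sums of path weights over the same duplicate-free list of closed walks, spelled
    by edges on the left ([ts]) and by pairs of a prime cycle and a rotation on the right ([L]). *)
Lemma trace_cycles N (S : {fset rpcycle X}) k :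
  (forall c, c \in S <-> ((clen c <= N)%N /\ cycle_in c)) -> (k < N)%N ->
  \tr (edge_mx ^+ k.+1) = \sum_(c <- S)
    (if (clen c %| k.+1)%N then (clen c)%:R * (cycle_weight (val c))%:C ^+ (k.+1 %/ clen c) else 0).
Proof.
move=> SP kN; rewrite mxtrace_expr.
pose ts := [seq t <- enum {: k.+1.-tuple 'I_(n + n)} | tuple_weight t != 0].
pose u (t : k.+1.-tuple 'I_(n + n)) := mkseq (tuple_walk t) k.+2.
pose L := [seq (c, i) | c <- [seq c <- S | (clen c %| k.+1)%N], i <- iota 0 (clen c)].
pose v (p : rpcycle X * nat) := mkseq (shift_fun p.2 (cfun p.1)) k.+2.
transitivity (\sum_(s <- [seq u t | t <- ts]) (path_weight X s)%:C).
  rewrite big_map big_filter big_enum_cond/=.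
  rewrite (bigID (fun t => tuple_weight t != 0))/= [X in _ + X]big1 ?addr0; last first.
    by move=> t /negPn/eqP.
  by apply: eq_bigr => t /tuple_weight_neq0[].
transitivity (\sum_(s <- [seq v p | p <- L]) (path_weight X s)%:C); last first.
  rewrite big_map big_allpairs_dep/= big_filter big_mkcond/=; apply: eq_bigr => c _.
  case: ifP => // /divnK dv.
  rewrite (eq_bigr (fun=> (cycle_weight (val c))%:C ^+ (k.+1 %/ clen c))) => [|i _].
    by rewrite big_const_seq count_predT size_iota iter_addr_0 mulr_natl.
  transitivity ((path_weight X (mkseq (shift_fun i (cfun c)) k.+2))%:C : C) => //.
  by rewrite -{1}dv word_weight_power rmorphXn.
apply: perm_big; apply: uniq_perm.
- rewrite map_inj_in_uniq; first by apply: filter_uniq; exact: enum_uniq.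
  move=> t t'.
  rewrite !mem_filter => /andP[/tuple_weight_neq0[[[_ w _] _] _ e _] _].
  move=> /andP[/tuple_weight_neq0[[[_ w' _] _] _ e' _] _] /(mkseq_inj (ltn0Sn k) w w') E.
  apply: eq_from_tnth => i; apply: edge_of_inj.
  rewrite !(tnth_nth (thead t)) -[X in nth _ _ X](modn_small (ltn_ord i)).
  rewrite (set_nth_default (thead t')) ?size_tuple ?modn_small//.
  have H (s : k.+1.-tuple 'I_(n + n)) x : edge_of (nth x s i) = tuple_edge s i.
    by rewrite /tuple_edge modn_small// (set_nth_default x) ?size_tuple.
  rewrite !H; apply: oedge_eq; last by rewrite e e' E.
  by rewrite -!/(tuple_walk _ _) E.
- rewrite map_inj_in_uniq.
    apply: allpairs_uniq_dep; rewrite ?filter_uniq ?fset_uniq//.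
      by move=> c _; exact: iota_uniq.
    by move=> [c i] [d j] _ _ /= [-> ->].
  move=> [c i] [d j] /allpairsPdep[c' [i' [+ + [-> ->]]]] /allpairsPdep[d' [j' [+ + [-> ->]]]].
  rewrite !mem_filter !mem_iota /= !add0n => /andP[dc _] ic /andP[dd _] jd.
  have per c0 i0 : (clen c0 %| k.+1)%N -> has_period k.+1 (shift_fun i0 (cfun c0)).
    move=> /divnK <-; have [_ cn _] := cycle_walk (val c0).
    exact/periodic_shift/periodic_mul.
  move=> /(mkseq_inj (ltn0Sn k) (per _ _ dc) (per _ _ dd)) E.
  by have [-> ->] := nb_walk_decomp_inj ic jd E.
- move=> s; apply/mapP/mapP => [[t]|[[c i] /allpairsPdep[c' [i' [+ + [-> ->]]]]]].
    rewrite mem_filter => /andP[/tuple_weight_neq0[w wA _ _] _] ->.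
    have [c [i [dc ic tE]]] := nb_walk_decomp w.
    exists (c, i); last by rewrite /u tE.
    apply/allpairsPdep; exists c, i; split; rewrite ?mem_iota ?add0n//.
    rewrite mem_filter dc; apply/SP; split; first exact: leq_trans (dvdn_leq _ dc) kN.
    have [c0 cn _] := cycle_walk (val c).
    move=> j; have := wA (i * clen c - i + j)%N; rewrite tE /shift_fun.
    have E l : (i * clen c - i + l + i)%N = (l + i * clen c)%N by nia.
    by rewrite -addnS !E !(periodic_mul _ cn).
  rewrite mem_filter mem_iota add0n => /andP[dc /SP[_ cA]] ic ->.
  have w : nb_walk X (shift_fun i' (cfun c')) k.+1.
    rewrite -(divnK dc); apply: nb_walk_mul.
      by rewrite divn_gt0 ?cycle_length_gt0// dvdn_leq.
    exact/nb_walk_shift/nb_walk_rpcycle.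
  have [|t [tE t0]] := tuple_of_walk w; first by move=> j; rewrite /shift_fun addSn.
  exists t; first by rewrite mem_filter t0 mem_enum.
  by rewrite /u tE.
Qed.

End FiniteTruncation.

Section PolynomialProducts.
Variables (R : realType) (I : choiceType) (w : I -> R) (l : I -> nat) (r K : R).
Local Notation C := R[i].
Hypotheses (w0 : forall i, 0 <= w i) (r0 : 0 < r).
Hypothesis wK : bounded_sums (fun i => w i * r ^+ l i) K.

Definition set_degree (Q : {fset I}) : nat := (\sum_(i <- Q) l i)%N.

Definition set_coef (Q : {fset I}) : C := \prod_(i <- Q) - (w i)%:C.

Lemma set_coef_bound :
  bounded_sums (fun Q => normc (set_coef Q) * r ^+ set_degree Q) (expR K).
Proof.
have wr i : 0 <= w i * r ^+ l i by rewrite mulr_ge0 ?w0 ?exprn_ge0 ?ltW.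
have := bounded_sums_prod wr wK; apply: bounded_sums_le => Q.
rewrite big_split /set_coef normc_prod (eq_bigr w) => [|i _].
  by rewrite /set_degree -expr_sum.
by rewrite normcNE normcC ger0_norm.
Qed.

Lemma prod_monomials_coef (S : {fset I}) n :
  (\prod_(i <- S) (1 - (w i)%:C *: 'X^(l i)) : {poly C})`_n =
  \sum_(Q <- fpowerset S) set_coef Q *+ (set_degree Q == n).
Proof.
rewrite (prodr_fset_addr1 (fun i => - ((w i)%:C *: 'X^(l i)) : {poly C})) coef_sum.
apply: eq_bigr => Q _.
have -> : \prod_(i <- Q) - ((w i)%:C *: 'X^(l i)) = set_coef Q *: 'X^(set_degree Q).
  rewrite /set_coef /set_degree; elim/big_rec3: _ => [|i d c p _ ->].
    by rewrite expr0 scale1r.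
  by rewrite mulNr -scalerAl -scalerAr scalerA exprD mulNr scaleNr.
by rewrite coefZ coefXn eq_sym mulr_natr.
Qed.

(** A set of total degree n only has elements of degree at most n, so it is eventually contained in
    [S t]; the sum over all sets of degree n dominates. *)
Lemma prod_monomials_cvg (T : Type) (F : set_system T) (FF : ProperFilter F)
    (S : T -> {fset I}) n :
  (forall i, (l i <= n)%N -> \forall t \near F, i \in S t) ->
  (\prod_(i <- S t) (1 - (w i)%:C *: 'X^(l i)) : {poly C})`_n @[t --> F] -->
    (degree_coef set_degree set_coef n : C^o).
Proof.
move=> HS; pose f_ t Q := if (Q `<=` S t)%fset then set_coef Q *+ (set_degree Q == n) else 0.
have fE t : (\prod_(i <- S t) (1 - (w i)%:C *: 'X^(l i)) : {poly C})`_n = isum (f_ t).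
  rewrite prod_monomials_coef (@isum_fset _ _ _ (fpowerset (S t))).
    by rewrite big_seq [RHS]big_seq; apply: eq_bigr => Q; rewrite fpowersetE /f_ => ->.
  by move=> Q; rewrite fpowersetE /f_ => /negbTE ->.
have [M HM] := degree_summable r0 set_coef_bound n.
under eq_fun do rewrite fE.
apply: (isum_dominated FF _ HM) => [t Q|Q]; rewrite /f_.
  by case: ifP => // _; rewrite ComplexField.Normc.normc0 normc_ge0.
case: eqP => [dQ|_]; last first.
  by apply: nearW => t; case: ifP.
have : \forall t \near F, forall i, i \in Q -> ((l i <= n)%N -> i \in S t).
  apply: near_fset_all => i; have [ln|nl] := leqP (l i) n.
    by apply: filterS (HS i ln) => t ->.
  by apply: nearW.
apply: filterS => t Ht; rewrite ifT//; apply/fsubsetP => i iQ; apply: Ht => //.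
by rewrite -dQ /set_degree (big_fsetD1 i)//= leq_addr.
Qed.

End PolynomialProducts.

Section FiniteBounds.
Variables (R : realType) (V : choiceType) (X : wgraph R V).
Local Notation C := R[i].
Local Notation B := (total_wt X).
Local Notation cfun c := (cycle_fun (val c)).
Local Notation clen c := (cycle_length (val c)).
Local Notation cwt c := (cycle_weight (val c)).
Implicit Types (A : {fset uedge X}) (c : rpcycle X).

Definition edge_det A : {poly C} := \det (1%:M - 'X *: map_mx polyC (edge_mx A)).

Lemma cycle_weight_ge0 c : 0 <= cwt c.
Proof.
rewrite cycle_weightE prodr_ge0// => i _; apply/ltW/weight_gt0.
by have [_ _] := cycle_walk (val c).
Qed.

(** Both sides have constant term 1 and, by [trace_cycles], the same logarithmic derivative up to
    degree N. *)
Lemma edge_det_cycles A N (S : {fset rpcycle X}) :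
  (forall c, c \in S <-> ((clen c <= N)%N /\ cycle_in A c)) ->
  coef_eq N (edge_det A) (\prod_(c <- S) (1 - (cwt c)%:C *: 'X^(clen c))).
Proof.
move=> SP; apply: (@newton_unique _ _ _ _ (trace_poly N (edge_mx A))).
- by rewrite coef_poly.
- have := @coef_eq_det _ 0 _ (1%:M - 'X *: map_mx polyC (edge_mx A)) 1%:M.
  move=> /(_ _ 0%N (leqnn _)) ->; last first.
    move=> i j [|//] _; rewrite !mxE coefB coefXM subr0//.
  rewrite det1; symmetry.
  have := @coef_eq_prod _ 0 _ S (fun c => 1 - (cwt c)%:C *: 'X^(clen c) : {poly C}) (fun=> 1).
  move=> /(_ _ 0%N (leqnn _)) ->; first by rewrite big1.
  move=> c [|//] _; rewrite coefB coefZ coefXn.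
  by rewrite (ltn_eqF (cycle_length_gt0 _)) mulr0 subr0.
- exact: newton_det.
- have -> : trace_poly N (edge_mx A) = \sum_(c <- S) power_poly N (cwt c)%:C (clen c).
    apply/polyP => -[|k]; rewrite coef_sum coef_poly ltnS.
      by rewrite big1// => c _; rewrite coef_poly.
    case: ifP => kN /=; last by rewrite big1// => c _; rewrite coef_poly ltnS kN.
    rewrite (trace_cycles SP kN); apply: eq_bigr => c _.
    by rewrite coef_poly ltnS kN.
  apply: newton_prod => c; apply: newton_factor; exact: cycle_length_gt0.
Qed.

Lemma normc_edge_mx A i j : normc (edge_mx A i j) <= wt (edge_of j).
Proof.
rewrite mxE; case: ifP => _; first by rewrite normcC ger0_norm// wt_ge0.
by rewrite ComplexField.Normc.normc0 wt_ge0.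
Qed.

(** An entry is at most the weight of its column's edge. Summing over each intermediate edge costs a
    factor [B], and the weight of the last edge is kept for the sum along the diagonal. *)
Lemma normc_trace A k : normc (\tr (edge_mx A ^+ k.+1)) <= B ^+ k.+1.
Proof.
have B0 := total_wt_ge0 X.
have H m i j : normc ((edge_mx A ^+ m.+1) i j) <= B ^+ m * wt (edge_of j).
  elim: m i j => [|m IH] i j; first by rewrite !expr1 expr0 mul1r normc_edge_mx.
  rewrite exprS mxE; apply: le_trans (normc_sum _ _ _) _.
  apply: (@le_trans _ _ (\sum_j0 wt (edge_of j0) * (B ^+ m * wt (edge_of j)))).
    apply: ler_sum => j0 _; rewrite ComplexField.Normc.normcM.
    by apply: ler_pM; rewrite ?normc_ge0 ?normc_edge_mx ?IH.
  rewrite -mulr_suml exprS -mulrA; apply: ler_wpM2r; last exact: sum_wt_edge_of.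
  by rewrite mulr_ge0 ?exprn_ge0 ?wt_ge0.
apply: le_trans (normc_sum _ _ _) _.
apply: (@le_trans _ _ (\sum_i B ^+ k * wt (edge_of i))); first by apply: ler_sum => i _.
by rewrite -mulr_sumr exprSr ler_wpM2l ?exprn_ge0 ?sum_wt_edge_of.
Qed.

Lemma edge_det_bound : exists M : R, 0 <= M /\ forall A k,
  normc (edge_det A)`_k <= M ^+ k / k`!%:R.
Proof.
have [m Hm] := bounded_valency X.
exists (m%:R * B); split; first by rewrite mulr_ge0 ?total_wt_ge0.
(* [det_coef_bound] asks for row sums, while the small sums are those of the columns. The nonzero
   entries of column j come from edges ending at o(j), which are told apart by their origins, hence
   at most [m]. *)
move=> A k; rewrite /edge_det -det_tr.
have -> : (1%:M - 'X *: map_mx polyC (edge_mx A))^T =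
    1%:M - 'X *: map_mx polyC (edge_mx A)^T.
  by apply/matrixP => i j; rewrite !mxE eq_sym.
have row j : \sum_i normc ((edge_mx A)^T j i) <= m%:R * wt (edge_of j).
  pose D := [seq i <- enum 'I_(size (enum_fset A) + size (enum_fset A)) |
    ter (edge_of i) == org (edge_of j)].
  apply: (@le_trans _ _ (\sum_(i <- D) wt (edge_of j))).
    rewrite big_filter big_enum_cond/= [leRHS]big_mkcond/=; apply: ler_sum => i _.
    rewrite !mxE; case: (ter (edge_of i) == org (edge_of j)); last first.
      by rewrite andFb ComplexField.Normc.normc0.
    case: ifP => _; first by rewrite normcC ger0_norm// wt_ge0.
    by rewrite ComplexField.Normc.normc0 wt_ge0.
  rewrite big_const_seq count_predT iter_addr_0 -[_ *+ _]mulr_natl.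
  apply: ler_wpM2r; first exact: wt_ge0.
  rewrite ler_nat -(size_map (fun i => org (edge_of i))).
  set s := map _ _; have us : uniq s.
    rewrite map_inj_in_uniq; first by apply: filter_uniq; exact: enum_uniq.
    move=> i i'.
    rewrite !mem_filter => /andP[/eqP ti _] /andP[/eqP ti' _] oi.
    by apply/edge_of_inj/oedge_eq; rewrite ?ti ?ti'.
  have <- : #|` [fset y in s]%fset| = size s.
    by apply: perm_size; apply: uniq_perm; rewrite ?fset_uniq// => y; rewrite !inE.
  apply: (Hm (org (edge_of j))) => y; rewrite !inE => /mapP[i' ].
  rewrite mem_filter => /andP[/eqP <- _] ->.
  by rewrite adj_sym; exact: (valP (edge_of i')).
apply: le_trans (det_coef_bound k row) _.
rewrite ler_wpM2r ?invr_ge0// -mulr_sumr; apply: lerXn2r.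
- by rewrite nnegrE mulr_ge0// sumr_ge0// => i _; exact: wt_ge0.
- by rewrite nnegrE mulr_ge0 ?total_wt_ge0.
- by rewrite ler_wpM2l// sum_wt_edge_of.
Qed.

Lemma cycle_in_near c : \forall A \near totally, cycle_in A c.
Proof.
have [c0 cn ca] := cycle_walk (val c).
pose e j : oedge X := exist _ (cfun c j, cfun c j.+1) (ca j).
exists [fset und (e j) | j in iota 0 (clen c)]%fset => // A /= cA j.
rewrite /adj_in; apply/imfsetP; exists (und (e (j %% clen c)%N)) => /=.
  move/fsubsetP: cA; apply; apply/imfsetP; exists (j %% clen c)%N => //=.
  by rewrite mem_iota add0n ltn_pmod.
rewrite /org /ter /= periodic_modn//; congr [fset _; _]%fset.
by rewrite -(periodic_modn j.+1 cn) -(periodic_modn (_ %% _).+1 cn) -[in RHS]addn1 modnDml addn1.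
Qed.

(** [B] times this radius is at most 1/2, so the trace bounds sum to a geometric series of total at
    most 1; the summand 1 keeps it defined for B = 0. *)
Definition zeta_radius : R := (2 * (B + 1))^-1.

Lemma zeta_radius_gt0 : 0 < zeta_radius.
Proof. by rewrite invr_gt0; have := total_wt_ge0 X; lra. Qed.

(** Finitely many cycles lie in one finite [A] and have bounded length. There a cycle of length k +
    1 enters the trace of T^(k+1) with coefficient k + 1, and all other terms are nonnegative. *)
Lemma cycles_bounded : bounded_sums (fun c => cwt c * zeta_radius ^+ clen c) 1.
Proof.
move=> F; have r0 := zeta_radius_gt0; have B0 := total_wt_ge0 X.
have := near_fset_all (totally_filter (I := uedge X)) F (cycle_in_near).
move=> [A _ /(_ A (fsubset_refl A))] /= FA.
pose N := (\max_(c <- F) clen c)%N.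
have [S SP] := short_cycles_exist A N.
have FS : (F `<=` S)%fset.
  apply/fsubsetP => c cF; apply/SP; split; last exact: FA.
  exact: (@leq_bigmax_seq _ (F : seq _) xpredT (fun c => clen c)).
have wr c : 0 <= cwt c * zeta_radius ^+ clen c.
  by rewrite mulr_ge0 ?cycle_weight_ge0 ?exprn_ge0 ?ltW.
apply: le_trans (ler_sum_fsubset wr FS) _.
have -> : \sum_(c <- S) cwt c * zeta_radius ^+ clen c =
   \sum_(k < N) zeta_radius ^+ k.+1 * \sum_(c <- S | clen c == k.+1) cwt c.
  under [RHS]eq_bigr do rewrite mulr_sumr big_mkcond.
  rewrite exchange_big/= big_seq [RHS]big_seq; apply: eq_bigr => c /SP[cN _].
  have := cycle_length_gt0 (val c); move: cN; case: (clen c) => [//|k] kN _.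
  rewrite (bigD1 (Ordinal kN))//= eqxx big1 ?addr0 1?mulrC// => j jk.
  by rewrite eqSS -[(k == j)%N]/(Ordinal kN == j) eq_sym (negbTE jk).
apply: (@le_trans _ _ (\sum_(k < N) 2^-1 ^+ k.+1)).
  apply: ler_sum => k _.
  apply: (@le_trans _ _ (zeta_radius ^+ k.+1 * B ^+ k.+1)).
    rewrite ler_wpM2l ?exprn_ge0 ?(ltW r0)//; apply: le_trans (normc_trace A k).
    rewrite (trace_cycles SP (ltn_ord k)).
    pose x c := if (clen c %| k.+1)%N then (clen c)%:R * cwt c ^+ (k.+1 %/ clen c) else 0.
    have x0 c : 0 <= x c.
      by rewrite /x; case: ifP => // _; rewrite mulr_ge0 ?exprn_ge0 ?cycle_weight_ge0.
    rewrite (eq_bigr (fun c => (x c)%:C)) => [|c _]; last first.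
      by rewrite /x; case: ifP => // _; rewrite rmorphM rmorphXn rmorph_nat.
    rewrite -rmorph_sum normcC ger0_norm ?sumr_ge0// big_mkcond.
    apply: ler_sum => c _; case: eqP => [cl|_]; last exact: x0.
    by rewrite /x cl dvdnn divnn /= expr1 ler_peMl ?cycle_weight_ge0// ler1n.
  rewrite -exprMn; apply: lerXn2r; rewrite ?nnegrE ?mulr_ge0 ?(ltW r0)//.
  by rewrite /zeta_radius invfM -mulrA ler_piMr// ler_pdivrMl ?mulr1; lra.
have E m : \sum_(k < m) 2^-1 ^+ k.+1 = 1 - 2^-1 ^+ m :> R.
  elim: m => [|m IH]; first by rewrite big_ord0 expr0 subrr.
  by rewrite big_ord_recr/= IH exprS; lra.
by rewrite E gerBl exprn_ge0.
Qed.

End FiniteBounds.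

Section ZetaSeries.
Variables (R : realType) (V : choiceType) (X : wgraph R V).
Local Notation C := R[i].
Local Notation clen c := (cycle_length (val c)).
Local Notation cwt c := (cycle_weight (val c)).
Implicit Types (A : {fset uedge X}) (c : rpcycle X).

Definition zeta_coef (n : nat) : C :=
  degree_coef (set_degree (fun c => clen c)) (set_coef (fun c => cwt c)) n.

Lemma zeta_coef_lim n :
  (fun A : {fset uedge X} => (edge_det A)`_n : C^o) @ totally --> (zeta_coef n : C^o).
Proof.
have /choice[S SP] A := short_cycles_exist A n.
have -> : (fun A => (edge_det A)`_n : C^o) =
    (fun A => (\prod_(c <- S A) (1 - (cwt c)%:C *: 'X^(clen c)) : {poly C})`_n).
  by apply/funext => A; exact: (edge_det_cycles (SP A) (leqnn n)).
apply: (prod_monomials_cvg (@cycle_weight_ge0 R V X) (zeta_radius_gt0 X)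
  (@cycles_bounded R V X)) => c cn.
by apply: filterS (cycle_in_near c) => A cA; apply/SP.
Qed.

Lemma normc_cvg_le (T : Type) (F : set_system T) (FF : ProperFilter F) (f : T -> C^o)
    (a : C^o) (K : R) : f @ F --> a -> (forall t, normc (f t) <= K) -> normc a <= K.
Proof.
move=> /cvgcP fa fK; apply/ler_addgt0Pr => e e0.
have /filter_ex[t /= Ht] := fa e e0.
rewrite -[a](subKr (f t)); apply: le_trans (normcB_le _ _) _.
by apply: lerD; [exact: fK|exact: ltW].
Qed.

(** The bound M^n / n! holds for every finite [A] with the same M and survives the limit; the
    resulting series is that of exp (M r). *)
Lemma zeta_coef_entire : entire_coefs zeta_coef.
Proof.
have [M [M0 HM]] := edge_det_bound X; move=> r r0.
exists (expR (M * r)); apply: bounded_sums_nat => [n|N].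
  by rewrite mulr_ge0 ?normc_ge0 ?exprn_ge0.
apply: (@le_trans _ _ (\sum_(n < N) exp_coeff (M * r) n)).
  apply: ler_sum => n _; rewrite /exp_coeff /= exprMn mulrAC ler_wpM2r ?exprn_ge0//.
  exact: (@normc_cvg_le _ totally _ _ _ _ (@zeta_coef_lim n) (fun A => HM A n)).
have := nondecreasing_cvgn_le _ (is_cvg_series_exp_coeff (M * r)) N.
rewrite /series /= big_mkord; apply.
apply: nondecreasing_series => n _ _.
by rewrite /exp_coeff /= mulr_ge0 ?invr_ge0// exprn_ge0// mulr_ge0.
Qed.

Let ev_small : \forall u \near (0 : C^o), normc u <= zeta_radius X / 2.
Proof.
have r0 := zeta_radius_gt0 X; have r2 : 0 < zeta_radius X / 2 by lra.
have /cvgcP /(_ _ r2) : id @ (0 : C^o) --> (0 : C^o) by exact: cvg_id.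
by apply: filterS => u /ltW; rewrite subr0.
Qed.

Lemma zeta_small (u : C) : normc u <= zeta_radius X / 2 ->
  [/\ zeta_converges X u & (zeta X u)^-1 = fseries zeta_coef u].
Proof.
have r0 := zeta_radius_gt0 X; move=> ur.
pose x c : C := - ((cwt c)%:C * u ^+ clen c).
(* Half the radius gains a factor 2^-l(c), at most 1/2 as lengths are positive. With
   [cycles_bounded] this keeps |x c| at most 1/2, so no factor vanishes. *)
have xb c : normc (x c) <= 2^-1 * (cwt c * zeta_radius X ^+ clen c).
  rewrite /x normcNE ComplexField.Normc.normcM normcC normcX.
  rewrite ger0_norm ?cycle_weight_ge0// mulrCA ler_wpM2l ?cycle_weight_ge0//.
  apply: (@le_trans _ _ ((zeta_radius X / 2) ^+ clen c)).
    by apply: lerXn2r; rewrite ?nnegrE ?normc_ge0//; lra.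
  rewrite exprMn mulrC ler_wpM2r ?exprn_ge0 ?(ltW r0)//.
  have := cycle_length_gt0 (val c); case: (clen c) => [//|l] _.
  by rewrite exprS ler_piMr ?exprn_ile1//; lra.
have sx : abs_summable x.
  apply: (abs_summable_le xb (@bounded_sumsZ _ _ _ 1 2^-1 _ (@cycles_bounded R V X))); lra.
have x1 c : 1 + x c != 0.
  apply/eqP => /eqP; rewrite addrC addr_eq0 => /eqP xc.
  have := xb c; rewrite xc normcNE ComplexField.Normc.normc1.
  have := bounded_sums_pt c (@cycles_bounded R V X).
  by move: (cwt c * _) => y y1 y2; lra.
have [P0 Pc] := partial_prod_inv_cvg sx x1.
have Px : isum (fun Q : {fset rpcycle X} => \prod_(c <- Q) x c) = fseries zeta_coef u.
  rewrite /zeta_coef -(isum_degree r0 (set_coef_bound (@cycle_weight_ge0 R V X) r0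
    (@cycles_bounded R V X))); last by lra.
  have -> // : (fun Q : {fset rpcycle X} => \prod_(c <- Q) x c) =
    (fun Q => set_coef (fun c => cwt c) Q * u ^+ set_degree (fun c => clen c) Q).
  apply/funext => Q; rewrite /x /set_coef /set_degree.
  elim/big_rec3: _ => [|c d p q _ ->]; first by rewrite expr0 mulr1.
  by rewrite exprD !mulNr mulrACA.
rewrite Px in P0 Pc.
have zE : zeta X u = (fseries zeta_coef u)^-1.
  by apply: cvg_lim => //; exact: Pc.
split; last by rewrite zE invrK.
split; last by rewrite zE invr_eq0.
by apply/cvg_ex; exists ((fseries zeta_coef u)^-1); exact: Pc.
Qed.

Lemma zeta_converges_near : \forall u \near (0 : C^o), zeta_converges X u.
Proof. by apply: filterS ev_small => u /zeta_small[]. Qed.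

Lemma inverse_zeta_fseries : inverse_zeta X (fseries zeta_coef).
Proof.
split; first exact/entire_fseries/zeta_coef_entire.
by apply: filterS ev_small => u /zeta_small[_ ->].
Qed.

Lemma taylor_inverse_zeta F n : inverse_zeta X F -> taylor F n = zeta_coef n.
Proof.
move=> [_ FE]; rewrite -(taylor_fseries n zeta_coef_entire); apply: taylor_near.
by have [_ GE] := inverse_zeta_fseries; apply: filterS2 FE GE => u -> ->.
Qed.

Lemma taylor_edge_prod n : taylor (edge_prod X) n = quad_coef (@edge_weight R V X) n.
Proof.
rewrite edge_prodE taylor_fseries//.
exact: quad_entire (@edge_weight_ge0 R V X) (@edge_weight_bounded R V X).
Qed.

Lemma quad_coef_lim n :
  (fun A : {fset uedge X} =>
     (\prod_(a <- A) (1 - (edge_weight a)%:C *: 'X^2) : {poly C})`_n : C^o) @ totally -->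
    (quad_coef (@edge_weight R V X) n : C^o).
Proof.
have E : bounded_sums (fun a : uedge X => edge_weight a * 1 ^+ 2) (total_wt X * total_wt X).
  by apply: bounded_sums_le (@edge_weight_bounded R V X) => a; rewrite expr1n mulr1.
have -> : quad_coef (@edge_weight R V X) n =
    degree_coef (set_degree (fun=> 2%N)) (set_coef (@edge_weight R V X)) n.
  rewrite /quad_coef (_ : (fun Q : {fset uedge X} => (2 * #|` Q|)%N) = set_degree (fun=> 2%N))//.
  by apply/funext => Q; rewrite /set_degree big_const_seq count_predT iter_addn_0.
apply: (@prod_monomials_cvg _ _ _ (fun=> 2%N) 1 _ (@edge_weight_ge0 R V X) ltr01 E _ totally _ id) => a _.
by exists [fset a]%fset => // A /=; rewrite fsub1set.
Qed.

End ZetaSeries.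

(** * The Fredholm determinant as a limit *)

Section ProductCoefficients.
Variable K : comNzRingType.

Lemma coef_prod_ffun k (p : 'I_k -> {poly K}) n :
  (\prod_a p a)`_n =
  \sum_(m : {ffun 'I_k -> 'I_n.+1} | (\sum_a m a)%N == n) \prod_a (p a)`_(m a).
Proof.
(* Cutting every factor at degree n makes the exponents range over ['I_n.+1], so that the product
   can be distributed. *)
pose q a : {poly K} := \sum_(j < n.+1) (p a)`_j *: 'X^j.
have pq a : coef_eq n (p a) (q a).
  move=> j jn; rewrite coef_sum (bigD1 (Ordinal (jn : (j < n.+1)%N)))//= coefZ coefXn eqxx mulr1.
  rewrite big1 ?addr0// => i ij; rewrite coefZ coefXn.
  case: eqP => [ji|_]; last by rewrite mulr0.
  by case/eqP: ij; apply: val_inj.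
rewrite (coef_eq_prod _ pq (leqnn n)) bigA_distr_bigA/= coef_sum [RHS]big_mkcond/=.
apply: eq_bigr => m _.
have -> : \prod_a ((p a)`_(m a) *: 'X^(m a)) = (\prod_a (p a)`_(m a)) *: 'X^(\sum_a m a).
  elim/big_rec3: _ => [|i d c r _ ->]; first by rewrite expr0 scale1r.
  by rewrite exprD -scalerAl -scalerAr scalerA.
by rewrite coefZ coefXn eq_sym; case: eqP => _; rewrite ?mulr1 ?mulr0.
Qed.

Lemma coef_det k (M : 'M[{poly K}]_k) n :
  (\det M)`_n = \sum_(m : {ffun 'I_k -> 'I_n.+1} | (\sum_a m a)%N == n)
    \det (\matrix_(a, b) (M a b)`_(m a)).
Proof.
rewrite /determinant coef_sum exchange_big/=; apply: eq_bigr => s _.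
rewrite -big_distrr/= -polyC1 -polyCN -polyC_exp coefCM coef_prod_ffun; congr (_ * _).
by apply: eq_bigr => m _; apply: eq_bigr => a _; rewrite mxE.
Qed.

End ProductCoefficients.

Lemma cvg_finite_sum (R : realType) (T : Type) (F : set_system T) (FF : Filter F)
    (J : Type) (s : seq J) (f : J -> T -> R[i]^o) (a : J -> R[i]^o) :
  (forall j, f j @ F --> a j) ->
  (fun t => \sum_(j <- s) f j t : R[i]^o) @ F --> (\sum_(j <- s) a j : R[i]^o).
Proof.
move=> fa; elim: s => [|j s IH].
  rewrite big_nil (_ : (fun t => _) = cst (0 : R[i]^o)); first exact: cvg_cst.
  by apply/funext => t; rewrite big_nil.
rewrite big_cons (_ : (fun t => _) = (fun t => f j t + \sum_(i <- s) f i t)).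
  exact: (cvgD (fa j) IH).
by apply/funext => t; rewrite big_cons.
Qed.

Section WedgeCoefficients.
Variables (R : realType) (I : choiceType).
Local Notation C := R[i].
Implicit Types E : nat -> I -> I -> C.

(** The expression [wedge_coef] in terms of matrix entries, so that it applies to the cut entries
    without an operator on [l2]. *)
Definition wedge_sum E k (x : 'I_k -> I) (n : nat) : C :=
  \sum_(m : {ffun 'I_k -> 'I_n.+1} | (\sum_a m a)%N == n)
    \det (\matrix_(a, b) E (m a) (x a) (x b)).

Definition fredholm_sum E (n : nat) : C :=
  \sum_(k < n.+1) isum (fun S : ksubset I k => wedge_sum E (ksubset_enum S) n).

(** Fewer than [k] units distributed over [k] rows leave a row of degree 0, which vanishes. *)
Lemma wedge_sum_eq0 E k (x : 'I_k -> I) n : (forall y z, E 0%N y z = 0) ->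
  (n < k)%N -> wedge_sum E x n = 0.
Proof.
move=> E0 nk; rewrite /wedge_sum big1// => m /eqP mn.
have [a ma] : exists a, m a = 0%N :> nat.
  apply: contrapT => H; have : (\sum_(a < k) 1 <= \sum_a m a)%N.
    apply: leq_sum => a _; rewrite lt0n; apply/eqP => ma; apply: H; by exists a.
  by rewrite sum1_card card_ord mn leqNgt nk.
rewrite (expand_det_row _ a) big1// => b _.
by rewrite mxE ma E0 mul0r.
Qed.

Lemma normc_det k (M : 'M[C]_k) (d : 'I_k -> R) : (forall a b, normc (M a b) <= d a) ->
  normc (\det M) <= k`!%:R * \prod_a d a.
Proof.
move=> Md; apply: le_trans (normc_sum _ _ _) _.
apply: (@le_trans _ _ (\sum_(s : {perm 'I_k}) \prod_a d a)).
  apply: ler_sum => s _; rewrite ComplexField.Normc.normcM normcX normcNE.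
  rewrite ComplexField.Normc.normc1 expr1n mul1r normc_prod.
  by apply: ler_prod => a _; rewrite normc_ge0 Md.
rewrite sumr_const -[X in X <= _]mulr_natl ler_wpM2r//.
  by apply: prodr_ge0 => a _; exact: le_trans (normc_ge0 _) (Md a a).
by rewrite ler_nat -card_Sn.
Qed.

Lemma ksubset_prod k (F : I -> R) (S : ksubset I k) :
  \prod_a F (ksubset_enum S a) = \prod_(x <- val S) F x.
Proof. by rewrite -(big_tuple _ _ (Tuple (valP S)) xpredT F). Qed.

Lemma normc_wedge_sum E n k (S : ksubset I k) (d : I -> R) :
  (forall m x y, (m <= n)%N -> normc (E m x y) <= d x) ->
  normc (wedge_sum E (ksubset_enum S) n) <=
    #|{ffun 'I_k -> 'I_n.+1}|%:R * k`!%:R * \prod_(x <- val S) d x.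
Proof.
move=> Ed; have d0 x : 0 <= d x by exact: le_trans (normc_ge0 _) (Ed 0%N x x (leq0n _)).
apply: le_trans (normc_sum _ _ _) _.
apply: (@le_trans _ _ (\sum_(m : {ffun 'I_k -> 'I_n.+1}) k`!%:R * \prod_(x <- val S) d x)).
  rewrite [leLHS]big_mkcond/=; apply: ler_sum => m _; case: ifP => _; last first.
    by rewrite mulr_ge0// prodr_ge0.
  rewrite -ksubset_prod; apply: normc_det => a b; rewrite mxE; apply: Ed.
  by rewrite -ltnS.
by rewrite sumr_const -[leLHS]mulr_natl mulrA.
Qed.

(** The term of a k-subset is at most a constant times the product of [d] over it, which is summable
    by [bounded_sums_prod]; and it involves finitely many entries, so it is eventually constant. *)
Lemma fredholm_sum_cvg (T : Type) (F : set_system T) (FF : ProperFilter F)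
    (E_ : T -> nat -> I -> I -> C) E (d : I -> R) K n : bounded_sums d K ->
  (forall t m x y, (m <= n)%N -> normc (E_ t m x y) <= d x) ->
  (forall m x y, \forall t \near F, E_ t m x y = E m x y) ->
  fredholm_sum (E_ t) n @[t --> F] --> (fredholm_sum E n : C^o).
Proof.
move=> dK Ed EE; apply: cvg_finite_sum => k.
have d0 x : 0 <= d x.
  have /filter_ex[t _] := EE 0%N x x; exact: le_trans (normc_ge0 _) (Ed t 0%N x x (leq0n _)).
apply: (isum_dominated FF (fun t S => normc_wedge_sum S (Ed t))).
  apply: bounded_sumsZ; first by rewrite mulr_ge0.
  exact: (bounded_sums_inj val_inj (bounded_sums_prod d0 dK)).
move=> S.
have : \forall t \near F, forall p, p \in [fset p | p in enum {: 'I_n.+1 * 'I_k * 'I_k}]%fset ->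
    E_ t p.1.1 (ksubset_enum S p.1.2) (ksubset_enum S p.2) =
    E p.1.1 (ksubset_enum S p.1.2) (ksubset_enum S p.2).
  by apply: near_fset_all => p; exact: EE.
apply: filterS => t Ht; apply: eq_bigr => m _; congr determinant.
apply/matrixP => a b; rewrite !mxE.
by apply: (Ht (m a, a, b)); rewrite inE mem_enum.
Qed.

End WedgeCoefficients.

Section TruncatedOperators.
Variables (R : realType) (V : choiceType) (X : wgraph R V).
Local Notation C := R[i].
Local Notation B := (total_wt X).
Local Notation edge := (oedge X).
Implicit Types (A : {fset uedge X}) (x y : V) (e : edge).

(** [J] only exchanges an edge with its reverse, so the coordinates of J^m sigma(x) are computed one
    edge at a time, without sums. *)
Fixpoint flow x (m : nat) (e : edge) : R :=
  if m is m'.+1 then wt e * flow x m' (erev e) else wt e *+ (org e == x).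

Lemma flow_ge0 x m e : 0 <= flow x m e.
Proof.
elim: m e => [|m IH] e /=; first by rewrite mulrn_wge0// wt_ge0.
by rewrite mulr_ge0 ?wt_ge0.
Qed.

Lemma flowE x m e : iter m (@J R V X) (sigma X (delta R x)) e = (flow x m e)%:C.
Proof.
elim: m e => [|m IH] e.
  rewrite -[LHS]/((wt e)%:C * (org e == x)%:R) /=.
  by case: eqP => _; rewrite ?mulr1 ?mulr0.
by rewrite iterS -[LHS]/((wt e)%:C * iter m (@J R V X) (sigma X (delta R x)) (erev e)) IH rmorphM.
Qed.

Lemma flow_bounded x m : bounded_sums (flow x m) (B ^+ m * out_wt X x).
Proof.
have B0 := total_wt_ge0 X.
elim: m => [|m IH].
  rewrite expr0 mul1r => L.
  exact: fiber_sum_ge (@wt_ge0 R V X) (@wt_bounded R V X) L x.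
rewrite exprS -mulrA.
apply: bounded_sums_le (bounded_sumsZ B0 (bounded_sums_inj (@erev_inj R V X) IH)) => e /=.
by rewrite ler_wpM2r ?flow_ge0 ?wt_le_total.
Qed.

Definition full_entry (m : nat) x y : C := ihara_coef X m (delta R x) y.

(* J preserves the space of the orientations of the edges in A, so cutting tau
   alone yields the operator of the finite graph with edge set A. *)
Definition cut_entry A (m : nat) x y : C :=
  if m is m'.+1 then (-1) ^+ m * \sum_i (flow x m' (edge_of (A := A) i))%:C *+ (ter (edge_of i) == y)
  else 0.

Lemma fredholm_detE n : fredholm_det (@ihara_coef R V X) n = fredholm_sum full_entry n.
Proof. by []. Qed.

(** The base 1 + B is at least 1, so the exponent [n] serves for all m up to n; what remains is the
    outgoing weight, summable over the vertices. *)
Lemma cut_entry_bound A n m x y : (m <= n)%N ->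
  normc (cut_entry A m x y) <= (1 + B) ^+ n * out_wt X x.
Proof.
have B0 := total_wt_ge0 X.
have o0 : 0 <= out_wt X x by exact: fiber_sum_ge0 (@wt_ge0 R V X) (@wt_bounded R V X) x.
case: m => [|m] mn; rewrite /cut_entry.
  by rewrite ComplexField.Normc.normc0 mulr_ge0 ?exprn_ge0//; lra.
rewrite ComplexField.Normc.normcM normcX normcNE ComplexField.Normc.normc1 expr1n mul1r.
apply: le_trans (normc_sum _ _ _) _.
apply: (@le_trans _ _ (\sum_i flow x m (edge_of (A := A) i))).
  apply: ler_sum => i _; case: eqP => _; rewrite ?mulr1n ?mulr0n.
    by rewrite normcC ger0_norm ?flow_ge0.
  by rewrite ComplexField.Normc.normc0 flow_ge0.
rewrite -(big_map (@edge_of R V X A) xpredT (flow x m)).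
apply: (le_trans (bounded_sums_uniq (@flow_bounded x m) _)).
  by rewrite map_inj_uniq ?index_enum_uniq//; exact: edge_of_inj.
apply: ler_wpM2r => //; apply: (@le_trans _ _ ((1 + B) ^+ m)).
  by apply: lerXn2r; rewrite ?nnegrE; lra.
by apply: ler_weXn2l; [lra|exact: ltnW].
Qed.

(** Only the edges ending at [y] contribute, and by bounded valency they are finitely many. *)
Lemma cut_entry_near m x y : \forall A \near totally, cut_entry A m x y = full_entry m x y.
Proof.
case: m => [|m]; first by apply: nearW.
pose Y := fset_set [set e : edge | ter e = y].
exists [fset und e | e in Y]%fset => // A /= YA.
rewrite /full_entry /= -[RHS]/((-1) ^+ m.+1 * tau_fun (iter m (@J R V X) (sigma X (delta R x))) y).
congr (_ * _); rewrite /tau_fun fsbig_finite/=; last exact: finite_ter.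
rewrite -/Y (eq_bigr (fun e => (flow x m e)%:C)); last by move=> e _; exact: flowE.
under eq_bigr do rewrite mulrb.
rewrite -big_mkcond/= -(big_map (@edge_of R V X A) (fun e => ter e == y) (fun e => (flow x m e)%:C)).
rewrite -big_filter; apply: perm_big; apply: uniq_perm; rewrite ?fset_uniq//.
  by rewrite filter_uniq// map_inj_uniq ?index_enum_uniq//; exact: edge_of_inj.
move=> e; rewrite mem_filter in_fset_set; last exact: finite_ter.
apply/andP/idP => [[/eqP ey _]|]; first by rewrite inE.
rewrite inE /= => ey; split; first exact/eqP.
have [i0 <-] : exists i, edge_of (A := A) i = e.
  apply: edge_of_surj; move/fsubsetP: YA; apply; apply/imfsetP; exists e => //=.
  by rewrite in_fset_set ?inE//; exact: finite_ter.
by rewrite map_f// mem_index_enum.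
Qed.

End TruncatedOperators.

(** * The factorization for a finite set of edges *)

Section CutIdentity.
Variables (R : realType) (V : choiceType) (X : wgraph R V) (A : {fset uedge X}).
Local Notation C := R[i].
Local Notation n2 := (size (enum_fset A) + size (enum_fset A))%N.
Local Notation eo := (@edge_of R V X A).

Definition cut_vertices : {fset V} := [fset org (eo i) | i in enum 'I_n2]%fset.

Local Notation nv := (size (enum_fset cut_vertices)).

Definition vertex_of (x : 'I_nv) : V := tnth (in_tuple (enum_fset cut_vertices)) x.

Lemma vertex_of_inj : injective vertex_of.
Proof. by apply/tuple_uniqP; exact: fset_uniq. Qed.

Lemma vertex_of_mem x : vertex_of x \in cut_vertices.
Proof. exact: mem_tnth. Qed.

Lemma vertex_of_surj v : v \in cut_vertices -> exists x, vertex_of x = v.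
Proof.
by move=> vA; have /tnthP[x ->] : v \in in_tuple (enum_fset cut_vertices) by []; exists x.
Qed.

Lemma org_cut i : org (eo i) \in cut_vertices.
Proof. by apply/imfsetP; exists i => //=; rewrite mem_enum. Qed.

Lemma erev_edge_of i : exists j, eo j = erev (eo i).
Proof. by apply: edge_of_surj; rewrite und_erev; exact: und_edge_of. Qed.

Definition sigma_mx : 'M[C]_(nv, n2) :=
  \matrix_(x, i) ((wt (eo i))%:C *+ (org (eo i) == vertex_of x)).

Definition tau_mx : 'M[C]_(n2, nv) := \matrix_(i, y) (ter (eo i) == vertex_of y)%:R.

Definition J_mx : 'M[C]_n2 :=
  \matrix_(i, j) ((wt (eo j))%:C *+ (eo j == erev (eo i))).

(** The product also continues an edge by its reverse, with the weight that [J_mx] subtracts. *)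
Lemma edge_mxE : edge_mx A = tau_mx *m sigma_mx - J_mx.
Proof.
apply/matrixP => i j; rewrite !mxE.
have [x xE] := vertex_of_surj (org_cut j).
rewrite (bigD1 x)//= big1 ?addr0 => [|y yx].
  rewrite !mxE xE eqxx mulr1n; case: (eqVneq (eo j) (erev (eo i))) => [->|_].
    by rewrite eqxx mulr1n mul1r andbF subrr.
  by rewrite mulr0n subr0 andbT; case: eqP => _; rewrite ?mul1r ?mul0r.
rewrite !mxE -xE; case: eqP => [|_]; last by rewrite mul0r.
case: eqP => [|_]; last by rewrite mulr0n mulr0.
by move=> /vertex_of_inj E; rewrite E eqxx in yx.
Qed.

Lemma sigma_J_mx m x i : (sigma_mx *m J_mx ^+ m) x i = (flow (vertex_of x) m (eo i))%:C.
Proof.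
elim: m i => [|m IH] i.
  rewrite expr0 -[1]/(1%:M) mulmx1 mxE /=.
  by case: eqP => _; rewrite ?mulr1n ?mulr0n.
rewrite exprSr -[_ * J_mx]/(_ *m J_mx) mulmxA mxE.
have [j jE] := erev_edge_of i.
rewrite (bigD1 j)//= big1 ?addr0 => [|j' jj'].
  by rewrite IH mxE jE erevK eqxx mulr1n rmorphM mulrC.
rewrite [J_mx _ _]mxE; case: eqP => [E|_]; last by rewrite mulr0n mulr0.
have : eo j' = eo j by rewrite jE E erevK.
by move=> /edge_of_inj E'; rewrite E' eqxx in jj'.
Qed.

Lemma cut_entry_mx m x y :
  (-1) ^+ m.+1 * (sigma_mx *m J_mx ^+ m *m tau_mx) x y =
  cut_entry A m.+1 (vertex_of x) (vertex_of y).
Proof.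
rewrite /cut_entry; congr (_ * _); rewrite mxE; apply: eq_bigr => i _.
by rewrite sigma_J_mx mxE mulr_natr.
Qed.

Definition operator_mx N : 'M[{poly C}]_nv :=
  \sum_(k < N) (- 'X) ^+ k.+1 *: map_mx polyC (sigma_mx *m J_mx ^+ k *m tau_mx).

Lemma operator_mx_coef N x y j : (j <= N)%N ->
  (operator_mx N x y)`_j = cut_entry A j (vertex_of x) (vertex_of y).
Proof.
move=> jN; rewrite summxE coef_sum.
have E k : (((- 'X) ^+ k.+1 *: map_mx polyC (sigma_mx *m J_mx ^+ k *m tau_mx)) x y)`_j =
    cut_entry A k.+1 (vertex_of x) (vertex_of y) *+ (j == k.+1).
  rewrite -cut_entry_mx mxE [map_mx _ _ _ _]mxE (exprNn 'X).
  rewrite -polyC1 -polyCN -polyC_exp -mulrA coefCM coefMC coefXn.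
  by case: eqP => _; rewrite ?mul1r ?mul0r ?mulr0.
under eq_bigr do rewrite E.
case: j jN {E} => [|j] jN; first by rewrite big1.
rewrite (bigD1 (Ordinal jN))// eqxx mulr1n big1 => [|k kj]; first exact: addr0.
by rewrite eqSS -[(j == k)%N]/(Ordinal jN == k) eq_sym (negbTE kj) mulr0n.
Qed.

Lemma cut_entry_notin m x y : x \notin cut_vertices -> cut_entry A m x y = 0.
Proof.
move=> xA; case: m => [//|m]; rewrite /cut_entry big1 ?mulr0// => i _.
suff -> : flow x m (eo i) = 0 by rewrite mul0rn.
elim: m i => [|m IH] i /=.
  by case: eqP => [xE|_]; rewrite ?mulr0n// -xE org_cut in xA.
by have [j <-] := erev_edge_of i; rewrite IH mulr0.
Qed.

(** Principal minors are grouped by size: those larger than [n] have no coefficient of degree n, and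
    k-subsets with a vertex outside [cut_vertices] contribute a determinant with a zero row. *)
Lemma det_cut N n : (n <= N)%N ->
  (\det (1%:M + operator_mx N))`_n = fredholm_sum (cut_entry A) n.
Proof.
move=> nN; rewrite det_1add_minors coef_sum.
pose G (S : {set 'I_nv}) := (\det (minor_mx (operator_mx N) S))`_n.
have GE k (h : 'I_k -> 'I_nv) : injective h ->
    G [set i in codom h]%SET = wedge_sum (cut_entry A) (vertex_of \o h) n.
  move=> hI; rewrite /G det_minor_mxsub// coef_det; apply: eq_bigr => m _.
  congr determinant; apply/matrixP => a b; rewrite !mxE operator_mx_coef//.
  by apply: leq_trans nN; rewrite -ltnS.
have G0 (S : {set 'I_nv}) : (n < #|S|)%N -> G S = 0.
  move=> nS; have -> : S = [set i in codom (@enum_val _ (mem S))]%SET.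
    apply/setP => i; rewrite inE; apply/idP/codomP => [iS|[a ->]]; last exact: enum_valP.
    by exists (enum_rank_in iS i); rewrite enum_rankK_in.
  by rewrite GE; [apply: wedge_sum_eq0|exact: enum_val_inj].
rewrite -[LHS]/(\sum_S G S).
have -> : \sum_S G S = \sum_(k < n.+1) \sum_(S : {set 'I_nv} | #|S| == k) G S.
  under [RHS]eq_bigr do rewrite big_mkcond.
  rewrite exchange_big/=; apply: eq_bigr => S _.
  have [nS|Sn] := ltnP n #|S|; first by rewrite G0// big1// => k _; case: ifP.
  rewrite (bigD1 (Ordinal (Sn : (#|S| < n.+1)%N)))//= eqxx big1 ?addr0// => k kS.
  by case: eqP => // E; case/eqP: kS; apply: val_inj.
apply: eq_bigr => -[k kn] _ /=.
pose D := [set S' : ksubset V k | (val S' `<=` cut_vertices)%fset].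
have Dfin : finite_set D.
  apply: (@sub_finite_set _ _ (val @^-1` [set` fpowerset cut_vertices])).
    by move=> S' /=; rewrite fpowersetE.
  by apply: finite_preimage => [? ? _ _|]; [exact: val_inj|exact: finite_fset].
rewrite (@isum_fset _ _ _ (fset_set D)); last first.
  move=> S' S'D; have /fsubsetPn[x xS xA] : ~~ (val S' `<=` cut_vertices)%fset.
    by apply: contra S'D => H; rewrite in_fset_set// inE.
  have /tnthP[a aE] : x \in Tuple (valP S') by [].
  rewrite /wedge_sum big1// => m _; rewrite (expand_det_row _ a) big1// => b _.
  by rewrite mxE cut_entry_notin ?mul0r// /ksubset_enum -aE.
(* [phi] is a bijection from the k-subsets of [cut_vertices] to the k-subsets of row indices. *)
pose phi (S' : ksubset V k) := [set i | vertex_of i \in val S']%SET.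
have phiG S' : S' \in D -> G (phi S') = wedge_sum (cut_entry A) (ksubset_enum S') n.
  rewrite inE => S'A.
  (* [h] lists the rows in the order of [ksubset_enum], so that the minor matches the wedge term
     entry by entry. *)
  have /choice[h hE] a : exists i, vertex_of i = ksubset_enum S' a.
    by apply: vertex_of_surj; move/fsubsetP: S'A; apply; exact: mem_tnth.
  have hI : injective h.
    move=> a b /(congr1 vertex_of); rewrite !hE.
    have /tuple_uniqP eI : uniq (Tuple (valP S')) by exact: fset_uniq.
    exact: eI.
  rewrite (_ : phi S' = [set i in codom h]%SET) ?GE//.
    by congr wedge_sum; apply/funext => a; exact: hE.
  apply/setP => i; rewrite !inE; apply/idP/codomP => [iS|[a ->]]; last first.
    by rewrite hE; exact: mem_tnth.
  have /tnthP[a aE] : vertex_of i \in Tuple (valP S') by [].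
  by exists a; apply: vertex_of_inj; rewrite hE.
transitivity (\sum_(S <- [seq phi S' | S' <- fset_set D]) G S); last first.
  rewrite big_map big_seq [RHS]big_seq; apply: eq_bigr => S'.
  by rewrite in_fset_set// => /phiG.
rewrite -big_filter; apply: perm_big; apply: uniq_perm.
- by rewrite filter_uniq// index_enum_uniq.
- rewrite map_inj_in_uniq ?fset_uniq// => S1 S2.
  rewrite !in_fset_set// !inE => /fsubsetP H1 /fsubsetP H2 E.
  apply/val_inj/fsetP => v; apply/idP/idP => vS.
    have [x xE] := vertex_of_surj (H1 v vS).
    by have := congr1 (fun S : {set 'I_nv} => x \in S) E; rewrite !inE xE vS => <-.
  have [x xE] := vertex_of_surj (H2 v vS).
  by have := congr1 (fun S : {set 'I_nv} => x \in S) E; rewrite !inE xE vS => ->.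
- move=> S; rewrite mem_filter mem_index_enum andbT.
  apply/eqP/mapP => [Sk|[S' S'D ->]].
    pose Q := [fset vertex_of i | i in enum S]%fset.
    have Qk : #|` Q| == k.
      rewrite card_imfset/=; last exact: vertex_of_inj.
      by rewrite undup_id ?enum_uniq// -cardE Sk.
    exists (exist _ Q Qk).
      rewrite in_fset_set// inE /=; apply/fsubsetP => v /imfsetP[i0 /= _ ->].
      exact: vertex_of_mem.
    apply/setP => i; rewrite inE /=; apply/idP/imfsetP => [iS|[j /= + /vertex_of_inj ->]].
      by exists i => //=; rewrite mem_enum.
    by rewrite mem_enum.
  have : #|` val S'| = k by apply/eqP; exact: (valP S').
  move: S'D; rewrite in_fset_set// inE => /fsubsetP S'A <-.
  have -> : val S' = [fset vertex_of i | i in enum (phi S')]%fset.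
    apply/fsetP => v; apply/idP/imfsetP => [vS|[i /=]]; last by rewrite mem_enum inE => + ->.
    have [x xE] := vertex_of_surj (S'A v vS).
    by exists x => //=; rewrite mem_enum inE xE.
  rewrite [RHS]card_imfset/=; last exact: vertex_of_inj.
  by rewrite undup_id ?enum_uniq// -cardE.
Qed.

(** [J] exchanges the two halves of the orientations, so the off-diagonal blocks are diagonal and
    each edge yields one factor with the product of its two weights. *)
Lemma det_J_mx : \det (1%:M + 'X *: map_mx polyC J_mx) =
  \prod_(a <- A) (1 - (edge_weight a)%:C *: 'X^2) :> {poly C}.
Proof.
pose u := \row_j ('X * (wt (erev (half_edge (A := A) j)))%:C%:P) : 'rV[{poly C}]_(size (enum_fset A)).
pose v := \row_j ('X * (wt (half_edge (A := A) j))%:C%:P) : 'rV[{poly C}]_(size (enum_fset A)).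
have halfI : injective (half_edge (A := A)).
  by move=> i j E; apply: tnth_A_inj; rewrite -!und_half E.
have half_ne i j : half_edge (A := A) i <> erev (half_edge (A := A) j).
  move=> E; have ij : i = j by apply: tnth_A_inj; rewrite -!und_half E und_erev.
  by have := erev_neq (half_edge (A := A) j); rewrite -E ij eqxx.
have -> : 1%:M + 'X *: map_mx polyC J_mx = block_mx 1%:M (diag_mx u) (diag_mx v) 1%:M.
  apply/matrixP => i j; rewrite -(fintype.splitK i) -(fintype.splitK j).
  case: (fintype.split i) => a; case: (fintype.split j) => b /=.
  - rewrite block_mxEul !mxE !edge_of_l (inj_eq (@lshift_inj _ _)).
    by case: (eqP (x := half_edge b)) => [/half_ne//|_]; rewrite mulr0n mulr0 addr0.
  - rewrite block_mxEur !mxE edge_of_l edge_of_r (inj_eq (@erev_inj R V X)) (inj_eq halfI).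
    rewrite eq_lrshift add0r eq_sym; case: eqP => [->|_]; rewrite ?mulr1n ?mulr0n ?mulr0//.
  - rewrite block_mxEdl !mxE edge_of_l edge_of_r erevK (inj_eq halfI).
    rewrite eq_rlshift add0r eq_sym; case: eqP => [->|_]; rewrite ?mulr1n ?mulr0n ?mulr0//.
  - rewrite block_mxEdr !mxE !edge_of_r erevK (inj_eq (@rshift_inj _ _)).
    case: (eqP (x := erev (half_edge b))) => [/esym/half_ne//|_].
    by rewrite mulr0n mulr0 addr0.
rewrite det_block_diag (big_tuple _ _ (in_tuple (enum_fset A)) xpredT
  (fun a => 1 - (edge_weight a)%:C *: 'X^2 : {poly C})).
apply: eq_bigr => i _; rewrite !mxE -und_half edge_weight_und rmorphM -mul_polyC polyCM.
by congr (_ - _); rewrite expr2; ring.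
Qed.

Lemma edge_det_factor n : (edge_det A)`_n =
  \sum_(k < n.+1) fredholm_sum (cut_entry A) k *
     (\prod_(a <- A) (1 - (edge_weight a)%:C *: 'X^2) : {poly C})`_(n - k).
Proof.
rewrite /edge_det edge_mxE (bass_factorization (N := n) sigma_mx tau_mx J_mx (leqnn n)).
rewrite mulrC coefM det_J_mx; apply: eq_bigr => -[k kn] _ /=.
by rewrite -(@det_cut n).
Qed.

End CutIdentity.

(** Both sides are the limit over [A] of [edge_det_factor], whose right side is a finite sum over k
    and converges term by term. *)
Lemma zeta_coef_factor (R : realType) (V : choiceType) (X : wgraph R V) n :
  zeta_coef X n =
  fps_mul (fredholm_det (@ihara_coef R V X)) (quad_coef (@edge_weight R V X)) n.
Proof.
apply: (totally_cvg_unique (@zeta_coef_lim R V X n)).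
rewrite (_ : (fun A => _) = (fun A : {fset uedge X} =>
   \sum_(k <- index_enum 'I_n.+1) fredholm_sum (cut_entry A) k *
     (\prod_(a <- A) (1 - (edge_weight a)%:C *: 'X^2) : {poly R[i]})`_(n - k) : R[i]^o)); last first.
  by apply/funext => A; exact: edge_det_factor.
apply: cvg_finite_sum => k.
have := @quad_coef_lim R V X (n - k); apply: cvgM.
rewrite fredholm_detE.
apply: (@fredholm_sum_cvg _ _ _ totally _ (fun A => cut_entry A) (@full_entry R V X) (fun x => (1 + total_wt X) ^+ k * out_wt X x) _ k).
- apply: bounded_sumsZ (@out_wt_bounded R V X).
  by rewrite exprn_ge0// addr_ge0// total_wt_ge0.
- by move=> A m x y; exact: cut_entry_bound.
- exact: cut_entry_near.
Qed.

Theorem theorem2p10 (R : realType) (V : choiceType) (X : wgraph R V) :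
  [/\ (\forall u \near (0 : R[i]^o), zeta_converges X u) /\
        (exists F, inverse_zeta X F),
      (forall n, trace_class (ihara_coef X n)),
      (forall F, inverse_zeta X F ->
        forall n, taylor F n =
          fps_mul (fredholm_det (ihara_coef X)) (taylor (edge_prod X)) n)
    & [/\ {family compact,
             (fun (A : {fset uedge X}) (u : R[i]^o) =>
                partial_prod (edge_factor u) A) @ totally --> edge_prod X},
          entire (edge_prod X),
          (forall z, edge_prod X z = 0 <-> exists e : uedge X, edge_zero e z)
        & (forall z, exists A : {fset uedge X},
             (forall e, e \in A <-> edge_zero e z) /\
             zero_of_order (edge_prod X) z #|` A|)]].
Proof.
split.
- split; first exact: zeta_converges_near.
  by exists (fseries (zeta_coef X)); exact: inverse_zeta_fseries.
- exact: ihara_trace_class.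
- move=> F FX n; rewrite (taylor_inverse_zeta n FX) zeta_coef_factor.
  congr fps_mul; apply/funext => m; exact/esym/taylor_edge_prod.
- exact: edge_prod_facts.
Qed.
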